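(* Let $R$ be a principal ideal domain with field of fractions $K$, let $n\ge1$, and let $V=K^{2n}$ with its standard symplectic form. There is a presentation of $\mathrm{St}^\omega_{2n}(K)=\mathrm{St}^\omega(V)$ over $\mathbb Z[\mathrm{Sp}_{2n}(R)]$, i.e. an exact sequence of $\mathbb Z[\mathrm{Sp}_{2n}(R)]$-modules $$V_{1,2}\oplus V_{1,1}\xrightarrow{\ \partial_1\ }V_0\to\mathrm{St}^\omega(V)\to 0,$$ where: - $V_0$ is the direct sum of all $\mathrm{Sh}_0(W_1)\otimes\cdots\otimes\mathrm{Sh}_0(W_n)$, where $V=W_1\oplus\cdots\oplus W_n$ ranges over ordered decompositions into mutually perpendicular genus $1$ symplectic subspaces. - $V_{1,1}$ is the direct sum of all $\mathrm{Sh}_0(W_1)\otimes\cdots\otimes\mathrm{Sh}_1(W_i)\otimes\cdots\otimes\mathrm{Sh}_0(W_n)$ with $1\le i\le n$, where $V=W_1\oplus\cdots\oplus W_n$ ranges over ordered decompositions into mutually perpendicular genus $1$ symplectic subspaces. - $V_{1,2}$ is the direct sum of all $\mathrm{Sh}_0(W_1)\otimes\cdots\otimes\mathrm{Sh}_0(W_{n-1})$, where $V=W_1\oplus\cdots\oplus W_{n-1}$ ranges over ordered decompositions into mutually perpendicular symplectic subspaces, all but one of which have genus $1$ and the remaining one of which has genus $2$. The map $\partial_1$ is as follows. - An element $[\langle v_1\rangle,\langle v_{\bar1}\rangle]\otimes\cdots\otimes[\langle u_i\rangle,\langle v_i\rangle,\langle w_i\rangle]\otimes\cdots\otimes[\langle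 v_n\rangle,\langle v_{\bar n}\rangle]\in V_{1,1}$ maps to $$\begin{aligned}&[\langle v_1\rangle,\langle v_{\bar1}\rangle]\otimes\cdots\otimes[\langle v_i\rangle,\langle w_i\rangle]\otimes\cdots\otimes[\langle v_n\rangle,\langle v_{\bar n}\rangle]\\ -\;&[\langle v_1\rangle,\langle v_{\bar1}\rangle]\otimes\cdots\otimes[\langle u_i\rangle,\langle w_i\rangle]\otimes\cdots\otimes[\langle v_n\rangle,\langle v_{\bar n}\rangle]\\ +\;&[\langle v_1\rangle,\langle v_{\bar1}\rangle]\otimes\cdots\otimes[\langle u_i\rangle,\langle v_i\rangle]\otimes\cdots\otimes[\langle v_n\rangle,\langle v_{\bar n}\rangle].\end{aligned}$$ - An element $[\langle v_1\rangle,\langle v_{\bar1}\rangle]\otimes\cdots\otimes[\langle v_{i,0}\rangle,\langle v_{i,1}\rangle,\langle v_{i,2}\rangle,\langle v_{i,3}\rangle]\otimes\cdots\otimes[\langle v_{n-1}\rangle,\langle v_{\overline{n-1}}\rangle]\in V_{1,2}$, where the $i$-th subspace $W_i$ has genus $2$, maps to the sum, over all pairs $0\le j_1<j_2\le 3$ such that $v_{i,j_1},v_{i,j_2}$ span a genus $1$ symplectic subspace $X$ of $W_i$, of the terms $$(-1)^{\nu}[\langle v_1\rangle,\langle v_{\bar1}\rangle]\otimes\cdots\otimes[\langle w_i\rangle,\langle x_i\rangle]\otimes[\langle y_i\rangle,\langle z_i\rangle]\otimes\cdots\otimes[\langle v_{n-1}\rangle,\langle v_{\overline{n-1}}\rangle],\qquad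 \nu=j_1+j_2+n-1-i,$$ where $w_i=v_{i,j_1}$, $x_i=v_{i,j_2}$, and $y_i,z_i$ are the projections onto $X^\perp\subset W_i$ of the other two vectors among $v_{i,0},\dots,v_{i,3}$, taken in increasing order of index. If $R$ has finitely many units, then tensoring with $\otimes_{\mathbb Z}\mathbb Q$ gives a presentation of $\mathrm{St}^\omega_{2n}(K)\otimes\mathbb Q$ by projective $\mathbb Q[\mathrm{Sp}_{2n}(R)]$-modules.
   Context: A symplectic $K$-vector space is a finite-dimensional vector space with a nondegenerate alternating bilinear form $\omega$; its genus is half its dimension. A subspace is symplectic if $\omega$ restricts to a nondegenerate form on it; $\perp$ denotes orthogonality with respect to $\omega$. The standard symplectic form on $K^{2n}$ has a basis $e_1,e_{\bar1},\dots,e_n,e_{\bar n}$ with $\omega(e_i,e_{\bar i})=-\omega(e_{\bar i},e_i)=1$ and all other pairings $0$. $\mathrm{Sp}_{2n}(R)$ is the group of form-preserving automorphisms of $R^{2n}$; it acts on lines and subspaces of $K^{2n}$. $\mathbb T^\omega(V)$ is the simplicial complex whose $k$-simplices are flags $0\subsetneq V_0\subsetneq\cdots\subsetneq V_k\subset V$ of nonzero isotropic subspaces, and $\mathrm{St}^\omega(V)=\widetilde H_{n-1}(\mathbb T^\omega(V);\mathbb Z)$ for $V$ of genus $n$; $\mathrm{St}^\omega_{2n}(K)=\mathrm{St}^\omega(K^{2n})$. For a finite-dimensional $K$-vector space $W$ and $k\ge0$, $\mathrm{Sh}_k(W)$ is the free abelian group on ordered sets $[\langle v_1\rangle,\dots,\langle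 v_N\rangle]$ of $N=\dim W+k$ lines spanning $W$, modulo $[\langle v_1\rangle,\dots,\langle v_N\rangle]=(-1)^{\mathrm{sgn}(\sigma)}[\langle v_{\sigma(1)}\rangle,\dots,\langle v_{\sigma(N)}\rangle]$ for all permutations $\sigma$ (with $\mathrm{sgn}(\sigma)\in\{0,1\}$ the parity). *)

(* Defs.v *)
From HB Require Import structures.
From mathcomp Require Import all_boot all_order perm all_algebra.
From mathcomp Require Import boolp.
From mathcomp Require Import freeg.

Set Implicit Arguments.
Unset Strict Implicit.
Unset Printing Implicit Defensive.

Import GRing.Theory.
Local Open Scope ring_scope.

Local Notation "[ 'fg' t ]" := (Freeg [:: (1 : int, t)]) (format "[ 'fg'  t ]").

Section AdditiveMaps.
Variables (A B : zmodType) (f : A -> B).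
Hypothesis fB : zmod_morphism f.

Lemma zm0 : f 0 = 0. Proof. by rewrite -{1}(subrr 0) fB subrr. Qed.
Lemma zmN x : f (- x) = - f x. Proof. by rewrite -[- x]add0r fB zm0 add0r. Qed.
Lemma zmD x y : f (x + y) = f x + f y.
Proof. by rewrite -{1}[y]opprK fB zmN opprK. Qed.
Lemma zmMz x (a : int) : f (x *~ a) = f x *~ a.
Proof.
have fn (n : nat) : f (x *+ n) = f x *+ n.
  by elim: n => [|n IHn]; rewrite ?mulr0n ?zm0 // !mulrS zmD IHn.
by case: a => n; rewrite ?NegzE -?pmulrn ?mulrNz ?zmN -?pmulrn fn.
Qed.
End AdditiveMaps.

Lemma int_scaleE (U : lmodType int) (a : int) (u : U) : a *: u = u *~ a.
Proof. by rewrite -scaler_int intz. Qed.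

Lemma zm_linear (U V : lmodType int) (f : U -> V) :
  zmod_morphism f -> linear f.
Proof. by move=> fB a u v; rewrite (zmD fB) !int_scaleE (zmMz fB). Qed.

Section Quotients.
Variables (A : zmodType) (S : A -> Prop).

(* The subgroup of A generated by S. *)
Definition zspan : {pred A} := fun x =>
  `[< forall H : A -> Prop, H 0 -> (forall y z, H y -> H z -> H (y - z)) ->
        (forall y, S y -> H y) -> H x >].

Lemma zspan_gen x : S x -> x \in zspan.
Proof. by move=> Sx; apply/asboolP => H _ _ HS; apply: HS. Qed.

Lemma zspan_zmod : zmod_closed zspan.
Proof.
split=> [|x y /asboolP xS /asboolP yS]; apply/asboolP => H H0 HB HS //.
exact: HB (xS _ H0 HB HS) (yS _ H0 HB HS).
Qed.

HB.instance Definition _ := GRing.isZmodClosed.Build A zspan zspan_zmod.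

Definition zquot : zmodType := Quotient.quot zspan.

Definition zpi (x : A) : zquot := (\pi_(Quotient.quot zspan) x)%qT.
Definition zrepr (x : zquot) : A := repr (x : Quotient.quot zspan).

Lemma zreprK x : zpi (zrepr x) = x.
Proof. exact: reprK. Qed.

Lemma zpiB : zmod_morphism zpi.
Proof. exact: (@pi_is_zmod_morphism _ _ _ (Quotient.quot zspan)). Qed.

Lemma zpi_eq x y : zpi x = zpi y <-> x - y \in zspan.
Proof.
rewrite /zpi; split=> [/eqP|xy]; first by rewrite -Quotient.idealrBE.
by apply/eqP; rewrite -Quotient.idealrBE.
Qed.

Lemma zspan_kills (B : zmodType) (f : A -> B) x :
  zmod_morphism f -> (forall s, S s -> f s = 0) -> x \in zspan -> f x = 0.
Proof.
move=> fB fS /asboolP/(_ (fun y => f y = 0)); apply=> //; first exact: zm0.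
by move=> y z fy fz; rewrite fB fy fz subrr.
Qed.

Lemma zquot_factor (B : zmodType) (f : A -> B) x :
  zmod_morphism f -> (forall s, S s -> f s = 0) -> f (zrepr (zpi x)) = f x.
Proof.
move=> fB fS; apply/eqP; rewrite -subr_eq0 -fB; apply/eqP.
by apply: zspan_kills => //; apply/zpi_eq; rewrite zreprK.
Qed.

Lemma zquot_factorB (B : zmodType) (f : A -> B) :
  zmod_morphism f -> (forall s, S s -> f s = 0) -> zmod_morphism (f \o zrepr).
Proof.
move=> fB fS x y /=.
by rewrite -{1}[x]zreprK -{1}[y]zreprK -zpiB zquot_factor.
Qed.
End Quotients.

Section Free.
Variables (T : choiceType) (B : zmodType) (f : T -> B).

(* The additive extension of f to the free abelian group on T. *)
Definition fgext (x : {freeg T / int}) : B := fglift (f : T -> zmodule B) x.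

Lemma fgextB : zmod_morphism fgext.
Proof. exact: (@lift_is_additive _ _ (zmodule B)). Qed.

Lemma fgextU a t : fgext (Freeg [:: (a, t)]) = f t *~ a.
Proof. by rewrite /fgext liftU. Qed.
End Free.

Lemma fg_ind (T : choiceType) (H : {freeg T / int} -> Prop) :
  H 0 -> (forall x y, H x -> H y -> H (x - y)) -> (forall t, H [fg t]) ->
  forall x, H x.
Proof.
move=> H0 HB Hg x; rewrite -[x]freeg_sumE.
have HN y : H y -> H (- y) by rewrite -[- y]sub0r; apply: HB.
have HD y z : H y -> H z -> H (y + z).
  by move=> Hy Hz; rewrite -[z]opprK; apply: HB (HN _ _).
apply: big_ind => // t _; move: (coeff t x) => a.
have Hn (n : nat) : H (Freeg [:: (n%:Z, t)]).
  elim: n => [|n IHn]; first by rewrite freegU0.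
  by rewrite -addn1 PoszD -freegUD; apply: HD.
by case: a => n //; rewrite NegzE -freegUN; apply: HN.
Qed.

Section Presented.
Variables (T : choiceType) (S : {freeg T / int} -> Prop).

(* The abelian group with generators T and relations S. *)
Definition presented : zmodType := zquot S.

Definition pgen (t : T) : presented := zpi S [fg t].

(* The map induced by f; meaningful when fgext f vanishes on S. *)
Definition plift (B : zmodType) (f : T -> B) (x : presented) : B :=
  fgext f (zrepr x).

Section Lift.
Variables (B : zmodType) (f : T -> B).
Hypothesis fS : forall s, S s -> fgext f s = 0.

Lemma pliftB : zmod_morphism (plift f).
Proof. exact: (zquot_factorB (@fgextB _ _ f) fS). Qed.

Lemma plift_gen t : plift f (pgen t) = f t.
Proof. by rewrite /plift (zquot_factor _ (@fgextB _ _ f) fS) fgextU. Qed.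
End Lift.

Lemma presented_ind (H : presented -> Prop) :
  H 0 -> (forall x y, H x -> H y -> H (x - y)) -> (forall t, H (pgen t)) ->
  forall x, H x.
Proof.
move=> H0 HB Hg x; rewrite -[x]zreprK.
elim/fg_ind: (zrepr x) => [|y z Hy Hz|t]; last exact: Hg.
  by rewrite (zm0 (@zpiB _ S)).
by rewrite (@zpiB _ S); apply: HB.
Qed.

Lemma presented_ext (B : zmodType) (f g : presented -> B) :
  zmod_morphism f -> zmod_morphism g ->
  (forall t, f (pgen t) = g (pgen t)) -> f =1 g.
Proof.
move=> fB gB fg; elim/presented_ind => [|x y ex ey|t]; last exact: fg.
  by rewrite (zm0 fB) (zm0 gB).
by rewrite fB gB ex ey.
Qed.
End Presented.

Section TensorProduct.
Variables (I : finType) (A : I -> zmodType).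

Variant tensor_rel : {freeg (forall i, A i) / int} -> Prop :=
  TensorRel i (a : forall j, A j) (x y : A i) :
    tensor_rel ([fg dfwith a (x + y)] - [fg dfwith a x] - [fg dfwith a y]).

(* The tensor product over Z of the family A. *)
Definition tensor : zmodType := presented tensor_rel.

Definition tmul (a : forall i, A i) : tensor := pgen tensor_rel a.
End TensorProduct.

Lemma dfwith_comp (I : finType) (A B : I -> Type) (h : forall i, A i -> B i)
    i (a : forall i, A i) (x : A i) :
  (fun j => h j (dfwith a x j)) = dfwith (fun j => h j (a j)) (h i x).
Proof.
apply: functional_extensionality_dep => j.
case: dfwithP => [|j' ij']; first by rewrite dfwith_in.
by rewrite dfwith_out.
Qed.

Section TensorTheory.
Variables (I : finType) (A B : I -> zmodType).

Lemma tmulB i (a : forall i, A i) :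
  zmod_morphism (fun x : A i => tmul (dfwith a x)).
Proof.
have D (x y : A i) :
    tmul (dfwith a (x + y)) = tmul (dfwith a x) + tmul (dfwith a y).
  apply/eqP; rewrite -subr_eq0 opprD addrA -!(@zpiB _ (@tensor_rel I A)).
  rewrite -(zm0 (@zpiB _ (@tensor_rel I A))); apply/eqP/zpi_eq; rewrite subr0.
  exact: zspan_gen.
by move=> x y; apply/eqP; rewrite eq_sym subr_eq -D subrK.
Qed.

(* The tensor product of the maps h i. *)
Definition tmap (h : forall i, A i -> B i) : tensor A -> tensor B :=
  plift (fun a => tmul (fun i => h i (a i))).
End TensorTheory.

Section TensorMap.
Variables (I : finType) (A B : I -> zmodType) (h : forall i, A i -> B i).
Hypothesis hB : forall i, zmod_morphism (@h i).

Lemma tmap_kills s : tensor_rel s -> fgext (fun a => tmul (fun i => @h i (a i))) s = 0.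
Proof.
case=> i a x y; rewrite !(@fgextB _ _) !fgextU !mulr1z !(dfwith_comp (@h)).
rewrite (zmD (@hB i)) (zmD (@tmulB _ B i _)) -addrA -opprD subrr //.
Qed.

Lemma tmapB : zmod_morphism (tmap (@h)).
Proof. exact/pliftB/tmap_kills. Qed.

Lemma tmap_tmul a : tmap (@h) (tmul a) = tmul (fun i => @h i (a i)).
Proof. exact/plift_gen/tmap_kills. Qed.
End TensorMap.

Section DirectSum.
Variables (D : choiceType) (M : D -> zmodType).

Variant dsum_rel : {freeg {d : D & M d} / int} -> Prop :=
  DsumRel d (x y : M d) :
    dsum_rel ([fg Tagged M (x + y)] - [fg Tagged M x] - [fg Tagged M y]).

(* The direct sum of the family M, as the coproduct of abelian groups. *)
Definition dsum : zmodType := presented dsum_rel.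

Definition din d (x : M d) : dsum := pgen dsum_rel (Tagged M x).

Lemma dinB d : zmod_morphism (@din d).
Proof.
have E (x y : M d) : din (x + y) = din x + din y.
  apply/eqP; rewrite -subr_eq0 opprD addrA -!(@zpiB _ dsum_rel).
  rewrite -(zm0 (@zpiB _ dsum_rel)); apply/eqP/zpi_eq; rewrite subr0.
  exact: zspan_gen.
by move=> x y; apply/eqP; rewrite eq_sym subr_eq -E subrK.
Qed.
End DirectSum.

Section DirectSumMap.
Variables (D D' : choiceType) (M : D -> zmodType) (M' : D' -> zmodType).
Variables (h : D -> D') (F : forall d, M d -> M' (h d)).

(* The map sending the summand d to the summand h d by F d. *)
Definition dsum_map : dsum M -> dsum M' :=
  plift (fun x : {d : D & M d} => din (F (tagged x))).

Hypothesis FB : forall d, zmod_morphism (@F d).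

Lemma dsum_map_kills s : dsum_rel s ->
  fgext (fun x : {d : D & M d} => din (F (tagged x))) s = 0.
Proof.
case=> d x y; rewrite !(@fgextB _ _) !fgextU !mulr1z /=.
by rewrite (zmD (@FB d)) (zmD (@dinB _ _ _)) -addrA -opprD subrr.
Qed.

Lemma dsum_mapB : zmod_morphism dsum_map.
Proof. exact/pliftB/dsum_map_kills. Qed.

Lemma dsum_map_din d (x : M d) : dsum_map (din x) = din (F x).
Proof. by rewrite /dsum_map /din plift_gen //; apply: dsum_map_kills. Qed.
End DirectSumMap.

Section RationalExtension.
Variable A : zmodType.

Variant rext_rel : {freeg (A * rat)%type / int} -> Prop :=
  | RextL a b q : rext_rel ([fg (a + b, q)] - [fg (a, q)] - [fg (b, q)])
  | RextR a q r : rext_rel ([fg (a, q + r)] - [fg (a, q)] - [fg (a, r)]).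

(* The tensor product of A and rat over Z. *)
Definition rext := presented rext_rel.
HB.instance Definition _ := GRing.Zmodule.on rext.

Definition rgen (a : A) (q : rat) : rext := pgen rext_rel (a, q).

Lemma rgenDl a b q : rgen (a + b) q = rgen a q + rgen b q.
Proof.
apply/eqP; rewrite -subr_eq0 opprD addrA -!(@zpiB _ rext_rel).
rewrite -(zm0 (@zpiB _ rext_rel)); apply/eqP/zpi_eq; rewrite subr0.
exact: zspan_gen (RextL a b q).
Qed.

Lemma rgenDr a q r : rgen a (q + r) = rgen a q + rgen a r.
Proof.
apply/eqP; rewrite -subr_eq0 opprD addrA -!(@zpiB _ rext_rel).
rewrite -(zm0 (@zpiB _ rext_rel)); apply/eqP/zpi_eq; rewrite subr0.
exact: zspan_gen (RextR a q r).
Qed.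

Lemma rext_kills (B : zmodType) (f : A -> rat -> B) :
  (forall a b q, f (a + b) q = f a q + f b q) ->
  (forall a q r, f a (q + r) = f a q + f a r) ->
  forall s, rext_rel s -> fgext (fun x => f x.1 x.2) s = 0.
Proof.
move=> fl fr s [a b q|a q r]; rewrite !(@fgextB _ _) !fgextU !mulr1z /=.
  by rewrite fl -addrA -opprD subrr.
by rewrite fr -addrA -opprD subrr.
Qed.

Definition rscale (q : rat) : rext -> rext :=
  plift (fun x => rgen x.1 (q * x.2)).

Let rscale_kills q s : rext_rel s -> fgext (fun x => rgen x.1 (q * x.2)) s = 0.
Proof.
apply: (rext_kills (f := fun a r => rgen a (q * r))) => *.
  exact: rgenDl.
by rewrite mulrDr rgenDr.
Qed.

Lemma rscaleB q : zmod_morphism (rscale q).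
Proof. exact/pliftB/rscale_kills. Qed.

Lemma rscale_rgen q a r : rscale q (rgen a r) = rgen a (q * r).
Proof. exact/plift_gen/rscale_kills. Qed.

Lemma rscaleA q r x : rscale q (rscale r x) = rscale (q * r) x.
Proof.
move: x; apply: presented_ext => [x y|x y|[a s]]; rewrite ?rscaleB //.
by rewrite !rscale_rgen mulrA.
Qed.

Lemma rscale1 : left_id 1 rscale.
Proof.
move=> x; apply: (presented_ext (g := id)) => [y z|y z|[a s]] //.
  exact: rscaleB.
by rewrite rscale_rgen mul1r.
Qed.

Lemma rscaleDr : right_distributive rscale +%R.
Proof. by move=> q x y; rewrite (zmD (@rscaleB q)). Qed.

Lemma rscaleDl x : {morph rscale^~ x : q r / q + r}.
Proof.
move=> q r; apply: (presented_ext (g := fun x => rscale q x + rscale r x)).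
- exact: rscaleB.
- by move=> y z; rewrite !rscaleB opprD addrACA.
- by case=> a s; rewrite !rscale_rgen mulrDl rgenDr.
Qed.

HB.instance Definition _ :=
  GRing.Zmodule_isLmodule.Build rat rext rscaleA rscale1 rscaleDr rscaleDl.
End RationalExtension.

Section RationalMap.
Variables (A B : zmodType) (f : A -> B).

(* The map induced by f after tensoring with rat. *)
Definition rmap : rext A -> rext B := plift (fun x => rgen (f x.1) x.2).

Hypothesis fB : zmod_morphism f.

Let rmap_kills s : rext_rel s -> fgext (fun x => rgen (f x.1) x.2) s = 0.
Proof.
apply: (rext_kills (f := fun a r => rgen (f a) r)) => *.
  by rewrite (zmD fB) rgenDl.
exact: rgenDr.
Qed.

Lemma rmapB : zmod_morphism rmap.
Proof. exact/pliftB/rmap_kills. Qed.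

Lemma rmap_rgen a q : rmap (rgen a q) = rgen (f a) q.
Proof. exact/plift_gen/rmap_kills. Qed.

Lemma rmap_linear : linear rmap.
Proof.
move=> q x y; rewrite (zmD rmapB); congr (_ + _).
move: x; apply: presented_ext => [x z|x z|[a r]].
- by rewrite scalerBr rmapB.
- by rewrite rmapB scalerBr.
- by rewrite /GRing.scale /= rscale_rgen !rmap_rgen rscale_rgen.
Qed.
End RationalMap.

Section GroupModules.
Variables (k : nzRingType) (G : groupType).

(* A k[G]-module, as a k-module with a k-linear action of G. *)
Record gmodule := GModule {
  gmod_sort :> lmodType k;
  gact : G -> gmod_sort -> gmod_sort;
  gact_linear : forall g, linear (gact g);
  gact1 : forall x, gact 1%g x = x;
  gactM : forall g h x, gact (g * h)%g x = gact g (gact h x)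
}.

Record ghom (M N : gmodule) := GHom {
  ghom_fun :> M -> N;
  ghom_linear : linear ghom_fun;
  ghom_act : forall g x, ghom_fun (gact g x) = gact g (ghom_fun x)
}.

(* Exactness of V1 -> V0 -> M -> 0. *)
Definition presentation (V1 V0 M : gmodule) (d : ghom V1 V0) (e : ghom V0 M) :=
  (forall z, exists y, e y = z) /\ (forall y, e y = 0 <-> exists x, d x = y).

Definition projective (P : gmodule) :=
  forall (M N : gmodule) (p : ghom M N) (f : ghom P N),
    (forall y, exists x, p x = y) ->
  exists h : ghom P M, forall x, p (h x) = f x.

Section Product.
Variables M N : gmodule.

Definition gprod_act g (x : M * N) := (gact g x.1, gact g x.2).

Lemma gprod_linear g : linear (gprod_act g).
Proof. by move=> a x y; rewrite /gprod_act /= !gact_linear. Qed.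
Lemma gprod_act1 x : gprod_act 1%g x = x.
Proof. by case: x => x y; rewrite /gprod_act !gact1. Qed.
Lemma gprod_actM g h x : gprod_act (g * h)%g x = gprod_act g (gprod_act h x).
Proof. by rewrite /gprod_act !gactM. Qed.

Definition gprod :=
  @GModule (M * N)%type gprod_act gprod_linear gprod_act1 gprod_actM.
End Product.
End GroupModules.

Section RationalModules.
Variables (G : groupType).

Lemma gactB (k : nzRingType) (M : gmodule k G) g : zmod_morphism (@gact _ _ M g).
Proof. exact/zmod_morphism_linear/gact_linear. Qed.

Lemma ghomB (k : nzRingType) (M N : gmodule k G) (f : ghom M N) : zmod_morphism f.
Proof. exact/zmod_morphism_linear/ghom_linear. Qed.

Definition zgmodule (A : zmodType) (act : G -> A -> A)
    (actB : forall g, zmod_morphism (act g))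
    (act1 : forall x, act 1%g x = x)
    (actM : forall g h x, act (g * h)%g x = act g (act h x)) : gmodule int G :=
  @GModule int G (zmodule A) act
    (fun g => @zm_linear (zmodule A) (zmodule A) (act g) (actB g)) act1 actM.

Section Module.
Variable M : gmodule int G.

Definition grext_act g : rext M -> rext M := rmap (gact g).

Lemma grext_linear g : linear (grext_act g).
Proof. exact/rmap_linear/gactB. Qed.

Lemma grext_act1 x : grext_act 1%g x = x.
Proof.
apply: (presented_ext (g := id)) x => [||[a q]] //; first exact/rmapB/gactB.
by rewrite /grext_act rmap_rgen ?gact1 //; exact: gactB.
Qed.

Lemma grext_actM g h x : grext_act (g * h)%g x = grext_act g (grext_act h x).
Proof.
have B := fun u => rmapB (@gactB _ M u).
have E := fun u => rmap_rgen (@gactB _ M u).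
apply: (presented_ext (g := fun x => grext_act g (grext_act h x))) x => [||[a q]].
- exact: B.
- by move=> x y; rewrite /grext_act !B.
- by rewrite /grext_act !E gactM.
Qed.

Definition grext : gmodule rat G := GModule grext_linear grext_act1 grext_actM.
End Module.

Section Hom.
Variables (M N : gmodule int G) (f : ghom M N).

Lemma grmap_act g (x : grext M) : rmap f (gact g x) = gact g (rmap f x : grext N).
Proof.
have fB := rmapB (@ghomB _ _ _ f).
have B := fun P : gmodule int G => rmapB (@gactB _ P g).
apply: (presented_ext (f := fun x : rext M => rmap f (rmap (gact g) x))
          (g := fun x => rmap (gact g) (rmap f x))) x => [x y|x y|[a q]].
- by rewrite B fB.
- by rewrite fB B.
- by rewrite !rmap_rgen ?ghom_act //; first [exact: gactB|exact: ghomB].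
Qed.

Definition grmap : ghom (grext M) (grext N) :=
  @GHom rat G (grext M) (grext N) (rmap f) (rmap_linear (@ghomB _ _ _ f)) grmap_act.
End Hom.
End RationalModules.

Section Sharblies.
Variables (K : fieldType) (V : vectType K).

(* s is an ordered set of dim W + k lines spanning W. *)
Definition is_frame (k : nat) (W : {vspace V}) (s : seq {vspace V}) : bool :=
  [&& size s == (\dim W + k)%N, uniq s, all (fun L => \dim L == 1%N) s
    & (\sum_(L <- s) L)%VS == W].

Definition frame k W := {s : seq {vspace V} | is_frame k W s}.

(* The relation s = (-1)^sgn(sigma) (s o sigma). *)
Variant sh_rel k W : {freeg (frame k W) / int} -> Prop :=
  ShRel (s t : frame k W) N (sigma : 'S_N) of size (val s) = N
      & val t = [seq nth 0%VS (val s) (sigma i) | i <- enum 'I_N] :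
    sh_rel ([fg s] - Freeg [:: ((-1) ^+ sigma, t)]).

Definition Sh k W : zmodType := presented (@sh_rel k W).

(* The class of s in Sh_k(W); by convention 0 when s is not a frame. *)
Definition shgen k W (s : seq {vspace V}) : Sh k W :=
  oapp (pgen (@sh_rel k W)) 0 (insub s).

Section Blocks.
Variables (m : nat) (P : ('I_m -> nat) -> ('I_m -> {vspace V}) -> Prop).

Definition block :=
  {b : ('I_m -> nat) * ('I_m -> {vspace V}) | `[< P b.1 b.2 >]}.

Definition shtens (k : 'I_m -> nat) (W : 'I_m -> {vspace V}) : zmodType :=
  tensor (fun i => Sh (k i) (W i)).

(* The direct sum, over all (k, W) satisfying P, of the tensor products
   Sh_(k 0)(W 0) (x) ... (x) Sh_(k (m-1))(W (m-1)). *)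
Definition shsum : zmodType := dsum (fun b : block => shtens (val b).1 (val b).2).

(* The element [s 0] (x) ... (x) [s (m-1)] of the summand of index (k, W);
   by convention 0 when there is no such summand. *)
Definition shelt k W (s : 'I_m -> seq {vspace V}) : shsum :=
  oapp (fun b : block =>
          din (M := fun b : block => shtens (val b).1 (val b).2)
            (tmul (fun i => shgen ((val b).1 i) ((val b).2 i) (s i))))
       0 (insub (k, W)).

Lemma sheltE k W s (kW : `[< P k W >]) :
  shelt k W s =
  din (M := fun b : block => shtens (val b).1 (val b).2)
      (d := exist (fun b => `[< P b.1 b.2 >]) (k, W) kW)
      (tmul (fun i => shgen (k i) (W i) (s i))).
Proof. by rewrite /shelt (insubT (fun b => `[< P b.1 b.2 >]) (x := (k, W)) kW). Qed.

Lemma shsum_ind (H : shsum -> Prop) :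
  H 0 -> (forall x y, H x -> H y -> H (x - y)) ->
  (forall k W s, P k W -> (forall i, is_frame (k i) (W i) (s i)) ->
     H (shelt k W s)) ->
  forall x, H x.
Proof.
move=> H0 HB Hg; apply: presented_ind => //; case=> b x.
change (H (din (M := fun b : block => shtens (val b).1 (val b).2) x)).
move: x; apply: presented_ind => [|x y Hx Hy|].
- by rewrite (zm0 (@dinB _ _ _)).
- by rewrite (@dinB _ _ _); apply: HB.
case: b => -[k W] kW /= a; rewrite -/(tmul _).
suff: forall (r : seq 'I_m) (a : forall i, Sh (k i) (W i)),
    (forall i, i \notin r -> exists t, a i = pgen _ t) ->
    H (din (M := fun b : block => shtens (val b).1 (val b).2)
      (d := exist (fun b => `[< P b.1 b.2 >]) (k, W) kW) (tmul a)).
  by move/(_ (enum 'I_m)); apply=> i; rewrite mem_enum.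
elim=> [|j r IHr] {}a aP.
  pose s i := sval (cid (aP i isT)).
  have sP i : a i = pgen (@sh_rel _ _) (s i) := svalP (cid (aP i isT)).
  have := Hg k W (fun i => val (s i)) (asboolW kW) (fun i => valP (s i)).
  rewrite (sheltE _ kW) (_ : (fun i => shgen (k i) (W i) (val (s i))) = a) //.
  apply: functional_extensionality_dep => i.
  by rewrite sP /shgen valK.
have -> : a = dfwith a (a j).
  apply: functional_extensionality_dep => i.
  by case: dfwithP.
elim/presented_ind: (a j) => [|x y Hx Hy|t].
- by rewrite (zm0 (tmulB _)) (zm0 (@dinB _ _ _)).
- by rewrite (tmulB _) (@dinB _ _ _); apply: HB.
apply: IHr => i ir; case: dfwithP ir => [_|i' ji' i'r]; first by exists t.
by apply: aP; rewrite in_cons negb_or eq_sym ji'.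
Qed.

End Blocks.
End Sharblies.

Section Maps.
Variables (K : fieldType) (V : vectType K).

Definition limgs (f : 'End(V)) (s : seq {vspace V}) := [seq (f @: L)%VS | L <- s].

(* The map Sh_k(W) -> Sh_k(f(W)) induced by f. *)
Definition shmap (f : 'End(V)) k W : Sh k W -> Sh k (f @: W)%VS :=
  plift (fun t => shgen k (f @: W) (limgs f (val t))).

Section Injective.
Variable f : 'End(V).
Hypothesis f_inj : lker f == 0%VS.

Lemma limg_dim (U : {vspace V}) : \dim (f @: U) = \dim U.
Proof. by apply: limg_dim_eq; rewrite (eqP f_inj) capv0. Qed.

Lemma limg_inj : injective (fun U => (f @: U)%VS).
Proof. by move=> U W /eqP; rewrite eq_limg_ker0 // => /eqP. Qed.

Lemma is_frame_limgs k W s : is_frame k (f @: W) (limgs f s) = is_frame k W s.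
Proof.
rewrite /is_frame size_map limg_dim (map_inj_uniq limg_inj) all_map big_map.
congr [&& _, _, _ & _]; first by apply: eq_all => U /=; rewrite limg_dim.
by rewrite -limg_sum eq_limg_ker0.
Qed.

Lemma shgen_perm k W (s t : seq {vspace V}) N (sigma : 'S_N) : size s = N ->
  is_frame k W s -> is_frame k W t ->
  t = [seq nth 0%VS s (sigma i) | i <- enum 'I_N] ->
  shgen k W s = shgen k W t *~ ((-1) ^+ sigma).
Proof.
move=> sN sW tW Et; rewrite /shgen !insubT /=.
apply/eqP; rewrite -subr_eq0 /pgen -(zmMz (@zpiB _ (@sh_rel _ V k W))) -zpiB.
rewrite -(zm0 (@zpiB _ (@sh_rel _ V k W))); apply/eqP/zpi_eq; rewrite subr0.
apply: zspan_gen; rewrite freeg_mulz intz; exact: (ShRel (s := Sub s sW) (t := Sub t tW) sN Et).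
Qed.

Lemma shmap_kills k W x : sh_rel x ->
  fgext (fun t : frame k W => shgen k (f @: W) (limgs f (val t))) x = 0.
Proof.
case=> s t N sigma sN Et; rewrite (@fgextB _ _) !fgextU mulr1z.
rewrite (@shgen_perm k (f @: W)%VS (limgs f (val s)) (limgs f (val t)) N sigma) ?subrr //.
- by rewrite size_map.
- by rewrite is_frame_limgs (valP s).
- by rewrite is_frame_limgs (valP t).
rewrite Et /limgs -map_comp; apply: eq_map => i /=.
by rewrite (nth_map 0%VS) // sN.
Qed.

Lemma shmapB k W : zmod_morphism (@shmap f k W).
Proof. exact/pliftB/shmap_kills. Qed.

Lemma shmap_shgen k W s : is_frame k W s ->
  shmap f (shgen k W s) = shgen k (f @: W) (limgs f s).
Proof.
move=> sW; rewrite {1}/shgen insubT /=.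
by rewrite /shmap plift_gen //; apply: shmap_kills.
Qed.
End Injective.

Section Blocks.
Variables (m : nat) (P : ('I_m -> nat) -> ('I_m -> {vspace V}) -> Prop).
Variable f : 'End(V).
Hypothesis Pf : forall k W, P k W -> P k (fun i => (f @: W i)%VS).

Lemma block_img_subproof (b : block P) :
  `[< P (val b).1 (fun i => (f @: (val b).2 i)%VS) >].
Proof. exact: asboolT (Pf (asboolW (valP b))). Qed.

Definition block_img (b : block P) : block P :=
  exist (fun b => `[< P b.1 b.2 >])
    ((val b).1, fun i => (f @: (val b).2 i)%VS) (block_img_subproof b).

Definition shsum_map : shsum P -> shsum P :=
  dsum_map (h := block_img) (fun b => tmap (fun i => @shmap f _ ((val b).2 i))).

Hypothesis f_inj : lker f == 0%VS.

Lemma shsum_mapB : zmod_morphism shsum_map.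
Proof. by apply: dsum_mapB => b; apply: tmapB => i; apply: shmapB. Qed.

Lemma shsum_map_shelt k W s : P k W -> (forall i, is_frame (k i) (W i) (s i)) ->
  shsum_map (shelt P k W s) =
  shelt P k (fun i => (f @: W i)%VS) (fun i => limgs f (s i)).
Proof.
move=> kW sW; rewrite (sheltE _ (asboolT kW)).
rewrite (sheltE _ (block_img_subproof (exist (fun b => `[< P b.1 b.2 >])
  (k, W) (asboolT kW)))).
rewrite /shsum_map dsum_map_din; last by move=> b; apply: tmapB => i; apply: shmapB.
rewrite tmap_tmul /=; last by move=> i; apply: shmapB.
rewrite (_ : (fun i => _) = fun i => shgen (k i) (f @: W i) (limgs f (s i))) //.
apply: functional_extensionality_dep => i.
by rewrite shmap_shgen.
Qed.
End Blocks.
End Maps.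

Section Symplectic.
Variables (K : fieldType) (V : vectType K) (om : {skew_symmetric V}).

Definition isotropic (U : {vspace V}) : bool := (U <= orthov om U)%VS.

(* U is symplectic of genus g. *)
Definition symplectic (g : nat) (U : {vspace V}) : bool :=
  ((U :&: orthov om U)%VS == 0%VS) && (\dim U == g.*2).

(* V is the direct sum of the mutually perpendicular symplectic subspaces W i
   of genera g i. *)
Definition perp_decomp m (g : 'I_m -> nat) (W : 'I_m -> {vspace V}) : Prop :=
  [/\ forall i, symplectic (g i) (W i),
      forall i j, i != j -> (W i <= orthov om (W j))%VS,
      directv (\sum_i W i) & (\sum_i W i)%VS = fullv].

Definition flag (p : nat) (s : seq {vspace V}) : bool :=
  [&& size s == p, sorted (fun U W => (U <= W)%VS && (U != W)) s
    & all (fun U => (U != 0%VS) && isotropic U) s].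

(* The augmented ordered chain complex of the complex of flags of nonzero
   isotropic subspaces: flags of p subspaces are (p - 1)-simplices and live in
   degree p, the empty flag in degree 0 giving the augmentation. *)
Definition chain p : zmodType := {freeg {s | flag p s} / int}.

Definition flgen p (s : seq {vspace V}) : chain p :=
  oapp (fun t : {s | flag p s} => [fg t]) 0 (insub s).

Definition bdry p : chain p -> chain p.-1 :=
  fgext (fun t : {s | flag p s} =>
    \sum_(i < p) flgen p.-1 (take i (val t) ++ drop i.+1 (val t)) *~ ((-1) ^+ i)).

Definition bdry_ker p : {pred chain p} := fun x => bdry x == 0.

Lemma bdryB p : zmod_morphism (@bdry p).
Proof. exact: fgextB. Qed.

Lemma bdry_ker_zmod p : zmod_closed (@bdry_ker p).
Proof.
split=> [|x y /eqP bx /eqP yb]; apply/eqP; first exact: (zm0 (@bdryB p)).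
by rewrite bdryB bx yb subrr.
Qed.
HB.instance Definition _ p := GRing.isZmodClosed.Build _ _ (@bdry_ker_zmod p).

Definition cycle p := {x : chain p | x \in @bdry_ker p}.
HB.instance Definition _ p := SubChoice.on (cycle p).
HB.instance Definition _ p := [SubChoice_isSubZmodule of cycle p by <:].

Definition boundary p (x : cycle p) : Prop := exists y : chain p.+1, val x = bdry y.

(* The reduced homology group in dimension p - 1. *)
Definition rhomology p : zmodType := zquot (@boundary p).

End Symplectic.

Section IsometricActions.
Variables (K : fieldType) (V : vectType K) (om : {skew_symmetric V}).

Definition chain_map (f : 'End(V)) p : chain om p -> chain om p :=
  fgext (fun t : {s | flag om p s} => flgen om p (limgs f (val t))).

(* chain_map f preserves cycles when f is an isometry; the default value 0 is
   then never used. *)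
Definition cycle_map (f : 'End(V)) p (x : cycle om p) : cycle om p :=
  insubd 0 (chain_map f (val x)).

Definition rhomology_map (f : 'End(V)) p (x : rhomology om p) : rhomology om p :=
  zpi _ (cycle_map f (zrepr x)).

Section Isometry.
Variable f : 'End(V).
Hypothesis f_inj : lker f == 0%VS.
Hypothesis f_om : forall u v, om (f u) (f v) = om u v.

Lemma limg_sub_orthov U W : ((f @: U)%VS <= orthov om (f @: W))%VS = (U <= orthov om W)%VS.
Proof.
apply/orthovP/orthovP => UW u v uU vW.
  by rewrite -f_om; apply: UW; apply: memv_img.
by case/memv_imgP: uU vW => {}u uU -> /memv_imgP[{}v vW ->]; rewrite f_om UW.
Qed.

Lemma symplectic_limg g U : symplectic om g U -> symplectic om g (f @: U)%VS.
Proof.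
case/andP=> /eqP U0 dU; rewrite /symplectic limg_dim // dU andbT.
rewrite -subv0; apply/subvP => x; rewrite memv_cap => /andP[/memv_imgP[u uU ->]].
move/mem_orthovP => fu; rewrite memv0.
have: u \in (U :&: orthov om U)%VS.
  rewrite memv_cap uU; apply/mem_orthovP => v vU.
  by rewrite -f_om fu ?memv_img.
by rewrite U0 memv0 => /eqP->; rewrite linear0.
Qed.

Lemma perp_decomp_limg m (g : 'I_m -> nat) W :
  perp_decomp om g W -> perp_decomp om g (fun i => (f @: W i)%VS).
Proof.
case=> W1 W2 W3 W4; have E : (\sum_i (f @: W i) = fullv)%VS.
  by rewrite -limg_sum W4 lker0_limgf.
split=> // [i|i j ij|]; first exact/symplectic_limg.
  by rewrite limg_sub_orthov W2.
rewrite directvE /= E; move: W3; rewrite directvE /= W4 => /eqP->.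
by apply/eqP/eq_bigr => i _; rewrite limg_dim.
Qed.

Lemma flag_limgs p s : flag om p (limgs f s) = flag om p s.
Proof.
rewrite /flag size_map sorted_map all_map; congr [&& _, _ & _].
  apply: eq_sorted => U W /=; rewrite limg_ker0 //.
  by rewrite (inj_eq (limg_inj f_inj)).
apply: eq_all => U /=; rewrite /isotropic limg_sub_orthov.
by rewrite -lkerE (eqP f_inj) subv0.
Qed.

Lemma chain_mapB p : zmod_morphism (@chain_map f p).
Proof. exact: fgextB. Qed.

Lemma chain_map_flgen p s :
  chain_map f (flgen om p s) = flgen om p (limgs f s).
Proof.
rewrite {1}/flgen; case: insubP => [t _ <-|nf] /=.
  by rewrite /chain_map fgextU mulr1z.
by rewrite (zm0 (@chain_mapB p)) /flgen insubF // flag_limgs; apply/negbTE.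
Qed.

Lemma fgen_flgen p (t : {s | flag om p s}) : [fg t] = flgen om p (val t).
Proof. by rewrite /flgen valK. Qed.

Lemma bdry_flgen p (s : seq {vspace V}) : flag om p s ->
  bdry (flgen om p s) =
  \sum_(i < p) flgen om p.-1 (take i s ++ drop i.+1 s) *~ ((-1) ^+ i).
Proof. by move=> sf; rewrite /flgen insubT /= /bdry fgextU mulr1z. Qed.

Lemma bdry_chain_map p (x : chain om p) :
  bdry (chain_map f x) = chain_map f (bdry x).
Proof.
elim/fg_ind: x => [|x y Ex Ey|t].
- by rewrite (zm0 (@chain_mapB p)) (zm0 (@bdryB _ _ _ p)) (zm0 (@chain_mapB p.-1)).
- by rewrite chain_mapB bdryB Ex Ey -chain_mapB -bdryB.
rewrite fgen_flgen chain_map_flgen !bdry_flgen ?flag_limgs ?(valP t) //.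
rewrite (big_morph _ (zmD (@chain_mapB p.-1)) (zm0 (@chain_mapB p.-1))).
apply: eq_bigr => i _; rewrite (zmMz (@chain_mapB p.-1)) chain_map_flgen.
by rewrite /limgs map_cat map_take map_drop.
Qed.

Lemma val_cycle_map p (x : cycle om p) : val (cycle_map f x) = chain_map f (val x).
Proof.
rewrite /cycle_map val_insubd ifT //; apply/eqP.
by rewrite bdry_chain_map (eqP (valP x)) (zm0 (@chain_mapB p.-1)).
Qed.

Lemma cycle_mapB p : zmod_morphism (@cycle_map f p).
Proof.
move=> x y; apply: val_inj.
by rewrite [RHS]raddfB /= !val_cycle_map raddfB /= chain_mapB.
Qed.

Lemma cycle_map_kills p x : boundary x -> zpi (@boundary _ _ om p) (cycle_map f x) = 0.
Proof.
case=> y xy; rewrite -(zm0 (@zpiB _ (@boundary _ _ om p))); apply/zpi_eq.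
rewrite subr0; apply: zspan_gen; exists (chain_map f y).
by rewrite val_cycle_map xy bdry_chain_map.
Qed.

Lemma zpi_cycle_mapB p :
  zmod_morphism (fun x => zpi (@boundary _ _ om p) (cycle_map f x)).
Proof. by move=> x y; rewrite cycle_mapB zpiB. Qed.

Lemma rhomology_mapB p : zmod_morphism (@rhomology_map f p).
Proof. exact: (zquot_factorB (@zpi_cycle_mapB p) (@cycle_map_kills p)). Qed.

Lemma rhomology_map_pi p x :
  rhomology_map f (zpi (@boundary _ _ om p) x) = zpi _ (cycle_map f x).
Proof. exact: (zquot_factor _ (@zpi_cycle_mapB p) (@cycle_map_kills p)). Qed.

End Isometry.

End IsometricActions.

Section EquivariantModules.
Variables (K : fieldType) (V : vectType K) (om : {skew_symmetric V}).
Variable G : groupType.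

(* A linear action of G on V by isometries of om. *)
Record isom_action := IsomAction {
  iact :> G -> 'End(V);
  iact1 : iact 1%g = \1%VF;
  iactM : forall g h, iact (g * h)%g = (iact g \o iact h)%VF;
  iact_om : forall g u v, om (iact g u) (iact g v) = om u v
}.

Variable rho : isom_action.

Lemma iact_inj g : lker (rho g) == 0%VS.
Proof.
apply/lker0P => u v /(congr1 (rho g^-1%g)).
by rewrite -!comp_lfunE -iactM mulVg iact1 !id_lfunE.
Qed.

Lemma limg_iact1 U : (rho 1%g @: U)%VS = U.
Proof. by rewrite iact1 lim1g. Qed.

Lemma limg_iactM g h U : (rho (g * h)%g @: U = rho g @: (rho h @: U))%VS.
Proof. by rewrite iactM limg_comp. Qed.

Lemma limgs_iact1 s : limgs (rho 1%g) s = s.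
Proof. by apply: map_id_in => U _; rewrite limg_iact1. Qed.

Lemma limgs_iactM g h s : limgs (rho (g * h)%g) s = limgs (rho g) (limgs (rho h) s).
Proof.
by rewrite /limgs -map_comp; apply: eq_map => U /=; rewrite limg_iactM.
Qed.

Section Homology.
Variable p : nat.
Implicit Type x : rhomology om p.

Lemma chain_map_iact1 (c : chain om p) : chain_map (rho 1%g) c = c.
Proof.
elim/fg_ind: c => [|c d Ec Ed|t].
- exact: (zm0 (@chain_mapB _ _ _ _ p)).
- by rewrite chain_mapB Ec Ed.
by rewrite fgen_flgen chain_map_flgen ?limgs_iact1 //; [exact: iact_inj|exact: iact_om].
Qed.

Lemma chain_map_iactM g h (c : chain om p) :
  chain_map (rho (g * h)%g) c = chain_map (rho g) (chain_map (rho h) c).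
Proof.
elim/fg_ind: c => [|c d Ec Ed|t].
- by rewrite !(zm0 (@chain_mapB _ _ _ _ p)).
- by rewrite !chain_mapB Ec Ed.
rewrite fgen_flgen !chain_map_flgen ?limgs_iactM //;
  by [apply: iact_inj|apply: iact_om].
Qed.

Definition hact g := @rhomology_map _ _ om (rho g) p.

Lemma hactB g : zmod_morphism (hact g).
Proof. exact: (rhomology_mapB (iact_inj g) (iact_om rho g)). Qed.

Lemma hact_pi g (c : cycle om p) : hact g (zpi _ c) = zpi _ (cycle_map (rho g) c).
Proof. exact: (rhomology_map_pi (iact_inj g) (iact_om rho g)). Qed.

Let val_cyc g (c : cycle om p) : val (cycle_map (rho g) c) = chain_map (rho g) (val c).
Proof. exact: (val_cycle_map (iact_inj g) (iact_om rho g)). Qed.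

Lemma hact1 x : hact 1%g x = x.
Proof.
rewrite -[x]zreprK hact_pi; congr (zpi _ _).
by apply: val_inj; rewrite val_cyc chain_map_iact1.
Qed.

Lemma hactM g h x : hact (g * h)%g x = hact g (hact h x).
Proof.
rewrite -[x]zreprK !hact_pi; congr (zpi _ _).
by apply: val_inj; rewrite !val_cyc chain_map_iactM.
Qed.

Definition homology_module : gmodule int G := zgmodule hactB hact1 hactM.
End Homology.

Section SharblyModules.
Variables (m : nat) (P : ('I_m -> nat) -> ('I_m -> {vspace V}) -> Prop).
Hypothesis PG : forall g k W, P k W -> P k (fun i => (rho g @: W i)%VS).

Definition shact g := shsum_map (PG g).

Lemma shactB g : zmod_morphism (shact g).
Proof. exact/shsum_mapB/iact_inj. Qed.

Lemma shact_shelt g k W s : P k W -> (forall i, is_frame (k i) (W i) (s i)) ->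
  shact g (shelt P k W s) =
  shelt P k (fun i => (rho g @: W i)%VS) (fun i => limgs (rho g) (s i)).
Proof. by move=> *; apply: shsum_map_shelt => //; apply: iact_inj. Qed.

Lemma shact1 x : shact 1%g x = x.
Proof.
elim/shsum_ind: x => [|x y Ex Ey|k W s kW sW].
- exact: (zm0 (@shactB 1%g)).
- by rewrite shactB Ex Ey.
rewrite shact_shelt //; congr shelt; apply: functional_extensionality_dep => i.
  exact: limg_iact1.
exact: limgs_iact1.
Qed.

Lemma shactM g h x : shact (g * h)%g x = shact g (shact h x).
Proof.
elim/shsum_ind: x => [|x y Ex Ey|k W s kW sW].
- by rewrite !(zm0 (@shactB _)).
- by rewrite !shactB Ex Ey.
rewrite !shact_shelt //.
- by congr shelt; apply: functional_extensionality_dep => i;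
    rewrite ?limg_iactM ?limgs_iactM.
- exact: PG.
- by move=> i; rewrite is_frame_limgs //; apply: iact_inj.
Qed.

Definition sharbly_module : gmodule int G := zgmodule shactB shact1 shactM.
End SharblyModules.

End EquivariantModules.

Section StandardForm.
Variables (R : comNzRingType) (n : nat).

(* Coordinates are ordered e_1, ..., e_n, e_bar1, ..., e_barn. *)
Definition stJ : 'M[R]_(n + n) := block_mx 0 1%:M (- 1%:M) 0.

Definition is_sp (A : 'M[R]_(n + n)) : bool := A^T *m stJ *m A == stJ.

Lemma stJ_tr : stJ^T = - stJ.
Proof.
by rewrite /stJ tr_block_mx linearN /= trmx1 !trmx0 opp_block_mx !opprK !oppr0.
Qed.

Lemma stJ_sqr : stJ *m stJ = - 1%:M.
Proof.
rewrite /stJ mulmx_block !mul0mx !mulmx0 !mul1mx !mulmx1 !addr0 !add0r.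
by rewrite scalar_mx_block opp_block_mx oppr0.
Qed.

Definition Sp := {A : 'M[R]_(n + n) | is_sp A}.
HB.instance Definition _ := SubChoice.on Sp.

Lemma is_sp1 : is_sp 1%:M.
Proof. by rewrite /is_sp trmx1 mul1mx mulmx1. Qed.

Lemma is_spM (A B : 'M[R]_(n + n)) : is_sp A -> is_sp B -> is_sp (A *m B).
Proof.
move=> /eqP spA /eqP spB; rewrite /is_sp trmx_mul.
have -> : B^T *m A^T *m stJ *m (A *m B) = B^T *m (A^T *m stJ *m A) *m B.
  by rewrite !mulmxA.
by rewrite spA spB.
Qed.

Definition sp_inv (A : 'M[R]_(n + n)) : 'M[R]_(n + n) := - (stJ *m A^T *m stJ).

Lemma sp_mulV A : is_sp A -> sp_inv A *m A = 1%:M.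
Proof.
move=> /eqP spA; rewrite /sp_inv mulNmx.
have -> : stJ *m A^T *m stJ *m A = stJ *m (A^T *m stJ *m A).
  by rewrite !mulmxA.
by rewrite spA stJ_sqr opprK.
Qed.

Lemma sp_mulrV A : is_sp A -> A *m sp_inv A = 1%:M.
Proof. by move/sp_mulV/mulmx1C. Qed.

Lemma is_spV A : is_sp A -> is_sp (sp_inv A).
Proof.
move=> spA; have /eqP JA := spA; apply/eqP; rewrite -{1}JA.
have -> : (sp_inv A)^T *m (A^T *m stJ *m A) *m sp_inv A
    = (A *m sp_inv A)^T *m stJ *m (A *m sp_inv A) by rewrite trmx_mul !mulmxA.
by rewrite sp_mulrV // trmx1 mul1mx mulmx1.
Qed.

Definition Sp_one : Sp := exist (fun A => is_sp A) _ is_sp1.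
Definition Sp_mul (A B : Sp) : Sp := exist (fun A => is_sp A) _ (is_spM (valP A) (valP B)).
Definition Sp_inv (A : Sp) : Sp := exist (fun A => is_sp A) _ (is_spV (valP A)).

Lemma Sp_mulA : associative Sp_mul.
Proof. by move=> A B C; apply: val_inj; apply: mulmxA. Qed.
Lemma Sp_mul1 : left_id Sp_one Sp_mul.
Proof. by move=> A; apply: val_inj; apply: mul1mx. Qed.
Lemma Sp_mulr1 : right_id Sp_one Sp_mul.
Proof. by move=> A; apply: val_inj; apply: mulmx1. Qed.
Lemma Sp_mulV : left_inverse Sp_one Sp_inv Sp_mul.
Proof. by move=> A; apply: val_inj; apply: sp_mulV (valP A). Qed.
Lemma Sp_mulrV : right_inverse Sp_one Sp_inv Sp_mul.
Proof. by move=> A; apply: val_inj; apply: sp_mulrV (valP A). Qed.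

HB.instance Definition _ :=
  isGroup.Build Sp Sp_mulA Sp_mul1 Sp_mulr1 Sp_mulV Sp_mulrV.

Definition st_form (u v : 'cV[R]_(n + n)) : R := (u^T *m stJ *m v) 0 0.

Lemma st_form_bilinear : bilinear_for
  (GRing.Scale.Law.clone _ _ ( *%R ) _)
  (GRing.Scale.Law.clone _ _ (idfun \; *%R ) _) st_form.
Proof.
split=> [v|u] a x y /=; rewrite /st_form.
  by rewrite linearP /= !mulmxDl -!scalemxAl !mxE.
by rewrite mulmxDr -scalemxAr !mxE.
Qed.

Lemma st_form_skew u v : st_form u v = (-1) ^+ true * idfun (st_form v u).
Proof.
rewrite expr1 mulN1r /st_form -[in LHS](trmxK (u^T *m stJ *m v)) mxE.
by rewrite !trmx_mul trmxK stJ_tr mulmxA mulmxN mulNmx mxE.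
Qed.

HB.instance Definition _ := bilinear_isBilinear.Build R _ _ _
  (GRing.Scale.Law.clone _ _ ( *%R ) _)
  (GRing.Scale.Law.clone _ _ (idfun \; *%R ) _) st_form st_form_bilinear.
HB.instance Definition _ :=
  @isHermitianSesquilinear.Build R _ true idfun st_form st_form_skew.
End StandardForm.

Section StandardModules.
Variables (R : comNzRingType) (K : fieldType) (iota : {rmorphism R -> K}) (n : nat).

Local Notation V := 'cV[K]_(n + n).
Local Notation om := (@st_form K n).

(* Matrices act on column vectors from the left. *)
Definition sp_lfun (A : Sp R n) : 'End(V) := linfun (mulmx (map_mx iota (val A))).

Lemma sp_lfunE A (u : V) : sp_lfun A u = map_mx iota (val A) *m u.
Proof. by rewrite /sp_lfun lfunE. Qed.

Lemma sp_lfun1 : sp_lfun 1%g = \1%VF.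
Proof. by apply/lfunP => u; rewrite sp_lfunE id_lfunE map_mx1 mul1mx. Qed.

Lemma sp_lfunM A B : sp_lfun (A * B)%g = (sp_lfun A \o sp_lfun B)%VF.
Proof. by apply/lfunP => u; rewrite comp_lfunE !sp_lfunE map_mxM mulmxA. Qed.

Lemma sp_lfun_form A (u v : V) : om (sp_lfun A u) (sp_lfun A v) = om u v.
Proof.
rewrite !sp_lfunE /st_form trmx_mul; congr (_ 0 0); set M := map_mx iota _.
have -> : u^T *m M^T *m stJ K n *m (M *m v) = u^T *m (M^T *m stJ K n *m M) *m v.
  by rewrite !mulmxA.
have EJ : map_mx iota (stJ R n) = stJ K n.
  by rewrite /stJ map_block_mx map_mxN !map_mx1 !map_mx0.
by rewrite -EJ map_trmx -!map_mxM (eqP (valP A)).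
Qed.

Definition sp_action : isom_action om (Sp R n) :=
  IsomAction sp_lfun1 sp_lfunM sp_lfun_form.

(* The indices (k, W) of the summands of V_0, V_{1,1} and V_{1,2}. *)
Definition idx0 (k : 'I_n -> nat) (W : 'I_n -> {vspace V}) : Prop :=
  (forall j, k j = 0%N) /\ perp_decomp om (fun=> 1%N) W.

Definition idx11 (k : 'I_n -> nat) (W : 'I_n -> {vspace V}) : Prop :=
  (exists i, forall j, k j = (j == i)) /\ perp_decomp om (fun=> 1%N) W.

Definition idx12 (k : 'I_n.-1 -> nat) (W : 'I_n.-1 -> {vspace V}) : Prop :=
  (forall j, k j = 0%N) /\ exists i, perp_decomp om (fun j => (j == i).+1) W.

Lemma sp_decomp m (g : 'I_m -> nat) A W :
  perp_decomp om g W -> perp_decomp om g (fun i => (sp_action A @: W i)%VS).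
Proof.
by apply: perp_decomp_limg; [apply: iact_inj | apply: iact_om].
Qed.

Lemma idx0G A k W : idx0 k W -> idx0 k (fun i => (sp_action A @: W i)%VS).
Proof. by case=> k0 /(sp_decomp A). Qed.

Lemma idx11G A k W : idx11 k W -> idx11 k (fun i => (sp_action A @: W i)%VS).
Proof. by case=> k0 /(sp_decomp A). Qed.

Lemma idx12G A k W : idx12 k W -> idx12 k (fun i => (sp_action A @: W i)%VS).
Proof. by case=> k0 [i /(sp_decomp A)] ?; split=> //; exists i. Qed.

Definition modV0 : gmodule int (Sp R n) := sharbly_module idx0G.
Definition modV11 : gmodule int (Sp R n) := sharbly_module idx11G.
Definition modV12 : gmodule int (Sp R n) := sharbly_module idx12G.
Definition modSt : gmodule int (Sp R n) := homology_module sp_action n.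

(* [s 0] (x) ... (x) [s (n-1)] in the summand of V_0 of index W. *)
Definition elt0 (W : 'I_n -> {vspace V}) s : modV0 :=
  shelt idx0 (fun=> 0%N) W s.
Definition elt11 (i : 'I_n) (W : 'I_n -> {vspace V}) s : modV11 :=
  shelt idx11 (fun j => (j == i) : nat) W s.
Definition elt12 (W : 'I_n.-1 -> {vspace V}) s : modV12 :=
  shelt idx12 (fun=> 0%N) W s.
End StandardModules.

Arguments elt0 {R K} iota {n} W s.
Arguments elt11 {R K} iota {n} i W s.
Arguments elt12 {R K} iota {n} W s.
Arguments modV0 {R K} iota n.
Arguments modV11 {R K} iota n.
Arguments modV12 {R K} iota n.
Arguments modSt {R K} iota n.

(* f 0, ..., f (i-1), a, b, f (i+1), ..., f (m-1); meant for n = m + 1. *)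
Definition splice (T : Type) m n (i : 'I_m) (a b : T) (f : 'I_m -> T) : 'I_n -> T :=
  fun k => nth a (take i (codom f) ++ [:: a, b & drop i.+1 (codom f)]) k.

Definition is_pid (R : idomainType) : Prop :=
  forall I : R -> Prop, I 0 -> (forall a x y, I x -> I y -> I (a * x + y)) ->
  exists a, forall x, I x <-> exists b, x = b * a.

Definition finitely_many_units (R : idomainType) : Prop :=
  exists s : seq R, forall u, u \is a GRing.unit -> u \in s.

Definition to_frac (R : idomainType) : {rmorphism R -> {fraction R}} :=
  @FracField.tofrac R.

(* Main.v *)
(* The augmentation sends [<v_1>, <v_1bar>] (x) ... (x) [<v_n>, <v_nbar>] to the
   cycle of the apartment spanned by these lines. Call a function on frames
   (lists of mutually perpendicular pairs of non-orthogonal lines) a symbol if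
   it changes sign when a pair is flipped and satisfies the three-term and
   six-term relations imposed by d_1; exactness at V_0 says that every symbol
   kills every linear relation between apartments. Fix a line L. By induction
   on the number of pairs not perpendicular to L, the six-term relation expands
   a symbol into its values on frames beginning with a pair (L, b). The part of
   a cycle carried by the flags beginning with b, for b not orthogonal to L, is
   a cycle of (L + b)^perp; this turns a relation between the frames
   (L, b) :: s into one between the frames s, so that induction on n applies.
   Since a cycle vanishes when the lines of all its flags are orthogonal to L,
   the same induction shows that the apartments generate all cycles.
   Over the rationals, exactness on the right is preserved by the tensor
   product, and projectivity follows by averaging over stabilizers of frames.
   These are finite when R has finitely many units: an element of Sp_2n(R)
   sends a primitive integral generator of a line of the frame to a unit
   multiple of another one, and is determined by these images. *)
From HB Require Import structures.
From mathcomp Require Import all_boot all_order fingroup perm all_algebra.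
From mathcomp Require Import boolp generic_quotient freeg.
Require Import Defs.

Set Implicit Arguments.
Unset Strict Implicit.
Unset Printing Implicit Defensive.

Import GRing.Theory Num.Theory.
Local Open Scope ring_scope.

(** * Chains of flags *)

Local Notation "[ 'fg' t ]" := (Freeg [:: (1 : int, t)]) (format "[ 'fg'  t ]").

(** Apartments are handled through operators. Inserting a line at every place of a flag, with signs,
    is a contraction of the complex of all lists of subspaces. Insertions anticommute, and two lines
    spanning a plane satisfy one further relation. The apartment of a frame is the product, over its
    pairs, of the difference of the two insertions, applied to the empty flag. It is then a cycle
    for formal reasons, and the relations imposed by [d_1] become identities between such products.
    Chains live on arbitrary lists of subspaces; being a flag is a condition on the support. The
    obstacle in the six-term relation is that the projections depend on the chosen pair of lines.
    Four lines spanning a genus 2 space have dual lines, each orthogonal to three of the four, and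
    every projection that occurs is one of them. This makes the symmetry under permutations of the
    four lines visible, on which the existence of [d_1] rests, and it explains the missing terms:
    for an orthogonal pair the four lines involved lie in one isotropic plane, where the product of
    operators is zero. *)

HB.instance Definition _ (T : choiceType) (B : zmodType) (f : T -> B) :=
  GRing.isZmodMorphism.Build _ _ (fgext f) (fgextB f).

(* The tactic [abel] decides identities of abelian groups, for which [ring]
   would ask for a multiplication. *)
Inductive zexpr := Zzero | Zvar of nat | Zadd of zexpr & zexpr | Zopp of zexpr.

Section AbelianIdentities.
Variable A : zmodType.
Implicit Types (e : seq A) (l : seq int).

Fixpoint zeval e t : A := match t with
  | Zzero => 0
  | Zvar n => nth 0 e n
  | Zadd t u => zeval e t + zeval e u
  | Zopp t => - zeval e t
  end.

Fixpoint zlin e l : A :=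
  if l is z :: l' then head 0 e *~ z + zlin (behead e) l' else 0.

Fixpoint zladd l m : seq int :=
  match l, m with
  | y :: l', z :: m' => y + z :: zladd l' m'
  | [::], _ => m
  | _, [::] => l
  end.

Fixpoint znorm t : seq int := match t with
  | Zzero => [::]
  | Zvar n => rcons (nseq n 0) 1
  | Zadd t u => zladd (znorm t) (znorm u)
  | Zopp t => [seq - z | z <- znorm t]
  end.

Lemma zlinD e l m : zlin e (zladd l m) = zlin e l + zlin e m.
Proof.
elim: l m e => [|y l IHl] [|z m] e //=; rewrite ?add0r ?addr0 //.
by rewrite mulrzDr IHl addrACA.
Qed.

Lemma znormP e t : zlin e (znorm t) = zeval e t.
Proof.
elim: t e => [|n|t IHt u IHu|t IHt] e //=; last 1 first.
- rewrite -IHt; elim: (znorm t) e {IHt} => [|z l IHl] e /=; first by rewrite oppr0.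
  by rewrite IHl mulrNz opprD.
- elim: n e => [|n IHn] [|x e] //=; rewrite ?mulr1z ?mulr0z ?addr0 ?add0r ?IHn //.
  exact: nth_nil.
- by rewrite zlinD IHt IHu.
Qed.

Lemma zeval_eq e t u :
  all (pred1 0) (znorm (Zadd t (Zopp u))) -> zeval e t = zeval e u.
Proof.
move=> l0; apply/eqP; rewrite -subr_eq0 -[_ - _]/(zeval e (Zadd t (Zopp u))).
rewrite -znormP; elim: (znorm _) e l0 => [|z l IHl] e /=; first by rewrite eqxx.
by case/andP=> /eqP-> /(IHl (behead e)); rewrite mulr0z add0r.
Qed.
End AbelianIdentities.

Ltac zatom x e :=
  lazymatch e with
  | cons x ?e' => constr:(0%N)
  | cons _ ?e' => let n := zatom x e' in constr:(S n)
  end.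
Ltac zatoms t e :=
  lazymatch t with
  | @GRing.add _ ?t ?u => let e' := zatoms t e in zatoms u e'
  | @GRing.opp _ ?t => zatoms t e
  | @GRing.zero _ => e
  | ?x => match constr:(Set) with
          | _ => let n := zatom x e in e
          | _ => constr:(cons x e)
          end
  end.
Ltac zquote t e :=
  lazymatch t with
  | @GRing.add _ ?t ?u =>
    let t' := zquote t e in let u' := zquote u e in constr:(Zadd t' u')
  | @GRing.opp _ ?t => let t' := zquote t e in constr:(Zopp t')
  | @GRing.zero _ => constr:(Zzero)
  | ?x => let n := zatom x e in constr:(Zvar n)
  end.
Ltac abel :=
  lazymatch goal with
  | |- @eq ?A ?t ?u =>
    let e := zatoms t (@nil A) in let e := zatoms u e in
    let t' := zquote t e in let u' := zquote u e in
    refine (@zeval_eq _ e t' u' isT)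
  end.

(** * Free abelian groups: additive extension and support *)

Section FreeAbelian.
Variables (T : choiceType).
Local Notation D := {freeg T / int}.
Implicit Types (c : D) (t : T).

Lemma fgextE (B : zmodType) (f : T -> B) t : fgext f [fg t] = f t.
Proof. by rewrite fgextU. Qed.

Lemma fg_ext (B : zmodType) (f g : {additive D -> B}) :
  (forall t, f [fg t] = g [fg t]) -> f =1 g.
Proof.
move=> fg; elim/fg_ind => [|x y ex ey|t]; last exact: fg.
  by rewrite !raddf0.
by rewrite !raddfB ex ey.
Qed.

Definition supp (Q : T -> Prop) c := forall t, coeff t c != 0 -> Q t.

Lemma supp0 Q : supp Q 0.
Proof. by move=> t; rewrite coeff0 eqxx. Qed.

Lemma suppD (Q : T -> Prop) c d : supp Q c -> supp Q d -> supp Q (c + d).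
Proof.
move=> cQ dQ t; rewrite coeffD.
by have [->|tc _] := eqVneq (coeff t c) 0; [rewrite add0r => /dQ|apply: cQ].
Qed.

Lemma suppN (Q : T -> Prop) c : supp Q c -> supp Q (- c).
Proof. by move=> cQ t; rewrite coeffN oppr_eq0 => /cQ. Qed.

Lemma suppB (Q : T -> Prop) c d : supp Q c -> supp Q d -> supp Q (c - d).
Proof. by move=> cQ dQ; apply: suppD => //; apply: suppN. Qed.

Lemma suppMz (Q : T -> Prop) c z : supp Q c -> supp Q (c *~ z).
Proof.
move=> cQ t; rewrite raddfMz /=.
by have [->|tc _] := eqVneq (coeff t c) 0; [rewrite mul0rz eqxx|apply: cQ].
Qed.

Lemma supp_sum (Q : T -> Prop) (I : Type) (r : seq I) (P : pred I) (F : I -> D) :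
  (forall i, P i -> supp Q (F i)) -> supp Q (\sum_(i <- r | P i) F i).
Proof. by move=> FQ; apply: big_ind => //; [exact: supp0|exact: suppD]. Qed.

Lemma suppU (Q : T -> Prop) t : Q t -> supp Q [fg t].
Proof. by move=> Qt t'; rewrite coeffU; case: (eqVneq t t') => [<-|_] //; rewrite mulr0 eqxx. Qed.

Lemma fgextEsum (B : zmodType) (f : T -> B) c :
  fgext f c = \sum_(t <- dom c) f t *~ coeff t c.
Proof.
by rewrite -[in LHS](freeg_sumE c) raddf_sum; apply: eq_bigr => t _; rewrite /= fgextU.
Qed.

(** Conditions on flags enter through supports, so an identity of additive maps need only be checked
    on the generators satisfying [Q]. *)
Lemma supp_ext (B : zmodType) (f g : {additive D -> B}) (Q : T -> Prop) c :
  supp Q c -> (forall t, Q t -> f [fg t] = g [fg t]) -> f c = g c.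
Proof.
move=> cQ fg; rewrite -(freeg_sumE c) !raddf_sum; apply: eq_big_seq => t.
rewrite mem_dom => /cQ/fg E.
by rewrite -[coeff t c]intz -freegU_mulz !raddfMz /= E.
Qed.

(** A free abelian group has no 2-torsion. This turns anticommutation of insertions into vanishing
    squares. *)
Lemma fg_eqN0 c : c = - c -> c = 0.
Proof.
move=> E; apply/eqP/freeg_eqP => t; rewrite coeff0.
move/(congr1 (coeff t)): E; rewrite coeffN => E.
by apply/eqP; have := mulrn_eq0 (coeff t c) 2; rewrite /= mulr2n {1}E addNr eqxx.
Qed.
End FreeAbelian.

Lemma supp_fgext (T T' : choiceType) (f : T -> {freeg T' / int}) (Q : T -> Prop) Q' (c : {freeg T / int}) :
  supp Q c -> (forall t, Q t -> supp Q' (f t)) -> supp Q' (fgext f c).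
Proof.
move=> cQ fQ; rewrite fgextEsum big_seq_cond; apply: supp_sum => t.
by rewrite andbT mem_dom => /cQ/fQ; apply: suppMz.
Qed.

(** * Insertion operators and their relations *)

Section Flags.
Variables (K : fieldType) (V : vectType K).
Local Notation VS := {vspace V}.
Local Notation F := (seq VS).
Local Notation D := {freeg F / int}.
Implicit Types (a b p q X Y L : VS) (s : F) (c : D).

Definition consD X : D -> D := fgext (fun s => [fg X :: s]).
HB.instance Definition _ X := GRing.Additive.on (consD X).
Definition mapD (f : VS -> VS) : D -> D := fgext (fun s => [fg map f s]).
HB.instance Definition _ f := GRing.Additive.on (mapD f).

Lemma consDE X s : consD X [fg s] = [fg X :: s]. Proof. exact: fgextE. Qed.
Lemma mapDE f s : mapD f [fg s] = [fg map f s]. Proof. exact: fgextE. Qed.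

Lemma mapD_cons f X c : mapD f (consD X c) = consD (f X) (mapD f c).
Proof.
apply: (fg_ext (f := mapD f \o consD X) (g := consD (f X) \o mapD f)) => t /=.
by rewrite consDE !mapDE consDE.
Qed.

(* [ins X a s] is the signed sum of the refinements of the flags
   [take j s ++ map (addv a) (drop j s)] by one step adding [a]; it is the
   prism between [s] and [map (addv a) s], over the base subspace [X]. *)
Fixpoint ins X a s : D :=
  if s is x :: s' then
    [fg [:: X + a, a + x & map (addv a) s']]%VS - consD x (ins x a s')
  else [fg [:: (X + a)%VS]].

Definition insD X a : D -> D := fgext (ins X a).
HB.instance Definition _ X a := GRing.Additive.on (insD X a).

Lemma insDE X a s : insD X a [fg s] = ins X a s. Proof. exact: fgextE. Qed.

Lemma insD_cons X a x c :
  insD X a (consD x c) =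
  consD (X + a)%VS (consD (a + x)%VS (mapD (addv a) c)) - consD x (insD x a c).
Proof.
apply: (fg_ext (f := insD X a \o consD x)
  (g := (consD (X + a)%VS \o (consD (a + x)%VS \o mapD (addv a)))
        \- (consD x \o insD x a))) => t /=.
by rewrite consDE !insDE mapDE !consDE /=.
Qed.

(** The augmented simplicial boundary in recursive form, on all lists of subspaces; [bd_sum]
    recovers the alternating sum of faces. *)
Fixpoint bd s : D := if s is x :: s' then [fg s'] - consD x (bd s') else 0.

Definition bdD : D -> D := fgext bd.
HB.instance Definition _ := GRing.Additive.on bdD.

Lemma bdDE s : bdD [fg s] = bd s. Proof. exact: fgextE. Qed.

Lemma bdD_cons x c : bdD (consD x c) = c - consD x (bdD c).
Proof.
apply: (fg_ext (f := bdD \o consD x) (g := idfun \- (consD x \o bdD))) => t /=.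
by rewrite consDE !bdDE.
Qed.

Lemma bdD_map f c : bdD (mapD f c) = mapD f (bdD c).
Proof.
apply: (fg_ext (f := bdD \o mapD f) (g := mapD f \o bdD)) => t /=.
rewrite mapDE !bdDE; elim: t => [|x t IHt] /=; first by rewrite raddf0.
by rewrite raddfB /= mapDE mapD_cons IHt.
Qed.

Lemma mapD_ins (f : VS -> VS) X a s (Y b : VS) :
  (forall Z, f (Z + a)%VS = (f Z + b)%VS) -> f X = Y ->
  mapD f (ins X a s) = ins Y b (map f s).
Proof.
move=> fa; have {}fa' Z : f (a + Z)%VS = (b + f Z)%VS by rewrite addvC fa addvC.
elim: s X Y => [|x s IHs] X Y /= <-; first by rewrite mapDE /= fa.
rewrite raddfB /= mapDE mapD_cons (IHs x (f x)) //= fa fa' -!map_comp.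
by congr (Freeg [:: (_, _ :: _ :: _)] - _); apply: eq_map => Z /=.
Qed.

Lemma mapD_insD (f : VS -> VS) X a c (Y b : VS) :
  (forall Z, f (Z + a)%VS = (f Z + b)%VS) -> f X = Y ->
  mapD f (insD X a c) = insD Y b (mapD f c).
Proof.
move=> fa fX.
apply: (fg_ext (f := mapD f \o insD X a) (g := insD Y b \o mapD f)) => t /=.
by rewrite insDE mapDE insDE (mapD_ins _ fa fX).
Qed.

Lemma mapD_addv_insD X a b c :
  mapD (addv b) (insD X a c) = insD (b + X) a (mapD (addv b) c).
Proof. by apply: mapD_insD => // Z; rewrite addvA. Qed.

(** The base occurs in the leading term only, so changing it costs a difference of two cones over
    the translated list. *)
Lemma ins_base X Y a s :
  ins X a s - ins Y a s =
  [fg (X + a)%VS :: map (addv a) s] - [fg (Y + a)%VS :: map (addv a) s].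
Proof. case: s => [|x s] //=; abel. Qed.

(** The prism has the ends [s] and its translate by [a]; its leading term is the cone from [X + a]
    that closes the translated end. Hence insertion is a contraction of the augmented complex. *)
Lemma bd_ins X a s : bdD (ins X a s) + insD X a (bd s) = [fg s].
Proof.
elim: s X => [|x s IHs] X; first by rewrite /= bdDE /= !raddf0 !addr0.
have E : [fg x :: s] = consD x (bdD (ins x a s)) + consD x (insD x a (bd s)).
  by rewrite -raddfD IHs /= consDE.
rewrite E [ins _ _ _]/= [bd _]/= !raddfB /= insDE insD_cons bdDE bdD_cons /=.
rewrite -bdDE -[Freeg [:: (_, map _ _)]]mapDE bdD_map bdDE mapDE !raddfB /= consDE.
have := ins_base X x a s; rewrite [(x + a)%VS]addvC => /eqP.
rewrite subr_eq => /eqP->.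
abel.
Qed.

Lemma bdD_insD X a c : bdD (insD X a c) = c - insD X a (bdD c).
Proof.
apply: (fg_ext (f := bdD \o insD X a) (g := idfun \- (insD X a \o bdD))) => t /=.
by rewrite insDE bdDE -[in RHS](bd_ins X a t) addrK.
Qed.

(* A subspace containing [q] does not distinguish between the addition of [p]
   and that of [p + q]. *)
Lemma insD_absorb X p q c :
  insD (q + X) p (mapD (addv q) c) = insD (q + X) (p + q) (mapD (addv q) c).
Proof.
have E Z : (p + (q + Z) = p + q + (q + Z))%VS.
  by rewrite -addvA [(q + (q + Z))%VS]addvA addvv.
apply: (fg_ext (f := insD (q + X) p \o mapD (addv q))
  (g := insD (q + X) (p + q) \o mapD (addv q))) => t /=.
rewrite mapDE !insDE; elim: t X => [|x t IHt] X /=.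
  by rewrite addvC E [(p + q + _)%VS]addvC.
rewrite IHt addvC E [(p + q + (q + X))%VS]addvC -!map_comp E.
by congr (Freeg [:: (_, _ :: _ :: _)] - _); apply: eq_map => Z /=.
Qed.

(** The terms are sorted by how many of [a], [b] are inserted before [x]: both, one or none.
    Exchanging [a] and [b] negates the first four terms, and the last is left to induction. *)
Lemma insD_ins_cons X a b x s :
  insD X a (ins X b (x :: s)) =
  [fg [:: X + a, X + b + a & map (addv (b + a)) (x :: s)]]%VS
  - [fg [:: X + b, X + b + a & map (addv (b + a)) (x :: s)]]%VS
  + consD (X + b)%VS (consD (b + x)%VS
      (insD (b + x)%VS a (mapD (addv b) [fg s])))
  - consD (X + a)%VS (consD (a + x)%VS
      (insD (a + x)%VS b (mapD (addv a) [fg s])))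
  + consD x (insD x a (ins x b s)).
Proof.
rewrite [ins X b _]/= raddfB /= insDE insD_cons.
rewrite -[ins x b s]insDE mapD_addv_insD mapDE [ins X a _]/= raddfB /=.
rewrite raddfB /= !consDE !mapDE !insDE.
rewrite -!map_comp (eq_map (g := addv (b + a))); last first.
  by move=> Z /=; rewrite addvA [(a + b)%VS]addvC.
by rewrite [(a + (X + b))%VS]addvC [(a + (b + x))%VS]addvA [(a + b)%VS]addvC; abel.
Qed.

Lemma insD_ins_nil X a b :
  insD X a (ins X b [::]) =
  [fg [:: X + a; X + b + a]]%VS - [fg [:: X + b; X + b + a]]%VS.
Proof. by rewrite insDE /= consDE addvC [(X + b + a)%VS]addvC. Qed.

Lemma addvAC X a b : (X + a + b = X + b + a)%VS.
Proof. by rewrite -!addvA [(a + b)%VS]addvC. Qed.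

Lemma insD_anticomm X a b c : insD X a (insD X b c) = - insD X b (insD X a c).
Proof.
apply: (fg_ext (f := insD X a \o insD X b)
  (g := \- (insD X b \o insD X a))) => t /=.
rewrite !insDE; elim: t X => [|x t IHt] X.
  by rewrite !insD_ins_nil addvAC opprB.
rewrite !insD_ins_cons -!insDE !(insDE x) IHt raddfN /=.
rewrite ![(X + a + b)%VS]addvAC [(a + b)%VS]addvC; abel.
Qed.

Lemma insD_sqr X a c : insD X a (insD X a c) = 0.
Proof. exact/fg_eqN0/insD_anticomm. Qed.

(** On the empty list over the base 0 the left side is [p, L] - [q, L], and the right side is the
    same after the degenerate lists [L, L] cancel. Only the plane L remembers that both lines were
    inserted. *)
Lemma insD_plane X p q L c : (p + q)%VS = L ->
  insD X p (insD X q c) = insD X p (insD X L c) - insD X q (insD X L c).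
Proof.
move=> pqL; have pL : (p + L)%VS = L by rewrite -pqL addvA addvv.
have qL : (q + L)%VS = L by rewrite addvC -pqL -addvA addvv.
have [Lp Lq] : (L + p)%VS = L /\ (L + q)%VS = L by rewrite ![(L + _)%VS]addvC.
apply: (fg_ext (f := insD X p \o insD X q)
  (g := (insD X p \o insD X L) \- (insD X q \o insD X L))) => t /=.
rewrite !insDE; elim: t X => [|x t IHt] X.
  rewrite !insD_ins_nil -!addvA Lp Lq [(q + p)%VS]addvC pqL; abel.
rewrite !insD_ins_cons -!(addvA X) Lp Lq [(q + p)%VS]addvC pqL.
rewrite !IHt raddfB /=.
(* Once L has been added to all later members, inserting a subspace of L is the same as inserting
   L. *)
have E r : (r + L)%VS = L -> insD (L + x) r (mapD (addv L) [fg t]) =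
    insD (L + x) L (mapD (addv L) [fg t]).
  by move=> rL; rewrite insD_absorb rL.
rewrite !E // (insD_absorb x p q) (insD_absorb x q p) [(q + p)%VS]addvC pqL.
abel.
Qed.
End Flags.

Arguments bdD {K V}.

(** * Orthogonality and frames *)

Section Orthogonality.
Variables (K : fieldType) (V : vectType K) (om : {skew_symmetric V}).
Local Notation VS := {vspace V}.
Implicit Types (U W P X Y L : VS) (u v w x y : V).

Local Notation "U ^|_" := (orthov om U) (at level 2, format "U ^|_").

Definition perp U W := (U <= W^|_)%VS.
Definition nondeg U := (U :&: U^|_ == 0)%VS.

Lemma perpE U W : perp U W = (U <= W^|_)%VS. Proof. by []. Qed.

Lemma perpC U W : perp U W = perp W U.
Proof. exact: orthov_sym. Qed.

Lemma perpP U W : reflect {in U & W, forall u v, om u v = 0} (perp U W).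
Proof. exact: orthovP. Qed.

Lemma perpDl U W X : perp (U + W) X = perp U X && perp W X.
Proof. exact: orthoDv. Qed.

Lemma perpDr U W X : perp X (U + W) = perp X U && perp X W.
Proof. exact: orthovD. Qed.

Lemma perp_lines u v : perp <[u]> <[v]> = (om u v == 0).
Proof. exact: orthov11. Qed.

Lemma perpS U W X Y : (U <= X)%VS -> (W <= Y)%VS -> perp X Y -> perp U W.
Proof. by move=> /subvP UX /subvP WY /perpP XY; apply/perpP => u v /UX uX /WY; apply: XY. Qed.

Lemma orthovDE U W : ((U + W)^|_ = U^|_ :&: W^|_)%VS.
Proof.
apply/vspaceP => x; rewrite memv_cap.
by rewrite ![x \in _]memvE orthovD.
Qed.

Lemma perp_cap U W : perp (U :&: W^|_) W.
Proof. exact: capvSr. Qed.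

Lemma nondegP U : reflect (forall x, x \in U -> {in U, forall y, om x y = 0} -> x = 0) (nondeg U).
Proof.
apply: (iffP eqP) => [U0 x xU xo|U0].
  apply/eqP; rewrite -memv0 -U0 memv_cap xU; exact/mem_orthovP.
apply/eqP; rewrite -subv0; apply/subvP => x; rewrite memv_cap => /andP[xU /mem_orthovP xo].
by rewrite memv0 (U0 x).
Qed.

Lemma dim_cap_orthov W U : (\dim W <= \dim (W :&: U^|_) + \dim U)%N.
Proof.
have H (s : seq V) : (\dim W <= \dim (W :&: (<<s>>)^|_) + size s)%N.
  elim: s => [|x s IHs]; first by rewrite span_nil orthov0 capvf addn0.
  rewrite span_cons orthovDE capvC -capvA capvC; set X := (_ :&: W)%VS.
  have := leq_dim_orthov1 om x X; rewrite {1}/X capvC => H.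
  by rewrite addnS -addSn (leq_trans IHs) // leq_add2r -ltnS; case: (\dim _) H.
by have := H (vbasis U); rewrite size_tuple (span_basis (vbasisP U)).
Qed.

Lemma dim_orthov_nondeg U X : nondeg U -> (X <= U)%VS ->
  (\dim (U :&: X^|_) + \dim X = \dim U)%N.
Proof.
move=> ndU XU; apply/eqP; rewrite eqn_leq dim_cap_orthov andbT.
set Y := (U :&: X^|_)%VS; pose Z := (U :\: Y)%VS.
have dZ : (\dim Z + \dim Y = \dim U)%N.
  by rewrite addnC -(dimv_cap_compl U Y) (capv_idPr _) ?capvSl.
rewrite -dZ addnC leq_add2r.
(* [X] is orthogonal to [Y] by definition, so a vector of [X] orthogonal to the complement [Z] is
   orthogonal to all of [U], hence zero. The dimension of [X] is therefore at most that of [Z]. *)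
have := dim_cap_orthov X Z; suff -> : (X :&: Z^|_ = 0)%VS by rewrite dimv0.
apply/eqP; rewrite -subv0 -(eqP ndU) subv_cap (subv_trans (capvSl _ _)) //=.
have -> : U = (Y + Z)%VS.
  rewrite addvC -{1}(addv_diff_cap U Y) (capv_idPr _) ?capvSl //.
rewrite orthovD capvSr andbT (subv_trans (capvSl _ _)) //.
by rewrite orthov_sym capvSr.
Qed.

Lemma nondeg_split P U : nondeg P -> (P <= U)%VS -> (P + (U :&: P^|_) = U)%VS.
Proof.
move=> ndP PU; apply/eqP; rewrite eqEdim subv_add PU capvSl /=.
rewrite dimv_disjoint_sum ?(leq_trans (dim_cap_orthov U P)) 1?addnC //.
by apply/eqP; rewrite -subv0 -(eqP ndP) capvS // capvSr.
Qed.

Lemma nondeg_cap P U : nondeg P -> nondeg U -> (P <= U)%VS -> nondeg (U :&: P^|_).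
Proof.
move=> ndP ndU PU; apply/nondegP => x; rewrite memv_cap => /andP[xU xP] xo.
apply: (nondegP _ ndU) => // y; rewrite -(nondeg_split ndP PU) => /memv_addP[p pP [z zP ->]].
by rewrite linearDr /= (xo z zP) addr0 (mem_orthovP xP).
Qed.

Lemma nondeg_disjoint P W : nondeg P -> perp P W -> (P :&: W = 0)%VS.
Proof.
move=> ndP PW; apply/eqP; rewrite -subv0 -(eqP ndP) capvS //.
by rewrite -/(perp W P) perpC.
Qed.

Lemma nondegD P W : nondeg P -> nondeg W -> perp P W -> nondeg (P + W).
Proof.
move=> ndP ndW PW; apply/nondegP => _ /memv_addP[p pP [w wW ->]] xo.
have -> : p = 0.
  apply: (nondegP _ ndP) => // y yP.
  have := xo y (subvP (addvSl P W) y yP); rewrite linearDl /= => <-.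
  by move: PW; rewrite perpC => /perpP/(_ w y wW yP)->; rewrite addr0.
have -> : w = 0; last by rewrite addr0.
apply: (nondegP _ ndW) => // y yW.
have := xo y (subvP (addvSr P W) y yW); rewrite linearDl /= => <-.
by move/perpP: PW => /(_ p y pP yW)->; rewrite add0r.
Qed.

Lemma isotropic_dim U X m : nondeg U -> (\dim U = m.*2)%N -> (X <= U)%VS ->
  isotropic om X -> (\dim X <= m)%N.
Proof.
move=> ndU dU XU iX; have := dim_orthov_nondeg ndU XU; rewrite dU => E.
have XX : (\dim X <= \dim (U :&: X^|_))%N by apply: dimvS; rewrite subv_cap XU.
by rewrite -leq_double -E -addnn leq_add2r.
Qed.

Lemma dim1P L : reflect (exists2 v, v != 0 & L = <[v]>%VS) (\dim L == 1%N).
Proof.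
apply: (iffP eqP) => [dL|[v v0 ->]]; last by rewrite dim_vline v0.
have v0 : vpick L != 0 by rewrite vpick0 -dimv_eq0 dL.
by exists (vpick L) => //; apply/esym/eqP; rewrite eqEdim -memvE memv_pick dim_vline v0 dL.
Qed.

Lemma line_sub_eq L X : \dim L = 1%N -> \dim X = 1%N -> (L <= X)%VS -> L = X.
Proof. by move=> dL dX LX; apply/eqP; rewrite eqEdim LX dL dX. Qed.

Lemma line_disjoint L X : \dim L = 1%N -> (L :&: X == 0)%VS = ~~ (L <= X)%VS.
Proof.
move=> /eqP/dim1P[v v0 ->]; rewrite -memvE; apply/eqP/idP => [vX|vX].
  by apply: contra v0 => vX'; rewrite -memv0 -vX memv_cap memv_line.
apply/eqP; rewrite -subv0; apply/subvP => x; rewrite memv_cap => /andP[/vlineP[k ->]].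
by have [->|k0] := eqVneq k 0; rewrite ?scale0r ?mem0v // rpredZeq (negPf k0) (negPf vX).
Qed.

Lemma dim_line_add L X : \dim L = 1%N -> ~~ (L <= X)%VS -> \dim (X + L)%VS = (\dim X).+1.
Proof.
by move=> dL LX; rewrite addvC dimv_disjoint_sum ?dL //; apply/eqP; rewrite line_disjoint.
Qed.

Lemma lineD_eq L M X : \dim L = 1%N -> \dim M = 1%N -> \dim X = 2%N ->
  L != M -> (L <= X)%VS -> (M <= X)%VS -> (L + M)%VS = X.
Proof.
move=> dL dM dX LM LX MX; apply/eqP; rewrite eqEdim subv_add LX MX dX.
rewrite addvC in LM *; rewrite addvC dim_line_add ?dL //.
by apply: contra LM => ML; rewrite (line_sub_eq dM dL ML).
Qed.

Lemma omDl x y z : om (x + y) z = om x z + om y z.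
Proof. exact: linearDl. Qed.
Lemma omDr x y z : om x (y + z) = om x y + om x z.
Proof. exact: linearDr. Qed.
Lemma omNl x y : om (- x) y = - om x y.
Proof. exact: linearNl. Qed.
Lemma omNr x y : om x (- y) = - om x y.
Proof. exact: linearNr. Qed.
Lemma omZl k x y : om (k *: x) y = k * om x y.
Proof. by rewrite linearZl_LR. Qed.

(** A separate assumption because skew-symmetry does not imply it in characteristic 2. *)
Hypothesis om_alt : forall x, om x x = 0.

Lemma om_anti x y : om x y = - om y x.
Proof. by rewrite hermC expr1 mulN1r. Qed.

Lemma omZr k x y : om x (k *: y) = k * om x y.
Proof. by rewrite om_anti omZl (om_anti y) mulrN opprK. Qed.

Lemma isotropic_line L : \dim L = 1%N -> isotropic om L.
Proof. by move=> /eqP/dim1P[v _ ->]; rewrite /isotropic -/(perp _ _) perp_lines om_alt. Qed.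

(** Two lines spanning a genus 1 symplectic plane, which is [pl p]. *)
Definition good (p : VS * VS) := [&& \dim p.1 == 1%N, \dim p.2 == 1%N & ~~ perp p.1 p.2].
Definition pl (p : VS * VS) := (p.1 + p.2)%VS.

Lemma goodE p : good p = [&& \dim p.1 == 1%N, \dim p.2 == 1%N & ~~ perp p.1 p.2]. Proof. by []. Qed.

Lemma goodP p : reflect (exists u v, [/\ p.1 = <[u]>%VS, p.2 = <[v]>%VS & om u v = 1]) (good p).
Proof.
apply: (iffP and3P) => [[/dim1P[u u0 E1] /dim1P[v v0 E2]]|[u [v [E1 E2 uv]]]].
  rewrite E1 E2 perp_lines => uv; exists ((om u v)^-1 *: u), v; split=> //.
    by apply/vspaceP => x; apply/vlineP/vlineP => -[k ->];
      [exists (k * om u v)|exists (k / om u v)]; rewrite scalerA ?mulfK ?mulfVK.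
  by rewrite linearZl_LR /= mulVf.
have nz : forall x : V, x = 0 -> om x v != 1 by move=> x ->; rewrite linear0l eq_sym oner_eq0.
have nz' : forall x : V, x = 0 -> om u x != 1 by move=> x ->; rewrite linear0r eq_sym oner_eq0.
rewrite E1 E2 perp_lines uv oner_eq0 !dim_vline; split=> //.
  by case: (u =P 0) => // /nz; rewrite uv eqxx.
by case: (v =P 0) => // /nz'; rewrite uv eqxx.
Qed.

Lemma nondeg_pl p : good p -> nondeg (pl p).
Proof.
case/goodP=> u [v [E1 E2 uv]]; rewrite /pl E1 E2.
apply/nondegP => _ /memv_addP[_ /vlineP[k ->] [_ /vlineP[l ->] ->]] xo.
have vu : om v u = -1 by rewrite om_anti uv.
have := xo v; have := xo u.
rewrite !linearDl /= !linearZl_LR /= !om_alt uv vu !mulr0 addr0 add0r.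
move=> /(_ (subvP (addvSl _ _) _ (memv_line _)))/eqP.
rewrite mulf_eq0 oppr_eq0 oner_eq0 orbF => /eqP-> /(_ (subvP (addvSr _ _) _ (memv_line _))).
by rewrite mulr1 => ->; rewrite !scale0r addr0.
Qed.

Lemma dim_pl p : good p -> \dim (pl p) = 2%N.
Proof.
case/and3P=> /eqP d1 /eqP d2 np; rewrite /pl dim_line_add ?d1 //.
apply: contra np => /(line_sub_eq d2 d1)->; exact: isotropic_line.
Qed.

(** Two distinct orthogonal lines would span the plane, so each would lie in its radical. *)
Lemma good_lines a b X : nondeg X -> \dim X = 2%N -> \dim a = 1%N -> \dim b = 1%N ->
  (a <= X)%VS -> (b <= X)%VS -> good (a, b) = (a != b).
Proof.
move=> ndX dX da db aX bX; rewrite /good /= da db /=; congr (~~ _).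
apply/idP/eqP => [ab|->]; last exact: isotropic_line.
case: (eqVneq a b) => // nab; have /eqP : \dim a = 0%N; last by rewrite da.
apply/eqP; rewrite dimv_eq0 -subv0 -(eqP ndX) subv_cap aX /=.
by rewrite -/(perp a X) -(lineD_eq da db dX nab aX bX) perpDr ab andbT; apply: isotropic_line.
Qed.

End Orthogonality.

Ltac andb_ac := do ?[match goal with |- context [andb ?a ?b] =>
  lazymatch a with andb _ _ => fail | _ => case: a; rewrite /= ?andbF ?andbT end end]; by [].

(** * Symplectic frames, contexts and dual lines in genus 2 *)

Section Frames.
Variables (K : fieldType) (V : vectType K) (om : {skew_symmetric V}).
Hypothesis om_alt : forall x, om x x = 0.
Local Notation VS := {vspace V}.
Local Notation T := (VS * VS)%type.
Local Notation perp := (perp om).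
Local Notation nondeg := (nondeg om).
Local Notation good := (good om).
Local Notation "U ^|_" := (orthov om U) (at level 2, format "U ^|_").
Implicit Types (U W P X Y L : VS) (u v w x y : V) (p q : T) (s t : seq T).

Definition plsum s := (\sum_(p <- s) pl p)%VS.

Fixpoint orthogonal_frame s :=
  if s is p :: s' then [&& good p, perp (pl p) (plsum s') & orthogonal_frame s'] else true.

Lemma orthogonal_frame_cons p s : orthogonal_frame (p :: s) =
  [&& good p, perp (pl p) (plsum s) & orthogonal_frame s].
Proof. by []. Qed.

Definition sframe U s := orthogonal_frame s && (plsum s == U).

Lemma sframeE U s : sframe U s = orthogonal_frame s && (plsum s == U). Proof. by []. Qed.

Lemma plsum_nil : plsum [::] = 0%VS. Proof. exact: big_nil. Qed.
Lemma plsum_cons p s : plsum (p :: s) = (pl p + plsum s)%VS. Proof. exact: big_cons. Qed.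
Lemma plsum_cat s t : plsum (s ++ t) = (plsum s + plsum t)%VS. Proof. exact: big_cat. Qed.
Lemma plsum1 p : plsum [:: p] = pl p. Proof. by rewrite plsum_cons plsum_nil addv0. Qed.

Lemma perp0r U : perp U 0%VS. Proof. by rewrite perpC perpE sub0v. Qed.

Lemma orthogonal_frame_cat s t :
  orthogonal_frame (s ++ t) =
  [&& orthogonal_frame s, orthogonal_frame t & perp (plsum s) (plsum t)].
Proof.
elim: s => [|p s IHs] /=; first by rewrite plsum_nil perpC perp0r andbT.
by rewrite IHs plsum_cat plsum_cons perpDr perpDl; andb_ac.
Qed.

Lemma orthogonal_frame_nondeg s : orthogonal_frame s -> nondeg (plsum s).
Proof.
elim: s => [_|p s IHs /and3P[gp pS /IHs nd]].
  by rewrite plsum_nil /nondeg cap0v.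
by rewrite plsum_cons nondegD // nondeg_pl.
Qed.

Lemma orthogonal_frame_dim s : orthogonal_frame s -> \dim (plsum s) = (size s).*2.
Proof.
elim: s => [_|p s IHs /and3P[gp pS os]]; first by rewrite plsum_nil dimv0.
rewrite plsum_cons dimv_disjoint_sum ?(dim_pl om_alt gp) ?IHs //.
by rewrite (nondeg_disjoint _ pS) // (nondeg_pl om_alt).
Qed.

Lemma sframe_nondeg U s : sframe U s -> nondeg U.
Proof. by case/andP=> /orthogonal_frame_nondeg + /eqP<-. Qed.

Lemma sframe_dim U s : sframe U s -> \dim U = (size s).*2.
Proof. by case/andP=> /orthogonal_frame_dim + /eqP<-. Qed.

Lemma sframe_nil U : sframe U [::] = (U == 0)%VS.
Proof. by rewrite /sframe /= plsum_nil eq_sym. Qed.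

Lemma cap_perp_add P W : nondeg P -> perp P W -> ((P + W) :&: P^|_)%VS = W.
Proof.
move=> ndP PW; apply/eqP; rewrite eqEsubv subv_cap addvSr -/(perp W P) perpC PW !andbT.
apply/subvP => x; rewrite memv_cap => /andP[/memv_addP[p pP [w wW ->]] /mem_orthovP xo].
suff -> : p = 0 by rewrite add0r.
apply: (nondegP _ _ ndP) => // y yP; rewrite -(xo y yP) linearDl /=.
by move: PW; rewrite perpC => /perpP/(_ w y wW yP)->; rewrite addr0.
Qed.

(** Peeling off one pair replaces [U] by the orthogonal complement of a plane; this is the step on
    which the inductions on the genus run. *)
Lemma sframe_cons U p s :
  sframe U (p :: s) = [&& good p, (pl p <= U)%VS & sframe (U :&: (pl p)^|_) s].
Proof.
apply/idP/and3P => [/andP[+ /eqP<-]|[gp pU /andP[os /eqP Es]]].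
  rewrite orthogonal_frame_cons => /and3P[gp pS os].
  rewrite plsum_cons addvSl /sframe os cap_perp_add ?eqxx //.
  exact: nondeg_pl.
rewrite /sframe orthogonal_frame_cons gp os plsum_cons Es (nondeg_split (nondeg_pl om_alt gp) pU) eqxx !andbT.
by rewrite perpC perp_cap.
Qed.

(* [ctx U s1 W s2]: a frame of [W] inserted between [s1] and [s2] gives a
   frame of [U]. *)
Definition ctx U s1 W s2 :=
  [&& orthogonal_frame (s1 ++ s2), perp W (plsum (s1 ++ s2)) & (W + plsum (s1 ++ s2) == U)%VS].

Lemma ctxE U s1 W s2 : ctx U s1 W s2 =
  [&& orthogonal_frame (s1 ++ s2), perp W (plsum (s1 ++ s2)) & (W + plsum (s1 ++ s2) == U)%VS].
Proof. by []. Qed.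

Lemma orthogonal_frame_mid s1 t s2 :
  orthogonal_frame (s1 ++ t ++ s2) =
  [&& orthogonal_frame t, orthogonal_frame (s1 ++ s2) & perp (plsum t) (plsum (s1 ++ s2))].
Proof.
rewrite !orthogonal_frame_cat !plsum_cat !perpDr (perpC _ (plsum t) (plsum s1)).
by andb_ac.
Qed.

Lemma plsum_mid s1 t s2 : plsum (s1 ++ t ++ s2) = (plsum t + plsum (s1 ++ s2))%VS.
Proof. by rewrite !plsum_cat !addvA [(plsum s1 + _)%VS]addvC. Qed.

Lemma sframe_ctx U s1 t s2 :
  sframe U (s1 ++ t ++ s2) = ctx U s1 (plsum t) s2 && orthogonal_frame t.
Proof. by rewrite /sframe /ctx orthogonal_frame_mid plsum_mid; andb_ac. Qed.

Lemma ctx_sframe U s1 W s2 t : ctx U s1 W s2 -> sframe W t -> sframe U (s1 ++ t ++ s2).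
Proof. by move=> c /andP[ot /eqP Et]; rewrite sframe_ctx Et c ot. Qed.

(* The lines [r l] are dual to the lines [v i] spanning a genus 2 space. *)
Record quad W (v r : nat -> VS) : Prop := Quad {
  quad_nondeg : nondeg W;
  quad_dim : \dim W = 4%N;
  quad_sum : (v 0%N + v 1%N + v 2%N + v 3%N)%VS = W;
  quad_v : forall i, (i < 4)%N -> \dim (v i) = 1%N;
  quad_r : forall i, (i < 4)%N -> \dim (r i) = 1%N;
  quad_sub : forall i, (i < 4)%N -> (r i <= W)%VS;
  quad_perp : forall i l, (i < 4)%N -> (l < 4)%N -> i != l -> perp (v i) (r l)
}.

Section Quad.
Variables (W : VS) (v r : nat -> VS).
Hypothesis Q : quad W v r.

Lemma quad_vsub i : (i < 4)%N -> (v i <= W)%VS.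
Proof.
case: i => [|[|[|[|]]]] // _; rewrite -(quad_sum Q).
- by rewrite -!addvA addvSl.
- by rewrite -!addvA addvC -!addvA addvSl.
- by rewrite -addvA addvC -addvA addvSl.
- exact: addvSr.
Qed.

Lemma quad_notperp X : (X <= W)%VS -> (forall i, (i < 4)%N -> perp (v i) X) -> X = 0%VS.
Proof.
move=> XW vX; apply/eqP; rewrite -subv0 -(eqP (quad_nondeg Q)) subv_cap XW.
by rewrite -/(perp X W) perpC -(quad_sum Q) !perpDl !vX.
Qed.

Lemma quad_dual i : (i < 4)%N -> ~~ perp (v i) (r i).
Proof.
move=> i4; apply/negP => vr; have := quad_r Q i4; rewrite (quad_notperp (quad_sub Q i4)) ?dimv0 //.
by move=> j j4; have [->//|ji] := eqVneq j i; apply: (quad_perp Q).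
Qed.

Lemma quad_neq i j : (i < 4)%N -> (j < 4)%N -> i != j -> v i != v j.
Proof.
by move=> i4 j4 ij; apply: contraNneq (quad_dual i4) => ->; rewrite (quad_perp Q) // eq_sym.
Qed.

Lemma quad_rneq i j : (i < 4)%N -> (j < 4)%N -> i != j -> r i != r j.
Proof.
by move=> i4 j4 ij; apply: contraNneq (quad_dual i4) => ->; rewrite (quad_perp Q).
Qed.

Lemma quad_dim2 i j : (i < 4)%N -> (j < 4)%N -> i != j -> \dim (v i + v j)%VS = 2%N.
Proof.
move=> i4 j4 ij; rewrite dim_line_add ?(quad_v Q) //.
apply: contra (quad_neq i4 j4 ij) => vji.
by rewrite (line_sub_eq _ _ vji) ?(quad_v Q).
Qed.

(** [r k] and [r l] are orthogonal to [v i] and [v j], so they lie in the complementary plane; being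
    distinct, they span it. *)
Lemma quad_frame i j k l : (i < 4)%N -> (j < 4)%N -> (k < 4)%N -> (l < 4)%N ->
  uniq [:: i; j; k; l] -> ~~ perp (v i) (v j) -> sframe W [:: (v i, v j); (r l, r k)].
Proof.
move=> i4 j4 k4 l4; rewrite /= !inE !negb_or andbT -!andbA => /and5P[ij ik il jk] /andP[jl kl] vij.
have gX : good (v i, v j) by rewrite /good /= !(quad_v Q) // vij.
have ndX := nondeg_pl om_alt gX.
have XW : (pl (v i, v j) <= W)%VS by rewrite subv_add !quad_vsub.
have ndY := nondeg_cap ndX (quad_nondeg Q) XW.
have dY : \dim (W :&: (pl (v i, v j))^|_) = 2%N.
  have := dim_orthov_nondeg (quad_nondeg Q) XW.
  by rewrite (dim_pl om_alt gX) (quad_dim Q) => /eqP; rewrite -[4%N]/(2 + 2)%N eqn_add2r => /eqP.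
have rY m : (m < 4)%N -> i != m -> j != m -> (r m <= W :&: (pl (v i, v j))^|_)%VS.
  by move=> m4 im jm; rewrite subv_cap (quad_sub Q) //= -/(perp _ _) perpC perpDl !(quad_perp Q).
have lk : l != k by rewrite eq_sym.
rewrite !sframe_cons gX XW (good_lines om_alt ndY) ?rY ?(quad_r Q) ?quad_rneq //=.
rewrite /pl /= (lineD_eq _ _ dY) ?rY ?(quad_r Q) ?quad_rneq // subvv sframe_nil.
by rewrite -subv0 -(eqP ndY) subvv.
Qed.

(** An isotropic plane in a genus 2 space is its own orthogonal, and [r l] is orthogonal to [v i]
    and [v j]. *)
Lemma quad_plane i j l : (i < 4)%N -> (j < 4)%N -> (l < 4)%N ->
  i != j -> i != l -> j != l -> perp (v i) (v j) -> (r l <= v i + v j)%VS.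
Proof.
move=> i4 j4 l4 ij il jl vij; set X := (v i + v j)%VS.
have vv m : (m < 4)%N -> perp (v m) (v m).
  by move=> m4; apply: (isotropic_line om_alt); rewrite (quad_v Q).
have XW : (X <= W)%VS by rewrite subv_add !quad_vsub.
have -> : X = (W :&: X^|_)%VS.
  apply/eqP; rewrite eqEdim subv_cap XW /= -/(perp X X) /X !(perpDl, perpDr).
  rewrite -/X (perpC _ (v j) (v i)) vij !vv //=.
  have := dim_orthov_nondeg (quad_nondeg Q) XW; rewrite (quad_dim2 i4 j4 ij) (quad_dim Q).
  by move/eqP; rewrite -[4%N]/(2 + 2)%N eqn_add2r => /eqP->.
by rewrite subv_cap (quad_sub Q) // -/(perp _ _) perpC perpDl !(quad_perp Q).
Qed.
End Quad.

End Frames.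

(** * Symbols on frames *)

Section Symbols.
Variables (K : fieldType) (V : vectType K) (om : {skew_symmetric V}).
Hypothesis om_alt : forall x, om x x = 0.
Local Notation VS := {vspace V}.
Local Notation T := (VS * VS)%type.
Local Notation perp := (perp om).
Local Notation sframe := (sframe om).
Local Notation ctx := (ctx om).
Local Notation "U ^|_" := (orthov om U) (at level 2, format "U ^|_").
Implicit Types (U W P X Y L : VS) (u v w x y : V) (p q : T) (s t : seq T).

(* [six_terms] has one term per pair [i < j]; the dual lines [r l], [r k] are
   the projections of [v k], [v l] along [v i + v j]. *)
Definition six_terms (B : zmodType) (t : nat -> nat -> nat -> nat -> B) : B :=
  t 0%N 1%N 2%N 3%N - t 0%N 2%N 1%N 3%N + t 0%N 3%N 1%N 2%N
  + t 1%N 2%N 0%N 3%N - t 1%N 3%N 0%N 2%N + t 2%N 3%N 0%N 1%N.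

Record symbol (B : zmodType) U (g : seq T -> B) : Prop := Symbol {
  symbol_flip : forall W s1 s2 a b, ctx U s1 W s2 -> sframe W [:: (a, b)] ->
    g (s1 ++ (b, a) :: s2) = - g (s1 ++ (a, b) :: s2);
  symbol_three : forall W s1 s2 a b c, ctx U s1 W s2 ->
    sframe W [:: (a, b)] -> sframe W [:: (a, c)] -> sframe W [:: (b, c)] ->
    g (s1 ++ (b, c) :: s2) - g (s1 ++ (a, c) :: s2) + g (s1 ++ (a, b) :: s2) = 0;
  symbol_six : forall W s1 s2 (v r : nat -> VS), ctx U s1 W s2 -> quad om W v r ->
    six_terms (fun i j k l => if perp (v i) (v j) then 0 else
      g (s1 ++ [:: (v i, v j), (r l, r k) & s2])) = 0
}.

Section Apartment.
Local Notation D := {freeg (seq VS) / int}.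

Definition apD p : D -> D := insD 0 p.1 \- insD 0 p.2.
HB.instance Definition _ p := GRing.Additive.on (apD p).

Lemma apDE p c : apD p c = insD 0 p.1 c - insD 0 p.2 c. Proof. by []. Qed.

Definition ap_on s (c : D) := foldr apD c s.

Lemma ap_onB s : zmod_morphism (ap_on s).
Proof. by elim: s => [|p s IHs] c d //=; rewrite IHs raddfB. Qed.
HB.instance Definition _ s := GRing.isZmodMorphism.Build _ _ (ap_on s) (ap_onB s).

(** Expanding the product chooses a line from each pair and an order of insertion, which gives the
    maximal simplices of the apartment with their orientations. *)
Definition ap s : D := ap_on s [fg [::]].

Lemma ap_cat s t : ap (s ++ t) = ap_on s (ap t).
Proof. exact: foldr_cat. Qed.

Lemma ap_cons p s : ap (p :: s) = apD p (ap s). Proof. by []. Qed.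

Lemma bdD_ap s : bdD (ap s) = 0.
Proof.
elim: s => [|p s IHs]; first by rewrite /ap /= bdDE.
by rewrite ap_cons apDE raddfB /= !bdD_insD IHs !raddf0; abel.
Qed.

(** All four lines lie in the isotropic plane [X]. By [insD_plane] each of the four products is a
    difference of terms depending on one line only, and these cancel in the alternating sum. If two
    of the lines coincide, their product is a square and both sides of the plane relation vanish. *)
Lemma apD_quad W (v r : nat -> VS) i j k l c : quad om W v r ->
  (i < 4)%N -> (j < 4)%N -> (k < 4)%N -> (l < 4)%N -> uniq [:: i; j; k; l] ->
  perp (v i) (v j) -> apD (v i, v j) (apD (r l, r k) c) = 0.
Proof.
move=> Q i4 j4 k4 l4; rewrite /= !inE !negb_or andbT -!andbA.
case/and5P=> ij ik il jk /andP[jl kl] vij; set X := (v i + v j)%VS.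
have dX : \dim X = 2%N by apply: (quad_dim2 Q).
have E m n : (m == i) || (m == j) -> (n == l) || (n == k) ->
    insD 0 (v m) (insD 0 (r n) c) =
    insD 0 (v m) (insD 0 X c) - insD 0 (r n) (insD 0 X c).
  move=> mij nkl.
  have m4 : (m < 4)%N by case/orP: mij => /eqP->.
  have n4 : (n < 4)%N by case/orP: nkl => /eqP->.
  have vX : (v m <= X)%VS by case/orP: mij => /eqP->; rewrite ?addvSl ?addvSr.
  have rX : (r n <= X)%VS by case/orP: nkl => /eqP->; apply: (quad_plane om_alt Q).
  have [->|vr] := eqVneq (v m) (r n); first by rewrite insD_sqr subrr.
  by apply: insD_plane; apply: lineD_eq; rewrite ?(quad_v Q) ?(quad_r Q).
rewrite !apDE /= !raddfB /= !E ?eqxx ?orbT //; abel.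
Qed.

Lemma ap_symbol U : symbol U ap.
Proof.
split=> [W s1 s2 a b _ _|W s1 s2 a b c _ _ _ _|W s1 s2 v r _ Q].
- by rewrite !ap_cat !ap_cons -raddfN !apDE opprB.
- rewrite !ap_cat !ap_cons -raddfB -raddfD -[RHS](raddf0 (ap_on s1)) /=; congr (ap_on s1 _).
  by rewrite !apDE /=; abel.
pose q i j k l := ap_on s1 (apD (v i, v j) (apD (r l, r k) (ap s2))).
have E i j k l : (i < 4)%N -> (j < 4)%N -> (k < 4)%N -> (l < 4)%N -> uniq [:: i; j; k; l] ->
    (if perp (v i) (v j) then 0 else ap (s1 ++ [:: (v i, v j), (r l, r k) & s2])) = q i j k l.
  move=> *; rewrite /q; case: ifP => [vij|_]; last by rewrite ap_cat !ap_cons.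
  by rewrite (apD_quad _ Q) // raddf0.
(* With the vanishing products for orthogonal pairs restored, the sum is formally zero: for each [i]
   the coefficients of the insertions of the dual lines after that of [v i] cancel in pairs. *)
rewrite /six_terms !E // /q -raddfB -!raddfD -raddfB -raddfD -[RHS](raddf0 (ap_on s1)) /=; congr (ap_on s1 _).
by rewrite !apDE /= !raddfB /=; abel.
Qed.
End Apartment.

Section Consequences.
Variables (B : zmodType) (U : VS) (g : seq T -> B).
Hypothesis gS : symbol U g.

Lemma symbol_swap s1 s2 p q : sframe U (s1 ++ [:: p, q & s2]) ->
  g (s1 ++ [:: q, p & s2]) = - g (s1 ++ [:: p, q & s2]).
Proof.
rewrite -[[:: p, q & s2]]/([:: p; q] ++ s2) sframe_ctx => /andP[c].
case: p q c => [p1 p2] [q1 q2] c opq.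
have := opq => /= /and4P[gp + gq _]; rewrite plsum1 perpDl !perpDr -!andbA => /and4P[p1q1 p1q2 p2q1 p2q2].
have [/and3P[d1 d2 np] /and3P[e1 e2 nq]] := (gp, gq).
(* In this quadruple each line is dual to its partner, and only the pairs (0,1) and (2,3) are
   non-orthogonal. The six-term relation reduces to the frame plus its transpose. *)
pose v := nth 0%VS [:: p1; p2; q1; q2]; pose r := nth 0%VS [:: p2; p1; q2; q1].
have pp L : \dim L == 1%N -> perp L L by move/eqP/(isotropic_line om_alt).
have Q : quad om (plsum [:: (p1, p2); (q1, q2)]) v r.
  have E : plsum [:: (p1, p2); (q1, q2)] = (p1 + p2 + q1 + q2)%VS.
    by rewrite plsum_cons plsum1 addvA.
  split=> //.
  - exact: orthogonal_frame_nondeg.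
  - exact: (orthogonal_frame_dim om_alt opq).
  - by move=> [|[|[|[|]]]] //= _; apply/eqP.
  - by move=> [|[|[|[|]]]] //= _; apply/eqP.
  - move=> i i4; rewrite E; case: i i4 => [|[|[|[|]]]] //= _.
    + by rewrite -!addvA addvC -!addvA addvSl.
    + by rewrite -!addvA addvSl.
    + exact: addvSr.
    + by rewrite -addvA addvC -addvA addvSl.
  by move=> [|[|[|[|]]]] [|[|[|[|]]]] //= _ _ _; rewrite ?pp // perpC.
have := symbol_six gS c Q; rewrite /six_terms /v /r /=.
rewrite p1q1 p1q2 p2q1 p2q2 (negPf np) (negPf nq) => E.
by apply/eqP; rewrite -addr_eq0 -E; apply/eqP; abel.
Qed.

Lemma symbol_front s1 s2 p : sframe U (s1 ++ p :: s2) ->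
  g (s1 ++ p :: s2) = g (p :: s1 ++ s2) *~ (-1) ^+ size s1.
Proof.
elim/last_ind: s1 s2 => [|s1 q IHs] s2; first by rewrite expr0 mulr1z.
rewrite size_rcons exprS mulN1r mulrNz -!cats1 -!catA /= => f.
rewrite -IHs; first by rewrite -[LHS]opprK -symbol_swap.
move: f; rewrite -[[:: q, p & s2]]/([:: q; p] ++ s2) -[[:: p, q & s2]]/([:: p; q] ++ s2).
rewrite !sframe_ctx /= !plsum_cons plsum_nil !addv0 [(pl q + _)%VS]addvC (perpC _ (pl q)).
by case/andP=> -> /and5P[-> -> -> _ _]; rewrite perp0r.
Qed.

(* The six-term relation of the lines spanned by [a1 + a2], [b1], [a2], [b2]. *)
Lemma symbol_merge s a1 b1 a2 b2 : om a1 b1 = 1 -> om a2 b2 = 1 ->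
  sframe U [:: (<[a1]>, <[b1]>), (<[a2]>, <[b2]>) & s]%VS ->
  [/\ sframe U [:: (<[a1 + a2]>, <[b1]>), (<[a2]>, <[b2 - b1]>) & s]%VS,
      sframe U [:: (<[a1 + a2]>, <[b2]>), (<[b2 - b1]>, <[a1]>) & s]%VS
    & g [:: (<[a1]>, <[b1]>), (<[a2]>, <[b2]>) & s]%VS =
      g [:: (<[a1 + a2]>, <[b1]>), (<[a2]>, <[b2 - b1]>) & s]%VS
      + g [:: (<[a1 + a2]>, <[b2]>), (<[b2 - b1]>, <[a1]>) & s]%VS].
Proof.
move=> ab1 ab2 f.
have := f; rewrite -[(_ :: _ :: s)]/([::] ++ [:: (<[a1]>, <[b1]>); (<[a2]>, <[b2]>)]%VS ++ s).
rewrite sframe_ctx => /andP[c opq].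
have := opq => /= /and4P[gp + gq _].
rewrite plsum1 perpDl !perpDr !perp_lines -!andbA => /and4P[/eqP a1a2 /eqP a1b2 /eqP b1a2 /eqP b1b2].
have ba1 : om b1 a1 = -1 by rewrite om_anti ab1.
have ba2 : om b2 a2 = -1 by rewrite om_anti ab2.
have b2a1 : om b2 a1 = 0 by rewrite om_anti a1b2 oppr0.
have a2a1 : om a2 a1 = 0 by rewrite om_anti a1a2 oppr0.
have a2b1 : om a2 b1 = 0 by rewrite om_anti b1a2 oppr0.
have b2b1 : om b2 b1 = 0 by rewrite om_anti b1b2 oppr0.
have omE := (omDl, omDr, omNl, omNr, om_alt, ab1, ab2, a1a2, a1b2, b1a2,
  b1b2, ba1, ba2, b2a1, a2a1, a2b1, b2b1).
have nz (x y : V) : om x y != 0 -> \dim <[x]> = 1%N.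
  by move=> xy; rewrite dim_vline; case: (x =P 0) xy => // ->; rewrite linear0l eqxx.
pose v := nth 0%VS [:: <[a1 + a2]>; <[b1]>; <[a2]>; <[b2]> ]%VS.
pose r := nth 0%VS [:: <[b1]>; <[a1]>; <[b2 - b1]>; <[a2]> ]%VS.
set W := plsum _ in c.
have WE : W = (<[a1]> + <[b1]> + <[a2]> + <[b2]>)%VS.
  by rewrite /W plsum_cons plsum1 addvA.
have a1W : a1 \in W by rewrite memvE WE -!addvA addvSl.
have b1W : b1 \in W by rewrite memvE WE -!addvA addvC -!addvA addvSl.
have a2W : a2 \in W by rewrite memvE WE -addvA addvC -addvA addvSl.
have b2W : b2 \in W by rewrite memvE WE addvSr.
have Q : quad om W v r.
  split=> //.
  - exact: orthogonal_frame_nondeg.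
  - exact: (orthogonal_frame_dim om_alt opq).
  - apply/eqP; rewrite eqEsubv; apply/andP; split; rewrite /v /=.
      by rewrite !subv_add -!memvE b1W a2W b2W memvD.
    rewrite WE !subv_add -!memvE; set X := (_ + _ + _ + _)%VS.
    have a2X : a2 \in X by rewrite memvE /X -addvA addvC -addvA addvSl.
    have aX : a1 + a2 \in X by rewrite memvE /X -!addvA addvSl.
    have b1X : b1 \in X by rewrite memvE /X -!addvA addvC -!addvA addvSl.
    have b2X : b2 \in X by rewrite memvE /X addvSr.
    by rewrite a2X b1X b2X -[a1](addrK a2) memvB.
  - case=> [|[|[|[|]]]] //= _; [apply: (nz _ b1)|apply: (nz _ a1)|apply: (nz _ b2)|apply: (nz _ a2)];
      by rewrite /= ?omE ?addr0 ?oppr_eq0 oner_eq0.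
  - case=> [|[|[|[|]]]] //= _; [apply: (nz _ a1)|apply: (nz _ b1)|apply: (nz _ a2)|apply: (nz _ b2)];
      by rewrite /= !omE ?oppr0 ?addr0 ?oppr_eq0 oner_eq0.
  - by case=> [|[|[|[|]]]] //= _; rewrite -memvE ?memvB.
  - by move=> [|[|[|[|]]]] [|[|[|[|]]]] //= _ _ _; rewrite perp_lines !omE ?(oppr0, addr0, add0r, addNr, subrr, eqxx).
(* Three of the six pairs are non-orthogonal. The pair (2,3) contributes the given frame with its
   two planes exchanged, whence the final use of [symbol_swap]. *)
have v01 : ~~ perp (v 0%N) (v 1%N) by rewrite perp_lines !omE addr0 oner_eq0.
have v03 : ~~ perp (v 0%N) (v 3%N) by rewrite perp_lines !omE add0r oner_eq0.
have v23 : ~~ perp (v 2%N) (v 3%N) by rewrite perp_lines !omE oner_eq0.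
have v02 : perp (v 0%N) (v 2%N) by rewrite perp_lines !omE addr0.
have v12 : perp (v 1%N) (v 2%N) by rewrite perp_lines !omE.
have v13 : perp (v 1%N) (v 3%N) by rewrite perp_lines !omE.
have F1 := ctx_sframe c (quad_frame om_alt Q (i := 0) (j := 1) (k := 2) (l := 3) isT isT isT isT isT v01).
have F2 := ctx_sframe c (quad_frame om_alt Q (i := 0) (j := 3) (k := 1) (l := 2) isT isT isT isT isT v03).
split=> //.
have := symbol_six gS c Q; rewrite /six_terms (negPf v01) (negPf v03) (negPf v23) v02 v12 v13.
rewrite /v /r /= => E; apply/eqP; rewrite -[X in X == _]opprK -(symbol_swap (s1 := [::])) //=.
by rewrite eq_sym -subr_eq0 opprK -E; apply/eqP; abel.
Qed.
End Consequences.
End Symbols.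

(** * Expansion of symbols along a fixed line *)

Section Expansion.
Variables (K : fieldType) (V : vectType K) (om : {skew_symmetric V}).
Hypothesis om_alt : forall x, om x x = 0.
Local Notation VS := {vspace V}.
Local Notation T := (VS * VS)%type.
Local Notation perp := (perp om).
Local Notation good := (good om).
Local Notation sframe := (sframe om).
Local Notation ctx := (ctx om).
Local Notation symbol := (symbol om).
Local Notation "U ^|_" := (orthov om U) (at level 2, format "U ^|_").
Implicit Types (W P X Y : VS) (u v w x y : V) (p q : T) (s t : seq T).

Variables (U L : VS).
Hypothesis dL : \dim L = 1%N.
Hypothesis LU : (L <= U)%VS.

(** The combination [e] is chosen before the symbol, so that one expansion serves both the apartment
    map and the symbol compared with it. *)
Definition expands s := exists e : seq (int * (VS * seq T)),
  (forall z, z \in e -> sframe U ((L, z.2.1) :: z.2.2)) /\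
  (forall (B : zmodType) (g : seq T -> B), symbol U g ->
     g s = \sum_(z <- e) g ((L, z.2.1) :: z.2.2) *~ z.1).

Lemma expands_head b s : sframe U ((L, b) :: s) -> expands ((L, b) :: s).
Proof.
move=> f; exists [:: (1, (b, s))]; split=> [z|B g _]; first by rewrite inE => /eqP->.
by rewrite big_seq1 mulr1z.
Qed.

Lemma expandsD s s1 s2 (z1 z2 : int) : expands s1 -> expands s2 ->
  (forall (B : zmodType) (g : seq T -> B), symbol U g -> g s = g s1 *~ z1 + g s2 *~ z2) ->
  expands s.
Proof.
move=> [e1 [f1 E1]] [e2 [f2 E2]] E.
exists ([seq (z1 * z.1, z.2) | z <- e1] ++ [seq (z2 * z.1, z.2) | z <- e2]); split.
  by move=> z; rewrite mem_cat => /orP[] /mapP[z' z'e ->] /=; [apply: f1|apply: f2].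
move=> B g gS; rewrite (E B g gS) (E1 B g gS) (E2 B g gS) big_cat /= !big_map !mulrz_suml.
by congr (_ + _); apply: eq_bigr => z _; rewrite -mulrzA mulrC.
Qed.

Lemma expandsZ s s1 (z : int) : expands s1 ->
  (forall (B : zmodType) (g : seq T -> B), symbol U g -> g s = g s1 *~ z) -> expands s.
Proof.
by move=> e1 E; apply: (expandsD (z1 := z) (z2 := 0) e1 e1) => B g /E->; rewrite mulr0z addr0.
Qed.

Lemma sframe_head p q s : sframe U (p :: s) -> good q -> pl q = pl p -> sframe U (q :: s).
Proof. by rewrite !sframe_cons // => /and3P[_ pU f] gq E; rewrite E gq pU f. Qed.

Lemma ctx_head p s : sframe U (p :: s) -> ctx U [::] (pl p) s /\ sframe (pl p) [:: p].
Proof.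
rewrite -[p :: s]/([::] ++ [:: p] ++ s) sframe_ctx => /andP[c o]; split; first by rewrite plsum1 in c.
by rewrite sframeE o plsum1 eqxx.
Qed.

(** For lines a, b, c in one plane the three-term relation reads (b, c) = (a, c) - (a, b), so any
    line of the first plane can be made the leading one. The degenerate cases are a = b and a = c,
    the latter a flip. *)
Lemma expands_line p s a : sframe U (p :: s) -> \dim a = 1%N -> (a <= pl p)%VS ->
  (forall c, sframe U ((a, c) :: s) -> pl (a, c) = pl p -> expands ((a, c) :: s)) ->
  expands (p :: s).
Proof.
move=> f da ap H; have gp : good p by move: f; rewrite sframe_cons // => /and3P[].
have [c0 f1] := ctx_head f; have nd := nondeg_pl om_alt gp; have d2 := dim_pl om_alt gp.
case: p f gp ap H c0 f1 nd d2 => b c f gp ap H c0 f1 nd d2.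
have [db dc] : \dim b = 1%N /\ \dim c = 1%N by case/and3P: gp => /eqP ? /eqP ?.
have bX : (b <= pl (b, c))%VS by apply: addvSl.
have cX : (c <= pl (b, c))%VS by apply: addvSr.
have ex (x y : VS) : x != y -> \dim x = 1%N -> \dim y = 1%N -> (x <= pl (b, c))%VS -> (y <= pl (b, c))%VS ->
    [/\ good (x, y), pl (x, y) = pl (b, c) & sframe (pl (b, c)) [:: (x, y)]].
  move=> xy dx dy xX yX; have g : good (x, y) by rewrite (good_lines om_alt nd d2).
  have E : pl (x, y) = pl (b, c) by apply: lineD_eq.
  by split=> //; rewrite sframeE orthogonal_frame_cons g plsum_nil perp0r plsum1 E eqxx.
have [E|ab] := eqVneq a b; first by rewrite -E; apply: H; rewrite E.
have [ac|ac] := eqVneq a c.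
  rewrite -{}ac in H bX c0 f1 f gp cX nd d2 ex *; have [g E _] := ex a b ab da db cX bX.
  apply: (expandsZ (z := -1) (H b (sframe_head f g E) E)) => B h hS.
  by have /= -> := symbol_flip hS (s1 := [::]) c0 f1; rewrite mulrN1z opprK.
have [g1 E1 h1] := ex a b ab da db ap bX; have [g2 E2 h2] := ex a c ac da dc ap cX.
apply: (expandsD (z1 := 1) (z2 := -1) (H c (sframe_head f g2 E2) E2) (H b (sframe_head f g1 E1) E1)).
move=> B h hS; have /= := symbol_three hS (s1 := [::]) c0 h1 h2 f1.
by move=> E; apply/eqP; rewrite mulr1z mulrN1z -subr_eq0 -[X in _ == X]E; apply/eqP; abel.
Qed.

Local Notation hit := (fun p => ~~ perp L (pl p)).

Lemma expands_frame s : sframe U s -> expands s.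
Proof.
have [x x0 Lx] : exists2 x, x != 0 & L = <[x]>%VS by apply/dim1P/eqP.
have [n] := ubnP (count hit s); elim: n s => // n IHn s; rewrite ltnS => sn f.
have front s1 p s2 : sframe U (s1 ++ p :: s2) ->
    sframe U (p :: s1 ++ s2) /\ (expands (p :: s1 ++ s2) -> expands (s1 ++ p :: s2)).
  move=> f'; split; last first.
    by move=> e; apply: (expandsZ e) => B g gS; rewrite (symbol_front om_alt gS f').
  move: f'; rewrite -[p :: s2]/([:: p] ++ s2) sframe_ctx.
  by rewrite -[p :: s1 ++ s2]/([::] ++ [:: p] ++ s1 ++ s2) sframe_ctx.
have perp_plsum t : ~~ has hit t -> perp L (plsum t).
  elim: t => [|p t IHt]; first by rewrite plsum_nil perp0r.
  by rewrite /= negb_or negbK plsum_cons perpDr => /andP[-> /IHt].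
have ndU := sframe_nondeg om_alt f.
(* If every plane were orthogonal to [L], then [L] would lie in the radical of [U]. *)
have : has hit s.
  apply: contraT => /perp_plsum; have /andP[_ /eqP->] := f => LpU.
  have : (L <= 0)%VS by rewrite -(eqP ndU) subv_cap LU.
  by rewrite subv0 -dimv_eq0 dL.
case/hasP=> p ps hp; case/splitPr: ps sn f => s1 s2 sn f.
have [fp ep] := front _ _ _ f; apply: ep.
move: sn; rewrite count_cat /= hp addnCA -count_cat add1n => sn.
move: (s1 ++ s2) fp sn => {f s1 s2} s fp sn.
(* When only the first plane is not orthogonal to [L], the line [L] lies in that plane and can be
   made the leading line. *)
have [/hasP [q qs hq]|nohit] := boolP (has hit s); last first.
  apply: (expands_line fp dL) => [|c fc _]; last exact: expands_head.
  have /andP[/and3P[gp pS os] /eqP E] := fp.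
  rewrite perpC in pS; have := cap_perp_add (orthogonal_frame_nondeg om_alt os) pS.
  rewrite addvC -plsum_cons E => <-; rewrite subv_cap LU; exact: perp_plsum.
case/splitPr: qs sn fp => s1 s2 sn fp.
have [fq eq] := front (p :: s1) q s2 fp; apply: eq.
move: sn; rewrite count_cat /= hq addnCA -count_cat add1n => sn.
rewrite /= in fq *; move: (s1 ++ s2) fq sn => {fp s1 s2} s fq sn.
(* [y] is the component of [x] in the plane of [r], characterised by having the same pairing with
   every vector of that plane; it is nonzero because the plane is not orthogonal to [L]. *)
have comp r : good r -> hit r -> exists2 y, y \in pl r &
    forall w, w \in pl r -> om x w = om y w /\ (y != 0).
  case/goodP=> u [v [Eu Ev uv]] hr.
  have vu : om v u = -1 by rewrite om_anti uv.
  exists (om x v *: u - om x u *: v).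
    by rewrite /pl Eu Ev memvB // memvZ // memvE ?addvSl ?addvSr.
  have E w : w \in pl r -> om x w = om (om x v *: u - om x u *: v) w.
    rewrite /pl Eu Ev => /memv_addP[_ /vlineP[k ->] [_ /vlineP[l ->] ->]].
    rewrite !(omDl, omDr, omNl, omNr, omZl, omZr, om_alt, uv, vu).
    by rewrite !(mulr0, mulr1, mulrN, opprK, add0r, addr0, oppr0) addrC mulrC [k * _]mulrC.
  move=> w wr; split; first exact: E.
  apply: contraNneq hr => y0; apply/perpP => z w' zL w'r; move: zL; rewrite Lx => /vlineP[k ->].
  by rewrite omZl (E w' w'r) y0 linear0l mulr0.
have [gq gp] : good q /\ good p by move: fq; rewrite !sframe_cons // => /and4P[-> _ ->].
have [yp ypp Ep] := comp p gp hp; have [yq yqq Eq] := comp q gq hq.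
have yp0 : yp != 0 by case: (Ep yp ypp).
have yq0 : yq != 0 by case: (Eq yq yqq).
apply: (expands_line (a := <[yq]>%VS) fq) => [||c fc Ec]; rewrite ?dim_vline ?yq0 //.
have [fc' ec] := front [:: (<[yq]>%VS, c)] p s fc; apply: ec; rewrite /= in fc' *.
apply: (expands_line (a := <[yp]>%VS) fc') => [||d fd Ed]; rewrite ?dim_vline ?yp0 //.
have [gd gc] : good (<[yp]>%VS, d) /\ good (<[yq]>%VS, c).
  by move: fd; rewrite !sframe_cons // => /and4P[-> _ ->].
(* The second lines are scaled to pair to 1 with the components [yp] and [yq], hence also with [x].
   Both generators then have the same pairing with [x], and their difference is orthogonal to
   [L]. *)
have hyp y e : good (<[y]>%VS, e) -> exists2 b, e = <[b]>%VS & om y b = 1.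
  case/and3P => /= _ /dim1P[b b0 ->]; rewrite perp_lines => yb; exists ((om y b)^-1 *: b).
    by apply/vspaceP => z; apply/vlineP/vlineP => -[k ->];
      [exists (k * om y b)|exists (k / om y b)]; rewrite scalerA ?mulfK ?mulfVK.
  by rewrite omZr mulVf.
have [b1 dE yb1] := hyp _ _ gd; have [b2 cE yb2] := hyp _ _ gc.
rewrite {}dE {}cE in fd Ed Ec *.
have [F1 F2 _] := symbol_merge om_alt (ap_symbol om_alt U) yb1 yb2 fd.
have xb1 : om x b1 = 1.
  by case: (Ep b1) => [|-> //]; rewrite -Ed memvE addvSr.
have xb2 : om x b2 = 1.
  by case: (Eq b2) => [|-> //]; rewrite -Ec memvE addvSr.
have xyp : om x yp = 0 by case: (Ep yp ypp) => -> _.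
have xyq : om x yq = 0 by case: (Eq yq yqq) => -> _.
have xb : om x (b2 - b1) = 0 by rewrite omDr omNr xb1 xb2 subrr.
(* In both merged frames the second plane is spanned by vectors orthogonal to [x]. At most one of
   the two planes still meets the count, so it drops. *)
have p1 : perp L (pl (<[yq]>%VS, <[b2 - b1]>%VS)).
  by rewrite Lx perpDr !perp_lines xyq xb eqxx.
have p2 : perp L (pl (<[b2 - b1]>%VS, <[yp]>%VS)).
  by rewrite Lx perpDr !perp_lines xyp xb eqxx.
apply: (expandsD (z1 := 1) (z2 := 1) (IHn _ _ F1) (IHn _ _ F2)) => [||B g gS].
- by rewrite /= p1 add0n; apply: leq_ltn_trans sn; case: (~~ _).
- by rewrite /= p2 add0n; apply: leq_ltn_trans sn; case: (~~ _).
by rewrite !mulr1z; have [_ _ ->] := symbol_merge om_alt gS yb1 yb2 fd.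
Qed.

End Expansion.

(** * Cycles of isotropic flags *)

Section Deletion.
Variables (T : eqType) (x0 : T).
Implicit Types s t : seq T.

Definition del j s := take j s ++ drop j.+1 s.

Lemma nth_del j k s : (k < size s)%N -> k != j -> nth x0 s k = nth x0 (del j s) (unbump j k).
Proof.
elim: s j k => [|x s IHs] [|j] [|k] //= ks kj; first by rewrite /unbump subn1 /del /= ?drop0.
by rewrite unbumpS; apply: IHs.
Qed.

Lemma del_inj j s t : size s = size t -> (j < size s)%N -> del j s = del j t ->
  nth x0 s j = nth x0 t j -> s = t.
Proof.
move=> st js dst nst; apply: (eq_from_nth (x0 := x0)) => // k ks.
have [->//|kj] := eqVneq k j.
by rewrite (nth_del ks kj) dst -nth_del // -st.
Qed.
End Deletion.

Lemma map_del (T T' : Type) (f : T -> T') j s :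
  map f (take j s ++ drop j.+1 s) = take j (map f s) ++ drop j.+1 (map f s).
Proof. by rewrite map_cat map_take map_drop. Qed.

(** The sum of the remaining entries determines the deleted one. Applied to dimensions: a face of a
    full flag tells which member is missing. *)
Lemma del_iota i j m : (i < m)%N -> (j < m)%N -> del i (iota 1 m) = del j (iota 1 m) -> i = j.
Proof.
have H k : (k < m)%N -> (sumn (del k (iota 1 m)) + k.+1 = sumn (iota 1 m))%N.
  move=> km; rewrite -[in RHS](cat_take_drop k (iota 1 m)) (drop_nth 0%N) ?size_iota //.
  by rewrite !sumn_cat /= nth_iota // add1n addnAC addnA addnAC.
by move=> im jm E; have := H i im; rewrite E -(H j jm) => /addnI[].
Qed.

Section Cycles.
Variables (K : fieldType) (V : vectType K) (om : {skew_symmetric V}).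
Hypothesis om_alt : forall x, om x x = 0.
Local Notation VS := {vspace V}.
Local Notation T := (VS * VS)%type.
Local Notation perp := (perp om).
Local Notation nondeg := (nondeg om).
Local Notation sframe := (sframe om).
Local Notation "U ^|_" := (orthov om U) (at level 2, format "U ^|_").
Local Notation D := {freeg (seq VS) / int}.
Implicit Types (U W P X Y L : VS) (u v w x y : V) (p q : T) (s t : seq T) (F G : seq VS) (c : D).

Definition cover X Y := (X <= Y)%VS && (\dim Y == (\dim X).+1).

(** Each step raises the dimension by exactly one. From 0, with [m] half the dimension of a
    nondegenerate [U], these are the maximal flags of isotropic subspaces. *)
Definition flag_from X U m F :=
  [&& size F == m, path cover X F & all (fun Y => isotropic om Y && (Y <= U)%VS) F].

Lemma isotropic_add X a U : isotropic om X -> (X <= U)%VS -> \dim a = 1%N -> perp a U ->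
  isotropic om (X + a)%VS.
Proof.
move=> iX XU da aU; have aX := perpS (subvv a) XU aU.
rewrite /isotropic -perpE perpDl !perpDr (perpC _ X a) aX.
have -> : perp X X := iX; exact: (isotropic_line om_alt da).
Qed.

(** Orthogonality of [a] to [U'] keeps the enlarged members isotropic, and [a] not lying in [U']
    makes each grow by exactly one dimension. *)
Lemma ins_flag X U' U a m F : (U' <= U)%VS -> (a <= U)%VS -> \dim a = 1%N ->
  ~~ (a <= U')%VS -> perp a U' -> isotropic om X -> (X <= U')%VS ->
  flag_from X U' m F -> supp (flag_from X U m.+1) (ins X a F).
Proof.
move=> UU aU da naU apU; elim: F X m => [|x F IHF] X m iX XU.
  move=> /and3P[/eqP<- _ _]; apply: suppU; rewrite /flag_from /= /cover addvSl.
  rewrite (dim_line_add da) ?eqxx ?(isotropic_add iX XU) ?subv_add ?(subv_trans XU) ?aU //.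
  by apply: contra naU => /subv_trans->.
have cov Y Z : (Z <= U')%VS -> (Y <= U')%VS -> cover Y Z -> cover (a + Y)%VS (a + Z)%VS.
  move=> ZU YU /andP[YZ /eqP dZ]; rewrite /cover addvS //= ![(a + _)%VS]addvC.
  by rewrite !dim_line_add ?dZ //; apply: contra naU => /subv_trans->.
move=> /and3P[/eqP<- /= /andP[cXx pF] /andP[/andP[ix xU] aF]].
have naX : ~~ (a <= X)%VS by apply: contra naU => /subv_trans->.
have nax : ~~ (a <= x)%VS by apply: contra naU => /subv_trans->.
apply: suppB.
  apply: suppU; rewrite /flag_from /= size_map eqxx /=.
  have -> : cover X (X + a)%VS by rewrite /cover addvSl dim_line_add ?eqxx.
  have ia Y : isotropic om Y -> (Y <= U')%VS -> isotropic om (a + Y)%VS && (a + Y <= U)%VS.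
    by move=> iY YU; rewrite [(a + Y)%VS]addvC (isotropic_add iY YU) // subv_add aU (subv_trans YU).
  have p2 : path cover (a + x)%VS (map (addv a) F).
    elim: F x {IHF cXx ix nax} xU pF aF => //= y F IHF x xU /andP[xy pF] /andP[/andP[_ yU] aF].
    by rewrite cov //= IHF.
  have p3 : all (fun Y => isotropic om Y && (Y <= U)%VS) (map (addv a) F).
    by apply/allP => _ /mapP[Y /(allP aF)/andP[iY YU] ->]; apply: ia.
  by rewrite [(X + a)%VS]addvC cov // p2 p3 !ia.
apply: (supp_fgext (Q := flag_from x U (size F).+1)).
  by apply: (IHF x) => //; rewrite /flag_from eqxx pF.
move=> G /and3P[/eqP sG pG aG]; apply: suppU.
by rewrite /flag_from /= sG eqxx cXx pG ix (subv_trans xU) ?aG.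
Qed.

Local Notation fflag := (flag_from 0).

Lemma ap_flag U s : sframe U s -> supp (fflag U (size s)) (ap s).
Proof.
elim: s U => [|[a b] s IHs] U f; first by apply: suppU.
rewrite ap_cons apDE; move: f; rewrite sframe_cons // => /and3P[g pU f].
have [da db] : \dim a = 1%N /\ \dim b = 1%N by case/and3P: g => /eqP ? /eqP ?.
have nab : ~~ perp a b by case/and3P: g.
move: pU; rewrite subv_add => /andP[aU bU].
have i0 : isotropic om 0%VS by rewrite /isotropic sub0v.
set U' := (U :&: _)%VS in f.
have := perp_cap om U (pl (a, b)); rewrite -/U' perpDr ![perp U' _]perpC => /andP[aU' bU'].
apply: suppB; apply: (supp_fgext (IHs _ f)) => F; apply: ins_flag => //; rewrite ?capvSl ?sub0v //.
  apply: contra nab => /(fun H => perpS H (subvv b)); apply.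
  by rewrite perpC.
apply: contra nab => /(fun H => perpS (subvv a) H); exact.
Qed.

Lemma flag_dims X U m F : flag_from X U m F -> [seq \dim Y | Y <- F] = iota (\dim X).+1 m.
Proof.
by case/and3P=> /eqP<- + _; elim: F X => //= Y F IHF X /andP[/andP[_ /eqP dY] /IHF->]; rewrite dY.
Qed.

Lemma flag_size X U m F : flag_from X U m F -> size F = m.
Proof. by case/and3P=> /eqP. Qed.

Section FullFlag.
Variables (U : VS) (m : nat) (F : seq VS).
Hypothesis fF : fflag U m F.

Lemma flag_dim i : (i < m)%N -> \dim (nth 0%VS F i) = i.+1.
Proof.
move=> im; rewrite -(nth_map 0%VS 0%N) ?(flag_size fF) // (flag_dims fF) dimv0.
by rewrite nth_iota // add1n.
Qed.

Lemma flag_iso i : (i < m)%N -> isotropic om (nth 0%VS F i) && (nth 0%VS F i <= U)%VS.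
Proof.
case/and3P: fF => /eqP <- _ /allP aF im; apply: aF; exact: mem_nth.
Qed.

Lemma flag_sub i : (i.+1 < m)%N -> (nth 0%VS F i <= nth 0%VS F i.+1)%VS.
Proof.
case/and3P: fF => /eqP <- /(pathP 0%VS) pF _ im; by case/andP: (pF i.+1 im).
Qed.
End FullFlag.

Lemma bd_sum F : bd F = \sum_(i < size F) [fg take i F ++ drop i.+1 F] *~ (-1) ^+ i.
Proof.
elim: F => [|x F IHF]; first by rewrite big_ord0.
rewrite big_ord_recl /= drop0 expr0 mulr1z IHF raddf_sum -sumrN; congr (_ + _).
by apply: eq_bigr => i _; rewrite raddfMz /= consDE exprS mulN1r mulrNz.
Qed.

Definition iscycle U m c := supp (fflag U m) c /\ bdD c = 0.

(** The face [del i F] can only arise by deleting a member in position [i], for dimension reasons,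
    and by assumption from no other flag of [c]. Its coefficient in the boundary is thus [coeff F c]
    up to sign. *)
Lemma cycle_unique U m c F i : iscycle U m c -> fflag U m F -> (i < m)%N ->
  (forall G, coeff G c != 0 -> del i G = del i F -> G = F) -> coeff F c = 0.
Proof.
move=> [cU bc] fF im uF; have := congr1 (coeff (del i F)) bc.
rewrite /bdD fgextEsum raddf_sum /= coeff0 => E.
suff E' G : G \in dom c -> coeff (del i F) (bd G *~ coeff G c) =
    if G == F then coeff G c * (-1) ^+ i else 0.
  have [Fc|/coeff_outdom//] := boolP (F \in dom c).
  move: E; rewrite (eq_big_seq _ E') (bigD1_seq F) ?uniq_dom //= eqxx big1 => [|G /negPf-> //].
  by move/eqP; rewrite addr0 mulf_eq0 signr_eq0 orbF => /eqP.
rewrite mem_dom => Gc; have fG := cU _ Gc.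
rewrite raddfMz /= bd_sum raddf_sum (flag_size fG) (bigD1 (Ordinal im)) //= big1 => [|j ji].
  rewrite addr0 raddfMz /= coeffU mul1r -/(del _ _) -mulrzr intz.
  case: (G =P F) => [->|GF]; first by rewrite eqxx -mulrzr mul1r !intz mulrC.
  by case: eqP => [/(uF _ Gc)//|_]; rewrite mul0rz mul0r.
rewrite raddfMz /= coeffU mul1r -/(del _ _); case: eqP => [E'|_]; last by rewrite mul0rz.
case/eqP: ji; apply/val_inj => /=; apply: (@del_iota _ _ m) => //.
have := congr1 (map (fun Y : VS => \dim Y)) E'.
by rewrite !map_del (flag_dims fF) (flag_dims fG) dimv0.
Qed.

Lemma cap_line_perp X L : \dim L = 1%N -> ~~ perp X L -> \dim (X :&: L^|_)%VS = (\dim X).-1.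
Proof.
move=> /eqP/dim1P[x _ ->] nXx; rewrite -eq_dim_orthov1 //.
by apply: contra nXx; rewrite memvE perpC.
Qed.

(* Going up, all subspaces in the flags of [c] are orthogonal to [L]; going
   down from the maximal ones, they all contain [L]; so their lines equal [L]. *)
Lemma cycle_perp0 U m c L : nondeg U -> \dim U = (m.+1).*2 -> \dim L = 1%N -> (L <= U)%VS ->
  iscycle U m.+1 c -> (forall F, coeff F c != 0 -> perp (nth 0%VS F 0) L) -> c = 0.
Proof.
move=> ndU dU dL LU cc h0; have [cU _] := cc.
have uniq F i : coeff F c != 0 -> (i < m.+1)%N ->
    ~ (forall G, coeff G c != 0 -> del i G = del i F -> nth 0%VS G i = nth 0%VS F i).
  move=> Fc im H; case/eqP: (Fc); apply: (cycle_unique cc (cU _ Fc) im) => G Gc dG.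
  apply: (del_inj (x0 := 0%VS) _ _ dG (H G Gc dG)); rewrite ?(flag_size (cU _ Gc)) //.
  by rewrite (flag_size (cU _ Fc)).
have neq F G i j : coeff F c != 0 -> coeff G c != 0 -> del i G = del i F -> (j < m.+1)%N ->
    j != i -> nth 0%VS G j = nth 0%VS F j.
  move=> Fc Gc dGF jm ji.
  by rewrite (nth_del _ _ ji) ?(flag_size (cU _ Gc)) // dGF -nth_del ?(flag_size (cU _ Fc)).
have up j : (j < m.+1)%N -> forall F, coeff F c != 0 -> perp (nth 0%VS F j) L.
  elim: j => [|j IHj] jm F Fc; first exact: h0.
  (* If member [j.+1] is not orthogonal to [L], then member [j], which is, must be its intersection
     with the orthogonal of [L]. All flags of [c] sharing the face without member [j] then agree
     there, against [uniq]. *)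
  apply: contraT => nF; case: (uniq F j Fc (ltnW jm)) => G Gc dG.
  have E := neq F G j j.+1 Fc Gc dG jm (negbT (gtn_eqF (ltnSn j))).
  have C H : coeff H c != 0 -> nth 0%VS H j.+1 = nth 0%VS F j.+1 ->
      nth 0%VS H j = (nth 0%VS F j.+1 :&: L^|_)%VS.
    move=> Hc EH; apply/eqP; rewrite eqEdim subv_cap -EH (flag_sub (cU _ Hc)) //= EH.
    rewrite -perpE IHj ?(ltnW jm) //= cap_line_perp //.
    by rewrite (flag_dim (cU _ Fc)) // (flag_dim (cU _ Hc)) // ltnW.
  by rewrite !C.
have down j : (j < m.+1)%N -> forall F, coeff F c != 0 -> (L <= nth 0%VS F (m - j))%VS.
  elim: j => [|j IHj] jm F Fc.
    rewrite subn0; have /andP[iF FU] := flag_iso (cU _ Fc) (ltnSn m).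
    (* The top member is orthogonal to [L]; if it did not contain [L], their sum would be isotropic
       of dimension m + 2 in genus m + 1. *)
    apply: contraT => nL; have iX : isotropic om (nth 0%VS F m + L)%VS.
      apply: (isotropic_add iF (subvv _) dL); rewrite perpC; exact: up.
    have := isotropic_dim ndU dU _ iX; rewrite subv_add FU LU => /(_ isT).
    by rewrite (dim_line_add dL nL) (flag_dim (cU _ Fc)) // ltnn.
  set i := (m - j.+1)%N; have Si : (m - j)%N = i.+1 by rewrite /i subnS prednK // subn_gt0.
  have im : (i.+1 < m.+1)%N by rewrite -Si ltnS leq_subr.
  rewrite Si in IHj.
  (* Dually, a member not containing [L] forces the next one to be its sum with [L]. *)
  apply: contraT => nL; case: (uniq F i.+1 Fc im) => G Gc dG.
  have E := neq F G i.+1 i Fc Gc dG (ltnW im) (negbT (ltn_eqF (ltnSn i))).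
  have C H : coeff H c != 0 -> nth 0%VS H i = nth 0%VS F i ->
      nth 0%VS H i.+1 = (nth 0%VS F i + L)%VS.
    move=> Hc EH; apply/esym/eqP; rewrite eqEdim subv_add -EH (flag_sub (cU _ Hc)) //.
    rewrite IHj ?(ltnW jm) // EH (dim_line_add dL nL) (flag_dim (cU _ Fc)) ?(ltnW im) //.
    by rewrite (flag_dim (cU _ Hc) im) /=.
  by rewrite !C.
apply/eqP/freeg_eqP => F; rewrite coeff0; have [//|Fc] := eqVneq (coeff F c) 0.
case: (uniq F 0%N Fc isT) => G Gc _.
have C H : coeff H c != 0 -> nth 0%VS H 0 = L.
  move=> Hc; apply/esym/(line_sub_eq dL); first by rewrite (flag_dim (cU _ Hc)).
  by have := down m (ltnSn m) H Hc; rewrite subnn.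
by rewrite !C.
Qed.

End Cycles.

(** * Residues at a line; apartments generate the cycles and satisfy only the symbol relations *)

Section Residues.
Variables (K : fieldType) (V : vectType K) (om : {skew_symmetric V}).
Hypothesis om_alt : forall x, om x x = 0.
Local Notation VS := {vspace V}.
Local Notation T := (VS * VS)%type.
Local Notation perp := (perp om).
Local Notation nondeg := (nondeg om).
Local Notation good := (good om).
Local Notation sframe := (sframe om).
Local Notation ctx := (ctx om).
Local Notation symbol := (symbol om).
Local Notation "U ^|_" := (orthov om U) (at level 2, format "U ^|_").
Local Notation D := {freeg (seq VS) / int}.
Local Notation fflag := (flag_from om 0).
Local Notation iscycle := (iscycle om).
Implicit Types (W P X Y : VS) (u v w x y : V) (p q : T) (s t : seq T) (F G : seq VS) (c : D).

Section Residue.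
Variables (U L b : VS) (m : nat).
Hypotheses (dL : \dim L = 1%N) (LU : (L <= U)%VS).
Hypotheses (db : \dim b = 1%N) (bU : (b <= U)%VS) (nbL : ~~ perp b L).

(* The flags of [U] starting with the line [b] correspond to the flags of
   [residue_space], via [cons b (map (addv b) _)]. *)
Definition residue_space : VS := (U :&: (pl (L, b))^|_)%VS.
Local Notation U' := residue_space.

Definition residue_flag F : D :=
  if F is x :: F' then if x == b then [fg map (capv U') F'] else 0 else 0.

Definition residue : D -> D := fgext residue_flag.
HB.instance Definition _ := GRing.Additive.on residue.

Lemma residueE F : residue [fg F] = residue_flag F. Proof. exact: fgextE. Qed.

Lemma residue_cons (x : VS) c : residue (consD x c) = if x == b then mapD (capv U') c else 0.
Proof.
case: ifP => xb.
  apply: (fg_ext (f := residue \o consD x) (g := mapD (capv U'))) => t /=.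
  by rewrite consDE residueE /= xb mapDE.
apply: (fg_ext (f := residue \o consD x) (g := \0)) => t /=.
by rewrite consDE residueE /= xb.
Qed.

Lemma good_Lb : good (L, b).
Proof. by rewrite goodE /= dL db perpC nbL. Qed.

Lemma cap_residue X : isotropic om X -> (X <= U)%VS -> (b <= X)%VS ->
  (U' :&: X = X :&: L^|_)%VS.
Proof.
move=> iX XU bX; have bX' : (X <= b^|_)%VS by apply: (perpS (om := om) (subvv X) bX iX).
rewrite /residue_space orthovDE; apply/eqP; rewrite eqEsubv !subv_cap capvSr capvSl.
rewrite (subv_trans (capvSl _ _) XU) (subv_trans (capvSl _ _) bX') capvSr.
by rewrite !andbT (subv_trans (capvSl _ _)) // (subv_trans (capvSr _ _)) ?capvSl.
Qed.

Lemma cap_residue_dim X : isotropic om X -> (X <= U)%VS -> (b <= X)%VS ->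
  (\dim (U' :&: X)%VS).+1 = \dim X.
Proof.
move=> iX XU bX; rewrite cap_residue // cap_line_perp //.
  by rewrite prednK // (leq_trans _ (dimvS bX)) ?db.
by apply: contra nbL => XL; apply: perpS bX (subvv L) XL.
Qed.

Lemma cap_residueK X : isotropic om X -> (X <= U)%VS -> (b <= X)%VS -> (b + (U' :&: X) = X)%VS.
Proof.
move=> iX XU bX; apply/eqP; rewrite eqEdim subv_add bX capvSr /= addvC dim_line_add //.
  by rewrite cap_residue_dim.
apply: contra nbL => /subv_trans /(_ (capvSl _ _)).
by rewrite subv_cap -perpE perpDr => /andP[_ /andP[]].
Qed.

Lemma residue_space_nondeg : nondeg U -> nondeg U'.
Proof.
move=> ndU; apply: nondeg_cap => //; first exact/nondeg_pl/good_Lb.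
by rewrite subv_add LU.
Qed.

Lemma residue_space_dim : nondeg U -> \dim U = (m.+1).*2 -> \dim U' = m.*2.
Proof.
move=> ndU dU; have PU : (pl (L, b) <= U)%VS by rewrite subv_add LU bU.
have /eqP := dim_orthov_nondeg ndU PU.
by rewrite (dim_pl om_alt good_Lb) dU doubleS -(addn2 m.*2) eqn_add2r => /eqP.
Qed.

Lemma flag_cons_cond F : fflag U m.+1 (b :: F) ->
  all (fun X => [&& isotropic om X, X <= U & b <= X]%VS) F.
Proof.
move=> /and3P[_ /= /andP[_ pF] /andP[_ aF]].
have [Y YE bY] : exists2 Y, Y = b & (b <= Y)%VS by exists b.
rewrite -{}YE in pF.
elim: F Y bY pF aF => //= X F IHF Y bY /andP[/andP[YX _] pF] /andP[/andP[-> ->] aF].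
by rewrite (subv_trans bY YX) (IHF X) // (subv_trans bY YX).
Qed.

Lemma residue_flag_supp F : fflag U m.+1 F -> supp (fflag U' m) (residue_flag F).
Proof.
case: F => [|x F] fF /=; first exact: supp0.
case: eqP => [xb|_]; last exact: supp0.
rewrite {x}xb in fF *; have aF := flag_cons_cond fF.
case/and3P: fF => /= sF /andP[_ pF] /andP[/andP[ib _] _].
rewrite eqSS in sF.
apply: suppU; rewrite /flag_from size_map sF /=; apply/andP; split; last first.
  rewrite all_map; apply: sub_all aF => X /and3P[iX _ _] /=; rewrite capvSl andbT.
  by apply: perpS iX; apply: capvSr.
have <- : (U' :&: b = 0)%VS.
  by apply/eqP; rewrite -dimv_eq0 -eqSS cap_residue_dim ?db.
have : [&& isotropic om b, b <= U & b <= b]%VS by rewrite ib bU subvv.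
suff gen G Y : [&& isotropic om Y, Y <= U & b <= Y]%VS -> path (cover (V:=V)) Y G ->
    all (fun X => [&& isotropic om X, X <= U & b <= X]%VS) G ->
    path (cover (V:=V)) (U' :&: Y)%VS (map (capv U') G).
  by move=> cb; apply: gen.
elim: G Y => //= X G IHG Y cY /andP[/andP[YX /eqP dYX] pG] /andP[cX aG].
rewrite IHG // andbT /cover capvS //=.
by case/and3P: cX => ? ? ?; case/and3P: cY => ? ? ?; rewrite -eqSS !cap_residue_dim ?dYX.
Qed.

Lemma residue_bd c : supp (fflag U m.+1) c -> bdD (residue c) = - residue (bdD c).
Proof.
move=> cU; apply: (supp_ext (f := bdD \o residue) (g := \- (residue \o bdD)) cU) => F fF /=.
rewrite residueE bdDE; case: F fF => [|x F] fF /=; first by rewrite !raddf0.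
rewrite raddfB /= residue_cons residueE.
(* Deleting [b] leaves a flag that begins with a plane, whose residue at [b] is zero. The surviving
   faces have their position shifted by one, which produces the sign. *)
have -> : residue_flag F = 0.
  case: F fF => //= y F fF; case: eqP => // yb; have := flag_dim fF (i := 1).
  by rewrite -(flag_size fF) /= yb db => /(_ isT).
rewrite sub0r opprK; case: ifP => _; last by rewrite raddf0.
by rewrite bdDE -bdDE -mapDE bdD_map bdDE.
Qed.

Lemma residue_cycle c : iscycle U m.+1 c -> iscycle U' m (residue c).
Proof.
move=> [cU bc]; split; first by apply: (supp_fgext cU) => F; apply: residue_flag_supp.
by rewrite residue_bd // bc raddf0 oppr0.
Qed.

Lemma residue_coeff c F : supp (fflag U m.+1) c -> fflag U m.+1 (b :: F) ->
  coeff (b :: F) c = coeff (map (capv U') F) (residue c).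
Proof.
move=> cU fF; apply: (supp_ext (f := coeff (b :: F)) (g := coeff (map (capv U') F) \o residue) cU).
move=> G fG /=; rewrite residueE coeffU mul1r.
case: G fG => [|x G] fG /=; first by rewrite coeff0.
rewrite eqseq_cons; case: eqP => [xb|_]; last by rewrite coeff0.
rewrite {x}xb in fG; rewrite coeffU mul1r; congr (nat_of_bool _)%:R.
apply/eqP/eqP => [-> //|E].
have aux H : fflag U m.+1 (b :: H) -> map (addv b) (map (capv U') H) = H.
  move=> /flag_cons_cond aH; rewrite -map_comp map_id_in // => X /(allP aH)/and3P[].
  exact: cap_residueK.
by rewrite -(aux G fG) E aux.
Qed.

Lemma residue_coeff0 c F : supp (fflag U m.+1) c -> residue c = 0 ->
  head 0%VS F = b -> coeff F c = 0.
Proof.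
move=> cU rc; have [//|Fc] := eqVneq (coeff F c) 0.
have := cU _ Fc; case: F Fc => [|x F] Fc fF /= xb; first by case/and3P: fF.
by rewrite xb in fF *; rewrite residue_coeff // rc coeff0.
Qed.

End Residue.

(** A first line of a flag in this apartment is [L], [b0] or a line of the complement of their
    plane. All but [b0] are orthogonal to [L], so a residue at a line [b] not orthogonal to [L] sees
    [b0] alone; the sign is that of the insertion of [b0] in the apartment. *)
Lemma residue_ap U L b b0 s : \dim b = 1%N -> (b <= U)%VS -> ~~ perp b L ->
  sframe U ((L, b0) :: s) ->
  residue U L b (ap ((L, b0) :: s)) = if b == b0 then - ap s else 0.
Proof.
move=> db bU nbL; rewrite sframe_cons // => /and3P[g pU f]; have as' := ap_flag om_alt f.
have dL : \dim L = 1%N by case/and3P: g => /eqP.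
have naL X : perp X L -> (X == b) = false by move=> XL; apply: contraTF XL => /eqP->.
have LL : (L == b) = false by apply: naL; apply: (isotropic_line om_alt).
rewrite ap_cons apDE /= raddfB /=.
have perpx X F : flag_from om 0 (residue_space U L b0) (size s) (X :: F) -> (X == b) = false.
  case/and3P=> _ _ /= /andP[/andP[_ XU] _]; apply: naL.
  by have := perpS XU (subvv _) (perp_cap om U (pl (L, b0))); rewrite perpDr => /andP[].
have R0 : residue U L b (insD 0 L (ap s)) = 0.
  apply: (supp_ext (f := residue U L b \o insD 0 L) (g := \0) as') => F fF /=.
  rewrite insDE; case: F fF => [|x F] fF /=; first by rewrite residueE /= add0v LL.
  by rewrite raddfB /= residueE /= add0v LL residue_cons (perpx _ _ fF) subrr.
rewrite R0 sub0r; case: eqP => [bb|/eqP bb].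
  congr (- _); rewrite -{b0}bb in f g pU as' perpx *.
  apply: (supp_ext (f := residue U L b \o insD 0 b) (g := idfun) as') => F fF /=.
  have bn : (b :&: residue_space U L b = 0)%VS.
    apply/eqP; rewrite line_disjoint //; apply: contra nbL => bb; apply: (perpS bb (subvv L)).
    by have := perp_cap om U (pl (L, b)); rewrite perpDr => /andP[].
  have E : map (capv (residue_space U L b)) (map (addv b) F) = F.
    rewrite -map_comp map_id_in // => X XF; case/and3P: fF => _ _ /allP/(_ X XF)/andP[_ XU] /=.
    by rewrite capvC [(b + X)%VS]addvC -(vspace_modl _ XU) bn addv0.
  rewrite insDE; case: F fF E => [|x F] fF E /=; first by rewrite residueE /= add0v eqxx.
  by rewrite raddfB /= residueE /= add0v eqxx residue_cons (perpx _ _ fF) subr0 -[in RHS]E.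
apply/eqP; rewrite oppr_eq0; apply/eqP.
apply: (supp_ext (f := residue U L b \o insD 0 b0) (g := \0) as') => F fF /=.
rewrite insDE; case: F fF => [|x F] fF /=; first by rewrite residueE /= add0v eq_sym (negPf bb).
by rewrite raddfB /= residueE /= add0v eq_sym (negPf bb) residue_cons (perpx _ _ fF) subrr.
Qed.

Lemma ctx_cons U p s1 W s2 : good p -> (pl p <= U)%VS -> ctx (U :&: (pl p)^|_)%VS s1 W s2 ->
  ctx U (p :: s1) W s2.
Proof.
move=> gp pU /and3P[o Wp /eqP E]; have ndp := nondeg_pl om_alt gp.
rewrite ctxE /= gp o plsum_cons perpDr Wp !andbT /=.
have : perp (W + plsum (s1 ++ s2))%VS (pl p) by rewrite E perp_cap.
rewrite perpDl => /andP[-> ]; rewrite perpC => -> /=.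
by rewrite addvA [(W + _)%VS]addvC -addvA E nondeg_split.
Qed.

Lemma symbol_tail (B : zmodType) U (g : seq T -> B) p : good p -> (pl p <= U)%VS ->
  symbol U g -> symbol (U :&: (pl p)^|_)%VS (fun s => g (p :: s)).
Proof.
move=> gp pU gS; have C := fun s1 W s2 => @ctx_cons U p s1 W s2 gp pU.
split=> [W s1 s2 a b /C c f|W s1 s2 a b d /C c f1 f2 f3|W s1 s2 v r /C c Q].
- exact: (symbol_flip gS c f).
- exact: (symbol_three gS c f1 f2 f3).
- exact: (symbol_six gS c Q).
Qed.

Definition all_frames U (e : seq (int * seq T)) := forall z, z \in e -> sframe U z.2.

Lemma apsum_flag U m (e : seq (int * seq T)) : \dim U = m.*2 -> all_frames U e ->
  iscycle U m (\sum_(z <- e) ap z.2 *~ z.1).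
Proof.
move=> dU fe; split; last first.
  by rewrite raddf_sum big1 // => z _; rewrite raddfMz /= bdD_ap mul0rz.
rewrite big_seq_cond; apply: supp_sum => z; rewrite andbT => /fe f; apply: suppMz.
by have := ap_flag om_alt f; have /eqP := sframe_dim om_alt f; rewrite dU -!muln2 eqn_mul2r /= => /eqP->.
Qed.

Lemma expand_all U L (e : seq (int * seq T)) : \dim L = 1%N -> (L <= U)%VS -> all_frames U e ->
  exists e' : seq (int * (VS * seq T)),
  (forall z, z \in e' -> sframe U ((L, z.2.1) :: z.2.2)) /\
  (forall (B : zmodType) (g : seq T -> B), symbol U g ->
     \sum_(z <- e) g z.2 *~ z.1 = \sum_(z <- e') g ((L, z.2.1) :: z.2.2) *~ z.1).
Proof.
move=> dL LU; elim: e => [|z e IHe] fe.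
  by exists [::]; split=> // B g _; rewrite !big_nil.
have [e1 [f1 E1]] := IHe (fun z' ze => fe z' (mem_behead (s := z :: e) ze)).
have [e2 [f2 E2]] := expands_frame om_alt dL LU (fe z (mem_head _ _)).
exists ([seq (z'.1 * z.1, z'.2) | z' <- e2] ++ e1); split=> [z'|B g gS].
  rewrite mem_cat => /orP[/mapP[z2 z2e ->]|z1e] /=.
    exact: f2 z2e.
  exact: f1 z1e.
rewrite big_cons (E1 _ _ gS) (E2 _ _ gS) big_cat big_map mulrz_suml /=; congr (_ + _).
by apply: eq_bigr => z' _; rewrite mulrzA.
Qed.

Lemma nondeg_line U m : \dim U = (m.+1).*2 -> exists2 L : VS, \dim L = 1%N & (L <= U)%VS.
Proof.
move=> dU; have v0 : vpick U != 0 by rewrite vpick0 -dimv_eq0 dU.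
by exists <[vpick U]>%VS; rewrite ?dim_vline ?v0 // -memvE memv_pick.
Qed.

Theorem ap_injective m U : nondeg U -> \dim U = m.*2 ->
  forall (B : zmodType) (g : seq T -> B), symbol U g ->
  forall e, all_frames U e -> \sum_(z <- e) ap z.2 *~ z.1 = 0 -> \sum_(z <- e) g z.2 *~ z.1 = 0.
Proof.
elim: m U => [|m IHm] U ndU dU B g gS e fe.
  (* In genus 0 the empty list is the only frame, and the coefficient of the empty flag reads off
     the sum of the multiplicities. *)
  have E (B' : zmodType) (h : seq T -> B') :
      \sum_(z <- e) h z.2 *~ z.1 = h [::] *~ (\sum_(z <- e) z.1).
    rewrite mulrz_sumr; apply: eq_big_seq => z /fe/(sframe_dim om_alt); rewrite dU.
    by case: (z.2).
  rewrite !E => /(congr1 (coeff [::])); rewrite raddfMz /= coeffU eqxx mul1r coeff0 intz => ->.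
  by rewrite mulr0z.
have [L dL LU] := nondeg_line dU; have [e' [fe' E]] := expand_all dL LU fe.
rewrite (E _ _ gS) (E _ _ (ap_symbol om_alt U)) => ap0.
pose bs := undup [seq z.2.1 | z <- e'].
have bsP z : z \in e' -> z.2.1 \in bs.
  by move=> ze; rewrite mem_undup; apply/mapP; exists z.
have E1 (X : int * (VS * seq T) -> B) :
    \sum_(z <- e') X z = \sum_(b <- bs) \sum_(z <- e' | z.2.1 == b) X z.
  transitivity (\sum_(z <- e') \sum_(b <- bs | z.2.1 == b) X z).
    apply: eq_big_seq => z ze; rewrite -big_filter (bigD1_seq z.2.1) ?filter_uniq ?undup_uniq //=; last first.
      by rewrite mem_filter eqxx bsP.
    rewrite big_seq_cond big1 ?addr0 // => b; rewrite mem_filter => /andP[/andP[/eqP-> _]].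
    by rewrite eqxx.
  by rewrite (exchange_big_dep xpredT).
(* The terms are grouped by the partner [b] of [L]; each group vanishes separately, by induction
   applied to the complement of the plane of [(L, b)]. *)
rewrite E1 big1_seq // => b /=; rewrite mem_undup => /mapP[z0 /fe'].
rewrite sframe_cons // => /and3P[g0 pU _] b0.
have db : \dim b = 1%N by case/and3P: g0 => _ /eqP + _; rewrite -b0.
have nbL : ~~ perp b L by case/and3P: g0 => _ _; rewrite perpC -b0.
move: pU; rewrite -b0 => pU; have bU : (b <= U)%VS by apply: subv_trans pU; apply: addvSr.
rewrite -b0 in g0; pose eb := [seq (z.1, z.2.2) | z <- e' & z.2.1 == b].
have febs : all_frames (residue_space U L b) eb.
  move=> _ /mapP[z + ->]; rewrite mem_filter => /andP[/eqP zb /fe'].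
  by rewrite zb sframe_cons // => /and3P[].
(* The residue at [b] removes the groups with other partners and turns the relation into one between
   the tails. *)
have ap1 : \sum_(z <- eb) ap z.2 *~ z.1 = 0.
  move/(congr1 (residue U L b)): ap0; rewrite raddf0 raddf_sum /= => ap0.
  rewrite big_map big_filter big_mkcond /= -[RHS]oppr0 -[in RHS]ap0 -sumrN.
  apply: eq_big_seq => z /fe' f.
  rewrite raddfMz /= residue_ap // eq_sym; case: ifP => _; rewrite ?mul0rz ?oppr0 //.
  by rewrite mulNrz opprK.
have := IHm _ (residue_space_nondeg dL LU db bU nbL ndU) (residue_space_dim dL LU db bU nbL ndU dU).
move=> /(_ B _ (symbol_tail g0 pU gS) eb febs ap1); rewrite big_map big_filter => E2.
by rewrite -[RHS]E2; apply: eq_bigr => z /eqP->.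
Qed.

Theorem ap_surjective m U : nondeg U -> \dim U = m.*2 ->
  forall c, iscycle U m c -> exists2 e, all_frames U e & c = \sum_(z <- e) ap z.2 *~ z.1.
Proof.
elim: m U => [|m IHm] U ndU dU c cc.
  exists [:: (coeff [::] c, [::])]; first by move=> z; rewrite inE => /eqP->; rewrite sframe_nil -dimv_eq0 dU.
  rewrite big_seq1 /=; apply/eqP/freeg_eqP => F; rewrite raddfMz /= coeffU mul1r.
  case: eqP => [<-|nF]; first by rewrite intz.
  rewrite mul0rz; have [//|/(cc.1 _)/flag_size/size0nil] := eqVneq (coeff F c) 0.
  by move/esym/nF.
have [L dL LU] := nondeg_line dU; have [cU bc] := cc.
(* The finitely many first lines in [c] at which the residue can detect something, those not
   orthogonal to [L]. *)
pose bs := undup [seq head 0%VS F | F <- dom c & ~~ perp (head 0%VS F) L].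
have headP F : coeff F c != 0 -> \dim (head 0%VS F) = 1%N /\ (head 0%VS F <= U)%VS.
  move=> Fc; have fF := cU _ Fc; rewrite -nth0 (flag_dim fF) //.
  by have /andP[] := flag_iso fF (ltn0Sn m).
have bsP b : b \in bs -> [/\ \dim b = 1%N, (b <= U)%VS & ~~ perp b L].
  rewrite mem_undup => /mapP[F]; rewrite mem_filter mem_dom => /andP[nF Fc] ->.
  by have [] := headP F Fc.
have /choice [eb ebP] : forall b, exists e : seq (int * seq T), b \in bs ->
    all_frames (residue_space U L b) e /\ residue U L b c = \sum_(z <- e) ap z.2 *~ z.1.
  move=> b.
  have [/bsP[db bU nbL]|_] := boolP (b \in bs); last by exists [::].
  have [] := IHm _ (residue_space_nondeg dL LU db bU nbL ndU) (residue_space_dim dL LU db bU nbL ndU dU)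
    (residue U L b c) _; first exact: residue_cycle cc.
  by move=> e fe E; exists e.
(* The sign compensates the one in [residue_ap], so that the residues of this combination agree with
   those of [c]. *)
pose e := flatten [seq [seq (- z.1, (L, b) :: z.2) | z <- eb b] | b <- bs].
have sumE (h : int * seq T -> {freeg (seq VS) / int}) :
    \sum_(z <- e) h z = \sum_(b <- bs) \sum_(z <- eb b) h (- z.1, (L, b) :: z.2).
  by rewrite big_flatten /= big_map; apply: eq_bigr => b _; rewrite big_map.
have ebF b z : b \in bs -> z \in eb b -> sframe U ((L, b) :: z.2).
  move=> bb zb; have [db bU nbL] := bsP b bb; have [/(_ z zb) f _] := ebP b bb.
  by rewrite sframe_cons // (good_Lb dL db nbL) /pl subv_add LU bU.
have fe : all_frames U e.
  by move=> z /flatten_mapP[b bb /mapP[z' z'b ->]]; apply: ebF.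
exists e => //; apply/eqP; rewrite -subr_eq0; apply/eqP.
have [eU ebd] := apsum_flag dU fe; set s := \sum_(z <- e) _ in eU ebd *.
have cs : iscycle U m.+1 (c - s).
  by split; [apply: suppB|rewrite raddfB /= bc ebd subrr].
(* The difference has zero residue at every line not orthogonal to [L], so all first lines in it are
   orthogonal to [L]. *)
apply: (cycle_perp0 om_alt ndU dU dL LU cs) => F Fc; apply: contraT; rewrite nth0 => nF.
have fF := cs.1 _ Fc; set b := head 0%VS F in nF.
have db : \dim b = 1%N by rewrite /b -nth0 (flag_dim fF).
have bU : (b <= U)%VS by rewrite /b -nth0; have /andP[] := flag_iso fF (ltn0Sn m).
case/eqP: (Fc); apply: (residue_coeff0 (L := L) (b := b) _ _ _ cs.1) => //.
have E b' z : b' \in bs -> z \in eb b' ->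
    residue U L b (ap ((L, b') :: z.2) *~ - z.1) = if b' == b then ap z.2 *~ z.1 else 0.
  move=> bb zb; rewrite raddfMz /= residue_ap ?ebF // eq_sym; case: ifP => _; last by rewrite mul0rz.
  by rewrite mulNrz mulrNz opprK.
rewrite raddfB /= /s sumE raddf_sum /=.
rewrite (eq_big_seq (fun b' => if b' == b then \sum_(z <- eb b') ap z.2 *~ z.1 else 0)); last first.
  move=> b' bb'; rewrite raddf_sum /= (eq_big_seq _ (E b' ^~ bb')).
  by case: eqP => // _; rewrite big1.
have [bb|nb] := boolP (b \in bs).
  rewrite (bigD1_seq b) ?undup_uniq //= eqxx [X in _ - (_ + X)]big1 => [|b' /negPf-> //].
  by rewrite addr0; have [_ ->] := ebP b bb; rewrite subrr.
rewrite big_seq_cond big1 ?subr0 => [|b' /andP[bb' _]]; last first.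
  by case: eqP => // bb; rewrite -bb bb' in nb.
(* For [b] outside [bs] no flag of [c] begins with [b]. *)
apply: (supp_ext (f := residue U L b) (g := \0) (Q := fun G => coeff G c != 0)) => //= G Gc.
rewrite residueE; case: G Gc => //= x G Gc; case: eqP => // xb; case/negP: nb.
rewrite mem_undup; apply/mapP; exists (x :: G) => //=.
by rewrite mem_filter /= mem_dom Gc xb nF.
Qed.

End Residues.

(** * Alternating functions and sharblies *)

Section FgextPointwise.
Variables (T : choiceType) (B : zmodType).
Implicit Types f g : T -> B.

Lemma eq_fgext f g : f =1 g -> fgext f =1 fgext g.
Proof. by move=> fg c; rewrite !fgextEsum; apply: eq_bigr => t _; rewrite fg. Qed.

Lemma fgext_mulz f z c : fgext (fun t => f t *~ z) c = fgext f c *~ z.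
Proof. by rewrite !fgextEsum mulrz_suml; apply: eq_bigr => t _; rewrite mulrzAC. Qed.

Lemma fgext_add f g c : fgext (fun t => f t + g t) c = fgext f c + fgext g c.
Proof. by rewrite !fgextEsum -big_split; apply: eq_bigr => t _; rewrite mulrzDl. Qed.
End FgextPointwise.

Section SharblyLift.
Variables (K : fieldType) (V : vectType K) (m : nat).
Local Notation VS := {vspace V}.
Variable P : ('I_m -> nat) -> ('I_m -> VS) -> Prop.
Variables (B : zmodType) (phi : ('I_m -> nat) -> ('I_m -> VS) -> ('I_m -> seq VS) -> B).

Definition upd (s : 'I_m -> seq VS) i t : 'I_m -> seq VS := [eta s with i |-> t].

Definition alternating := forall k W s i t N (sigma : 'S_N), P k W ->
  (forall j, is_frame (k j) (W j) (s j)) -> is_frame (k i) (W i) t -> size (s i) = N ->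
  t = [seq nth 0%VS (s i) (sigma x) | x <- enum 'I_N] ->
  phi k W s = phi k W (upd s i t) *~ (-1) ^+ sigma.

Hypothesis phiA : alternating.

Section Summand.
Variables (k : 'I_m -> nat) (W : 'I_m -> VS).
Hypothesis PkW : P k W.
Implicit Types (r : seq 'I_m) (a : forall i, Sh (k i) (W i)) (s : 'I_m -> seq VS).

(** Multilinear extension one slot at a time: [r] lists the slots still to be expanded, and [s]
    records the frames already chosen in the others. The order of the slots is fixed, so additivity
    in each of them has to be proved. *)
Fixpoint mext r a s : B :=
  if r is i :: r' then
    plift (fun t : frame (k i) (W i) => mext r' a (upd s i (val t))) (a i)
  else phi k W s.

Let frames_off r s := forall j, j \notin r -> is_frame (k j) (W j) (s j).

Lemma updC s i j (t u : seq VS) : i != j ->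
  upd (upd s i t) j u = upd (upd s j u) i t.
Proof.
move=> ij; apply: functional_extensionality_dep => x; rewrite /upd /=.
by case: (x =P j) => // ->; rewrite eq_sym (negPf ij).
Qed.

Lemma updU s i (t u : seq VS) :
  upd (upd s i t) i u = upd s i u.
Proof. by apply: functional_extensionality_dep => x; rewrite /upd /=; case: eqP. Qed.

Lemma frames_off_upd i r s (t : frame (k i) (W i)) :
  frames_off (i :: r) s -> frames_off r (upd s i (val t)).
Proof.
move=> sr j jr; rewrite /upd /=; case: (j =P i) => [->|/eqP ji]; first exact: valP t.
by apply: sr; rewrite in_cons negb_or ji.
Qed.

Lemma mext_alt r a s i t N (sigma : 'S_N) : i \notin r -> frames_off r s ->
  is_frame (k i) (W i) t -> size (s i) = N ->
  t = [seq nth 0%VS (s i) (sigma x) | x <- enum 'I_N] ->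
  mext r a s = mext r a (upd s i t) *~ (-1) ^+ sigma.
Proof.
elim: r s => [|j r IHr] s ir sr tf sN Et /=.
  by apply: phiA => // j; apply: sr.
have [ij ir'] : i != j /\ i \notin r by move: ir; rewrite in_cons negb_or => /andP.
rewrite /plift -fgext_mulz; apply: eq_fgext => u.
rewrite (updC _ _ _ ij); apply: IHr; rewrite /upd //= ?(negPf ij) //.
exact: frames_off_upd.
Qed.

Lemma mext_kills r a i s x : i \notin r -> frames_off (i :: r) s -> sh_rel x ->
  fgext (fun t : frame (k i) (W i) => mext r a (upd s i (val t))) x = 0.
Proof.
move=> ir sr [t u N sigma sN Et].
rewrite raddfB /= !fgextU mulr1z.
rewrite (mext_alt (i := i) (t := val u) (sigma := sigma) a ir) ?updU ?subrr //=.
- exact: frames_off_upd.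
- exact: valP u.
- by rewrite /upd /= eqxx.
- by rewrite /upd /= eqxx.
Qed.

Lemma eq_mext r a b s : {in r, forall i, a i = b i} -> mext r a s = mext r b s.
Proof.
elim: r s => //= i r IHr s ab; rewrite ab ?mem_head // /plift; apply: eq_fgext => t.
by apply: IHr => j jr; apply: ab; rewrite in_cons jr orbT.
Qed.

Lemma mext_add r a i (x y : Sh (k i) (W i)) s : uniq r -> i \in r -> frames_off r s ->
  mext r (dfwith a (x + y)) s = mext r (dfwith a x) s + mext r (dfwith a y) s.
Proof.
elim: r s => //= j r IHr s /andP[jr ur]; rewrite in_cons => ijr sr.
have [ij|ij] := eqVneq i j; last first.
  rewrite (negPf ij) /= in ijr; rewrite !dfwith_out // /plift -fgext_add.
  by apply: eq_fgext => t; apply: IHr => //; apply: frames_off_upd.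
case: j / ij in jr sr {ijr} *; rewrite !dfwith_in.
have E (z : Sh (k i) (W i)) : (fun t : frame (k i) (W i) => mext r (dfwith a z) (upd s i (val t))) =1
    (fun t : frame (k i) (W i) => mext r a (upd s i (val t))).
  move=> t; apply: eq_mext => j' j'r; rewrite dfwith_out //.
  by apply: contraNneq jr => ->.
rewrite /plift !(eq_fgext (E _)) -!/(plift _ _).
by rewrite (zmD (pliftB _)) // => z; apply: mext_kills.
Qed.

Lemma mext_shgen r s u : uniq r -> (forall i, is_frame (k i) (W i) (u i)) -> frames_off r s ->
  mext r (fun i => shgen (k i) (W i) (u i)) s =
  phi k W (fun i => if i \in r then u i else s i).
Proof.
move=> + uf; elim: r s => [|i r IHr] s //= /andP[ir ur] sr.
rewrite {2}/shgen insubT //= plift_gen; last by move=> z; apply: mext_kills.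
rewrite IHr //; last exact: frames_off_upd.
congr phi; apply: functional_extensionality_dep => j; rewrite /upd /= in_cons.
by case: (j =P i) => [->|] //=; rewrite if_same.
Qed.

(** The initial empty lists are overwritten in every slot before [phi] is evaluated. *)
Definition tlift : shtens k W -> B := plift (fun a => mext (enum 'I_m) a (fun=> [::])).

Let frames_off_enum s : frames_off (enum 'I_m) s.
Proof. by move=> j; rewrite mem_enum. Qed.

Lemma tlift_kills x : tensor_rel x ->
  fgext (fun a : forall i, Sh (k i) (W i) => mext (enum 'I_m) a (fun=> [::])) x = 0.
Proof.
case=> i a y z; rewrite !raddfB /= !fgextE mext_add ?enum_uniq ?mem_enum //.
by rewrite -addrA -opprD subrr.
Qed.

Lemma tliftB : zmod_morphism tlift.
Proof. exact/pliftB/tlift_kills. Qed.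

Lemma tlift_tmul u : (forall i, is_frame (k i) (W i) (u i)) ->
  tlift (tmul (fun i => shgen (k i) (W i) (u i))) = phi k W u.
Proof.
move=> uf; rewrite /tlift /tmul plift_gen; last exact: tlift_kills.
rewrite mext_shgen ?enum_uniq //; congr phi.
by apply: functional_extensionality_dep => i; rewrite mem_enum.
Qed.
End Summand.

(** The universal property of [shsum]: an alternating family of values on tuples of frames induces
    an additive map. The augmentation, [d11], [d12] and the lifts used for projectivity all arise in
    this way. *)
Definition shlift : shsum P -> B :=
  plift (fun x : {b : block P & shtens (val b).1 (val b).2} => tlift (tagged x)).

Lemma shlift_kills x : dsum_rel x ->
  fgext (fun x : {b : block P & shtens (val b).1 (val b).2} => tlift (tagged x)) x = 0.
Proof.
case=> b y z; rewrite !raddfB /= !fgextE /=.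
by rewrite (zmD (tliftB (asboolW (valP b)))) -addrA -opprD subrr.
Qed.

Lemma shliftB : zmod_morphism shlift.
Proof. exact/pliftB/shlift_kills. Qed.

Lemma shlift_shelt k W s : P k W -> (forall i, is_frame (k i) (W i) (s i)) ->
  shlift (shelt P k W s) = phi k W s.
Proof.
move=> kW sf; rewrite (sheltE s (asboolT kW)) /shlift /din plift_gen /=; last exact: shlift_kills.
exact: tlift_tmul.
Qed.

End SharblyLift.

(** * Alternation under permutations of a sequence *)

Section PermutedSequences.
Variables (T : eqType) (x0 : T) (B : zmodType) (f : seq T -> B).

Definition permuted N s (sigma : 'S_N) := [seq nth x0 s (sigma x) | x <- enum 'I_N].

Lemma size_permuted N s (sigma : 'S_N) : size (permuted s sigma) = N.
Proof. by rewrite size_map size_enum_ord. Qed.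

Lemma nth_permuted N s (sigma : 'S_N) (i : 'I_N) : nth x0 (permuted s sigma) i = nth x0 s (sigma i).
Proof. by rewrite (nth_map i) ?size_enum_ord // nth_ord_enum. Qed.

Lemma permuted1 N s : size s = N -> permuted s (1%g : 'S_N) = s.
Proof.
move=> sN; apply: (eq_from_nth (x0 := x0)); rewrite size_permuted // => i iN.
by rewrite (nth_permuted s 1%g (Ordinal iN)) perm1.
Qed.

Lemma permutedM N s (sigma tau : 'S_N) : permuted s (tau * sigma)%g = permuted (permuted s sigma) tau.
Proof. by apply: eq_map => i; rewrite permM nth_permuted. Qed.

Lemma perm_permuted N s (sigma : 'S_N) : size s = N -> perm_eq (permuted s sigma) s.
Proof.
move=> sN; have -> : permuted s sigma = [seq nth x0 s i | i <- [seq val (sigma i) | i <- enum 'I_N]].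
  by rewrite -map_comp.
rewrite -[X in perm_eq _ X](mkseq_nth x0) sN; apply: perm_map.
rewrite -val_enum_ord map_comp; apply: perm_map; apply: uniq_perm; rewrite ?enum_uniq //.
  by rewrite map_inj_uniq ?enum_uniq //; apply: perm_inj.
by move=> i; rewrite mem_enum; apply/mapP; exists (sigma^-1 i)%g; rewrite ?mem_enum ?permKV.
Qed.

Variable C : seq T -> bool.
Hypothesis C_perm : forall s t, perm_eq s t -> C s = C t.

(** The transpositions of 0 with another index generate the symmetric group, so the sign rule for
    these suffices. Invariance of [C] keeps the intermediate sequences admissible. *)
Lemma alternating_star N : (forall s (i : 'I_N.+1), size s = N.+1 -> C s -> i != ord0 ->
    f (permuted s (tperm ord0 i)) = - f s) ->
  forall s (sigma : 'S_N.+1), size s = N.+1 -> C s -> f s = f (permuted s sigma) *~ (-1) ^+ sigma.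
Proof.
move=> fC s sigma sN Cs.
suff : f (permuted s sigma) = f s *~ (-1) ^+ sigma.
  by move=> ->; rewrite -mulrzA -expr2 sqrr_sign mulr1z.
have /gen_prodgP [k [t tP ->]] : sigma \in generated [set tperm ord0 y | y in 'I_N.+1] by rewrite gen_tperm inE.
elim: k t tP => [|k IHk] t tP.
  by rewrite big_ord0 permuted1 // odd_perm1 expr0 mulr1z.
rewrite big_ord_recl permutedM odd_permM; set r := (\prod_(i < k) _)%g.
have r1 : size (permuted s r) = N.+1 by rewrite size_permuted.
have Cr : C (permuted s r) by rewrite (C_perm (perm_permuted r sN)).
have /imsetP [i _ ->] := tP ord0; rewrite odd_tperm signr_addb mulrC mulrzA -IHk; last by move=> j; apply: tP.
have [->|i0] := eqVneq ord0 i; first by rewrite tperm1 permuted1 // expr0 mulr1z.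
by rewrite fC 1?eq_sym // expr1 mulrN1z.
Qed.

Lemma alternating2 : (forall a b, C [:: a; b] -> f [:: b; a] = - f [:: a; b]) ->
  forall s (sigma : 'S_2), size s = 2%N -> C s -> f s = f (permuted s sigma) *~ (-1) ^+ sigma.
Proof.
move=> H; apply: alternating_star => s i; case: s => [|a [|b []]] //= _ Cs i0.
have -> : permuted [:: a; b] (tperm ord0 i) = [:: b; a]; last exact: H.
rewrite /permuted !enum_ordSl (enum_ord0 : enum 'I_0 = [::]) /=.
by case: i i0 => [[|[|]]] //= ? _; rewrite !permE /=.
Qed.

Lemma alternating3 :
  (forall a b c, C [:: a; b; c] -> f [:: b; a; c] = - f [:: a; b; c] /\ f [:: c; b; a] = - f [:: a; b; c]) ->
  forall s (sigma : 'S_3), size s = 3%N -> C s -> f s = f (permuted s sigma) *~ (-1) ^+ sigma.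
Proof.
move=> H; apply: alternating_star => s i; case: s => [|a [|b [|c []]]] //= _ Cs i0.
have [H1 H2] := H _ _ _ Cs.
have := H1; have := H2; rewrite /permuted !enum_ordSl (enum_ord0 : enum 'I_0 = [::]) /=.
by case: i i0 => [[|[|[|]]]] //= ? _; rewrite !permE /=.
Qed.

Lemma alternating4 : (forall a b c d, C [:: a; b; c; d] ->
    [/\ f [:: b; a; c; d] = - f [:: a; b; c; d], f [:: c; b; a; d] = - f [:: a; b; c; d]
      & f [:: d; b; c; a] = - f [:: a; b; c; d]]) ->
  forall s (sigma : 'S_4), size s = 4%N -> C s -> f s = f (permuted s sigma) *~ (-1) ^+ sigma.
Proof.
move=> H; apply: alternating_star => s i; case: s => [|a [|b [|c [|d []]]]] //= _ Cs i0.
have [H1 H2 H3] := H _ _ _ _ Cs.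
have := H1; have := H2; have := H3; rewrite /permuted !enum_ordSl (enum_ord0 : enum 'I_0 = [::]) /=.
by case: i i0 => [[|[|[|[|]]]]] //= ? _; rewrite !permE /=.
Qed.
End PermutedSequences.

Lemma is_frame_perm (K : fieldType) (V : vectType K) k (W : {vspace V}) s t :
  perm_eq s t -> is_frame k W s = is_frame k W t.
Proof.
by move=> st; rewrite /is_frame (perm_size st) (perm_uniq st) (perm_all _ st) (perm_big _ st).
Qed.

(** * Decompositions with frames versus lists of pairs of lines *)

Section Families.
Variables (K : fieldType) (V : vectType K) (om : {skew_symmetric V}).
Hypothesis om_alt : forall x, om x x = 0.
Local Notation VS := {vspace V}.
Local Notation T := (VS * VS)%type.
Local Notation perp := (perp om).
Local Notation good := (good om).
Local Notation sframe := (sframe om).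
Local Notation symplectic := (symplectic om).

Lemma orthogonal_frameE s : orthogonal_frame om s =
  all good s && pairwise (fun p q => perp (pl p) (pl q)) s.
Proof.
elim: s => //= p s ->; suff -> : perp (pl p) (plsum s) = all (fun q => perp (pl p) (pl q)) s.
  by andb_ac.
elim: s => [|q s IHs] /=; first by rewrite plsum_nil perp0r.
by rewrite plsum_cons perpDr IHs.
Qed.

Lemma perp_sum (I : Type) (r : seq I) (Q : pred I) (F : I -> VS) X :
  (forall i, Q i -> perp X (F i)) -> perp X (\sum_(i <- r | Q i) F i)%VS.
Proof.
move=> XF; apply: (big_ind (fun Y => perp X Y)) => //; first exact: perp0r.
by move=> Y Z XY XZ; rewrite perpDr XY.
Qed.

(** Directness comes for free: a nondegenerate summand meets the sum of the others, which is
    orthogonal to it, in 0. *)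
Lemma perp_decomp_intro m (g : 'I_m -> nat) (W : 'I_m -> VS) :
  (forall i, symplectic (g i) (W i)) -> (forall i j, i != j -> perp (W i) (W j)) ->
  (\sum_i W i)%VS = fullv -> perp_decomp om g W.
Proof.
move=> sW pW W1; split=> //; apply/directv_sumP => i _.
have /andP[nd _] := sW i; apply: nondeg_disjoint nd _.
by apply: perp_sum => j ji; apply: pW; rewrite eq_sym.
Qed.

Lemma frame0P W s : \dim W = 2%N -> is_frame 0 W s ->
  exists a b : VS, [/\ s = [:: a; b], \dim a = 1%N, \dim b = 1%N, a != b & W = (a + b)%VS].
Proof.
move=> dW /and4P[]; rewrite dW; case: s => [|a [|b []]] //= _.
rewrite inE andbT => ab /and3P[/eqP da /eqP db _]; rewrite !big_cons big_nil addv0 => /eqP<-.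
by exists a, b.
Qed.

Lemma frame0I (a b : VS) : \dim a = 1%N -> \dim b = 1%N -> a != b -> \dim (a + b)%VS = 2%N ->
  is_frame 0 (a + b)%VS [:: a; b].
Proof.
by move=> da db ab d; rewrite /is_frame d /= inE ab da db !big_cons big_nil addv0 !eqxx.
Qed.

Section Tolist.
Variable m : nat.
Implicit Types (s : 'I_m -> seq VS) (W : 'I_m -> VS) (t : seq T).

(** Sharblies are indexed by slots, symbols by lists of pairs. [tolist] passes from the former to
    the latter, with inverse [pair_lines] and [pair_span] when every slot carries two lines. *)
Definition tolist s : seq T := [seq (nth 0%VS (s i) 0, nth 0%VS (s i) 1) | i <- enum 'I_m].
Definition pair_lines t (i : 'I_m) : seq VS :=
  let p := nth (0%VS, 0%VS) t i in [:: p.1; p.2].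
Definition pair_span t (i : 'I_m) : VS := pl (nth (0%VS, 0%VS) t i).

Lemma size_tolist s : size (tolist s) = m.
Proof. by rewrite size_map size_enum_ord. Qed.

Lemma nth_tolist s (i : 'I_m) :
  nth (0%VS, 0%VS) (tolist s) i = (nth 0%VS (s i) 0, nth 0%VS (s i) 1).
Proof. by rewrite (nth_map i) ?size_enum_ord // nth_ord_enum. Qed.

Lemma tolistK t : size t = m -> tolist (pair_lines t) = t.
Proof.
move=> tm; apply: (eq_from_nth (x0 := (0%VS, 0%VS))); rewrite size_tolist // => i im.
by rewrite (nth_tolist (pair_lines t) (Ordinal im)) /=; case: (nth _ t i).
Qed.

Section Decomposition.
Variables (W : 'I_m -> VS) (s : 'I_m -> seq VS).
Hypotheses (Wd : perp_decomp om (fun=> 1%N) W) (sW : forall i, is_frame 0 (W i) (s i)).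

Let dW i : \dim (W i) = 2%N.
Proof. by case: Wd => /(_ i) /andP[_ /eqP]. Qed.

Lemma tolist_lines : pair_lines (tolist s) = s.
Proof.
apply: functional_extensionality_dep => i; rewrite /pair_lines nth_tolist /=.
by have [a [b [-> _ _ _ _]]] := frame0P (dW i) (sW i).
Qed.

Lemma tolist_span : pair_span (tolist s) = W.
Proof.
apply: functional_extensionality_dep => i; rewrite /pair_span nth_tolist /=.
by have [a [b [-> _ _ _ ->]]] := frame0P (dW i) (sW i).
Qed.

Lemma plsum_nth t : size t = m -> plsum t = (\sum_i pair_span t i)%VS.
Proof. by move=> tm; rewrite /plsum (big_nth (0%VS, 0%VS)) tm big_mkord. Qed.

Lemma tolist_sframe : sframe fullv (tolist s).
Proof.
case: Wd => symW pW _ W1; rewrite sframeE plsum_nth ?size_tolist // tolist_span W1 eqxx andbT.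
rewrite orthogonal_frameE; apply/andP; split.
  apply/(all_nthP (0%VS, 0%VS)) => i; rewrite size_tolist => im.
  rewrite (nth_tolist s (Ordinal im)); have /andP[nd _] := symW (Ordinal im).
  have [a [b [-> da db ab E]]] := frame0P (dW (Ordinal im)) (sW (Ordinal im)).
  by rewrite (good_lines om_alt nd (dW _)) // E ?addvSl ?addvSr.
apply/(pairwiseP (0%VS, 0%VS)) => i j; rewrite !inE size_tolist => im jm ij.
have := pW (Ordinal im) (Ordinal jm); rewrite -tolist_span; apply.
by rewrite -val_eqE /= ltn_eqF.
Qed.
End Decomposition.

Lemma pair_decomp t : size t = m -> sframe fullv t ->
  perp_decomp om (fun=> 1%N) (pair_span t) /\
  (forall i, is_frame 0 (pair_span t i) (pair_lines t i)).
Proof.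
move=> tm /andP[]; rewrite orthogonal_frameE => /andP[/all_nthP gt /(pairwiseP (0%VS, 0%VS)) pt] /eqP t1.
have g (i : 'I_m) : good (nth (0%VS, 0%VS) t i) by apply: gt; rewrite tm.
split; last first.
  move=> i; have /and3P[/eqP d1 /eqP d2 np] := g i; rewrite /pair_span /pair_lines; apply: frame0I => //.
    by apply: contraNneq np => ->; apply: isotropic_line.
  exact: (dim_pl om_alt (g i)).
apply: perp_decomp_intro => [i|i j ij|]; last by rewrite -plsum_nth.
  by rewrite /symplectic (dim_pl om_alt (g i)) eqxx andbT; exact: (nondeg_pl om_alt (g i)).
have [ltij|ltji|E] := ltngtP i j; last by rewrite (val_inj E) eqxx in ij.
  by apply: pt; rewrite // inE tm.
by rewrite perpC; apply: pt; rewrite // inE tm.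
Qed.

End Tolist.
End Families.

(** * The augmentation *)

Section Chains.
Variables (K : fieldType) (V : vectType K) (om : {skew_symmetric V}) (n : nat).
Hypothesis om_alt : forall x, om x x = 0.
Hypothesis om_nd : nondeg om fullv.
Hypothesis dimV : \dim {: V} = n.*2.
Local Notation VS := {vspace V}.
Local Notation T := (VS * VS)%type.
Local Notation D := {freeg (seq VS) / int}.
Local Notation fflag := (flag_from om 0 fullv n).
Implicit Types (F : seq VS) (c : D).

Let ltv (U W : VS) := (U <= W)%VS && (U != W).

Let ltv_trans : transitive ltv.
Proof.
move=> U W X /andP[WU nWU] /andP[UX nUX]; rewrite /ltv (subv_trans WU UX) /=.
apply: contra nWU => /eqP E; rewrite eqEsubv WU E.
by rewrite -E in UX *; rewrite UX.
Qed.

Let ltv_dim U W : ltv U W -> (\dim U < \dim W)%N.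
Proof.
by case/andP=> UW nUW; rewrite ltn_neqAle (dimvS UW) andbT; apply: contra nUW; rewrite (dimv_leqif_eq UW).
Qed.

Let path_dim X F : path ltv X F -> all (fun U => \dim U <= n)%N (X :: F) -> (\dim X + size F <= n)%N.
Proof.
elim: F X => [|Y F IHF] X /=; first by rewrite addn0 => _ /andP[].
case/andP=> /ltv_dim XY pF /andP[_ aF]; apply: leq_trans (IHF Y pF aF).
by rewrite addnS -addSn leq_add2r.
Qed.

Let path_cover X F : path ltv X F -> all (fun U => \dim U <= n)%N F -> (\dim X + size F = n)%N ->
  path (cover (V:=V)) X F.
Proof.
elim: F X => //= Y F IHF X /andP[XY pF] aYF E.
have := path_dim pF aYF; rewrite -E addnS -addSn leq_add2r => YX.
have dY : \dim Y = (\dim X).+1 by apply/eqP; rewrite eqn_leq YX ltv_dim.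
rewrite /cover dY eqxx andbT IHF //; first by rewrite andbT; case/andP: XY.
  by case/andP: aYF.
by rewrite dY -E addnS addSn.
Qed.

(** A chain of [n] strictly increasing nonzero isotropic subspaces, all of dimension at most [n],
    has the dimensions 1, ..., n. *)
Lemma flagE F : flag om n F = fflag F.
Proof.
rewrite /flag /flag_from; case: eqP => //= sF; apply/andP/andP => -[pF aF].
  have p0 : path ltv 0%VS F.
    case: F {sF} pF aF => //= X F -> /andP[/andP[X0 _] _].
    by rewrite /ltv sub0v eq_sym X0.
  split; last by apply: sub_all aF => X /andP[_ ->]; rewrite subvf.
  apply: path_cover; rewrite ?dimv0 ?add0n //.
  apply: sub_all aF => X /andP[_ iX]; exact: isotropic_dim om_nd dimV (subvf X) iX.
have p0 : path ltv 0%VS F.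
  apply: sub_path pF => X Y /andP[XY dXY]; rewrite /ltv XY.
  by apply: contraTneq dXY => ->; rewrite neq_ltn ltnSn.
split; first exact: path_sorted p0.
apply/allP => X XF; have /andP[-> _] := allP aF X XF; rewrite andbT.
by have /andP[_] := allP (order_path_min ltv_trans p0) X XF; rewrite eq_sym.
Qed.

HB.instance Definition _ p := GRing.isZmodMorphism.Build _ _ (@bdry _ _ om p) (@bdryB _ _ om p).
HB.instance Definition _ f p :=
  GRing.isZmodMorphism.Build _ _ (@chain_map _ _ om f p) (@chain_mapB _ _ om f p).

Definition to_chain : D -> chain om n := fgext (flgen om n).
HB.instance Definition _ := GRing.Additive.on to_chain.

Definition of_chain p : chain om p -> D := fgext (fun t : {s | flag om p s} => [fg val t]).
HB.instance Definition _ p := GRing.Additive.on (@of_chain p).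

Lemma of_chain_flgen p F : flag om p F -> of_chain (flgen om p F) = [fg F].
Proof. by move=> fF; rewrite /flgen insubT /of_chain /= fgextE. Qed.

Lemma to_chainK c : supp fflag c -> of_chain (to_chain c) = c.
Proof.
move=> cF; apply: (supp_ext (f := @of_chain n \o to_chain) (g := idfun) cF) => F.
by rewrite -flagE => fF /=; rewrite /to_chain fgextE of_chain_flgen.
Qed.

Lemma of_chainK (x : chain om n) : to_chain (of_chain x) = x.
Proof.
apply: (fg_ext (f := to_chain \o @of_chain n) (g := idfun)) => t /=.
by rewrite /of_chain fgextE /to_chain fgextE -fgen_flgen.
Qed.

Lemma of_chain_supp (x : chain om n) : supp fflag (of_chain x).
Proof.
apply: (supp_fgext (Q := xpredT)) => // t _; apply: suppU; rewrite -flagE; exact: valP t.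
Qed.

Lemma flag_del p F i : flag om p F -> (i < p)%N -> flag om p.-1 (take i F ++ drop i.+1 F).
Proof.
case/and3P=> /eqP sF pF aF ip.
have E : drop i F = nth 0%VS F i :: drop i.+1 F by apply: drop_nth; rewrite sF.
have sub : subseq (take i F ++ drop i.+1 F) F.
  by rewrite -{3}(cat_take_drop i F) E; apply: cat_subseq (subseq_refl _) (subseq_cons _ _).
rewrite /flag (subseq_sorted ltv_trans sub pF) /=; apply/andP; split; last first.
  by apply/allP => X /(mem_subseq sub)/(allP aF).
have := congr1 size (cat_take_drop i F); rewrite size_cat E /= addnS => H.
by rewrite size_cat -sF -H.
Qed.

Lemma of_chain_bdry p (x : chain om p) : bdD (of_chain x) = of_chain (bdry x).
Proof.
apply: (fg_ext (f := bdD \o @of_chain p) (g := @of_chain p.-1 \o @bdry _ _ om p)) => t /=.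
rewrite /of_chain fgextE bdDE fgen_flgen bdry_flgen ?(valP t) // bd_sum.
have /and3P[/eqP -> _ _] := valP t; rewrite raddf_sum; apply: eq_bigr => i _.
rewrite raddfMz /=; congr (_ *~ _); rewrite -/(of_chain _) of_chain_flgen //.
exact: flag_del (valP t) (ltn_ord i).
Qed.

Lemma bdry_to_chain c : supp fflag c -> bdD c = 0 -> bdry (to_chain c) = 0.
Proof.
move=> cF bc; have E : of_chain (bdry (to_chain c)) = 0 by rewrite -of_chain_bdry to_chainK.
have inj p (x : chain om p) : of_chain x = 0 -> x = 0; last exact: inj E.
move=> x0; apply/eqP/freeg_eqP => t; rewrite coeff0.
transitivity (coeff (val t) (of_chain x)); last by rewrite x0 coeff0.
apply: (fg_ext (f := coeff t) (g := coeff (val t) \o @of_chain p)) => u /=.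
by rewrite /of_chain fgextE !coeffU -val_eqE.
Qed.

(** No flag has n + 1 nonzero isotropic members, so there are no boundaries in the top degree and a
    homology class is a cycle. *)
Lemma boundary0 (x : cycle om n) : zpi (@boundary _ _ om n) x = 0 -> x = 0.
Proof.
rewrite -(zm0 (@zpiB _ (@boundary _ _ om n))) => /zpi_eq; rewrite subr0.
apply: (zspan_kills (f := idfun)) => // {}x [y xy]; apply/val_inj; rewrite xy /=.
suff -> : y = 0 by rewrite (zm0 (@bdryB _ _ om n.+1)).
elim/fg_ind: y {x xy} => // [x y -> ->|t]; first by rewrite subrr.
have /and3P[/eqP st pt at'] := valP t; have st0 : (0 < size (val t))%N by rewrite st.
have pt0 : path ltv 0%VS (val t).
  case: (val t) pt at' => //= X F -> /andP[/andP[X0 _] _].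
  by rewrite /ltv sub0v eq_sym X0.
have := path_dim pt0; rewrite dimv0 st add0n ltnn => H; suff : false by [].
apply: H; rewrite /= dimv0 /=.
apply: sub_all at' => X /andP[_ iX]; exact: isotropic_dim om_nd dimV (subvf X) iX.
Qed.

Lemma chain_map_to_chain (f : 'End(V)) c : lker f == 0%VS ->
  (forall u v, om (f u) (f v) = om u v) ->
  chain_map f (to_chain c) = to_chain (mapD (fun X => f @: X)%VS c).
Proof.
move=> f0 fom; apply: (fg_ext (f := @chain_map _ _ om f n \o to_chain)
  (g := to_chain \o mapD (fun X => f @: X)%VS)) => F /=.
by rewrite mapDE /to_chain !fgextE chain_map_flgen.
Qed.

Lemma mapD_ap (f : 'End(V)) (s : seq T) :
  mapD (fun X => f @: X)%VS (ap s) = ap [seq (f @: p.1, f @: p.2)%VS | p <- s].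
Proof.
elim: s => [|p s IHs]; first by rewrite /ap /= mapDE.
have E a c : mapD (fun X => f @: X)%VS (insD 0 a c) = insD 0 (f @: a) (mapD (fun X => f @: X)%VS c).
  by apply: mapD_insD; rewrite ?limg0 // => Z; rewrite limgD.
by rewrite map_cons !ap_cons !apDE raddfB /= !E IHs.
Qed.
End Chains.

Section StandardFormFacts.
Variables (K : fieldType) (n : nat).
Local Notation V := 'cV[K]_(n + n).
Local Notation om := (@st_form K n : {skew_symmetric V}).

Lemma st_form_alt (u : V) : om u u = 0.
Proof.
rewrite -[u]vsubmxK /= /st_form tr_col_mx /stJ mul_row_block mul_row_col.
rewrite !mulmx0 !mulmx1 mulmxN mulmx1 add0r addr0 mulNmx mxE.
suff -> : ((usubmx u)^T *m dsubmx u) 0 0 = ((dsubmx u)^T *m usubmx u) 0 0 by rewrite mxE addNr.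
by rewrite -[in LHS](trmxK ((usubmx u)^T *m dsubmx u)) mxE trmx_mul trmxK.
Qed.

Lemma st_form_nondeg : nondeg om fullv.
Proof.
apply/nondegP => u _ uo.
have uJ : u^T *m stJ K n = 0.
  apply/rowP => j; have := uo (delta_mx j 0) (memvf _).
  by rewrite /= /st_form -colE mxE => ->; rewrite mxE.
have := congr1 (fun A => A *m stJ K n) uJ; rewrite -mulmxA stJ_sqr mul0mx mulmxN mulmx1.
by move/eqP; rewrite oppr_eq0 => /eqP/(congr1 trmx); rewrite trmxK trmx0.
Qed.

Lemma st_form_dim : \dim {: V} = n.*2.
Proof. by rewrite dimvf /dim /= muln1 addnn. Qed.
End StandardFormFacts.

Section TolistUpdate.
Variables (K : fieldType) (V : vectType K) (m : nat).
Local Notation VS := {vspace V}.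

Definition line_pair (t : seq VS) := (nth 0%VS t 0, nth 0%VS t 1).

Lemma tolist_split (s : 'I_m -> seq VS) i t :
  tolist (upd s i t) = take i (tolist s) ++ line_pair t :: drop i.+1 (tolist s).
Proof.
have im : (i < size (tolist s))%N by rewrite size_tolist.
apply: (eq_from_nth (x0 := (0%VS, 0%VS))).
  by rewrite size_cat /= size_takel ?(ltnW im) // size_drop !size_tolist subnSK ?ltn_ord // subnKC ?(ltnW (ltn_ord i)).
move=> j; rewrite size_tolist => jm; rewrite (nth_tolist _ (Ordinal jm)) nth_cat size_takel ?(ltnW im) //.
rewrite /upd /= -val_eqE /=; case: ltngtP => [ji|ij|E].
- by rewrite nth_take // (nth_tolist _ (Ordinal jm)).
- by rewrite -(subnSK ij) /= nth_drop subnKC // (nth_tolist _ (Ordinal jm)).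
by rewrite E subnn.
Qed.

Lemma upd_id (s : 'I_m -> seq VS) i : upd s i (s i) = s.
Proof. by apply: functional_extensionality_dep => j; rewrite /upd /=; case: eqP => [->|]. Qed.

End TolistUpdate.

Lemma ap_flip (K : fieldType) (V : vectType K) (s1 s2 : seq ({vspace V} * {vspace V})) a b :
  ap (s1 ++ (b, a) :: s2) = - ap (s1 ++ (a, b) :: s2).
Proof. by rewrite !ap_cat !ap_cons -raddfN !apDE opprB. Qed.

Section Augmentation.
Variables (R : comNzRingType) (K : fieldType) (iota : {rmorphism R -> K}) (n : nat).
Local Notation V := 'cV[K]_(n + n).
Local Notation VS := {vspace V}.
Local Notation om := (@st_form K n : {skew_symmetric V}).
Local Notation T := (VS * VS)%type.
Local Notation sframe := (sframe om).

Local Notation idx := (@idx0 K n).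

Let alt := @st_form_alt K n.
Let nd := @st_form_nondeg K n.
Let dm := @st_form_dim K n.

Lemma idx0_frame k W i (s : seq VS) : idx k W -> is_frame (k i) (W i) s ->
  is_frame 0 (W i) s /\ size s = 2%N.
Proof.
case=> k0 [/(_ i)/andP[_ /eqP dW] _ _ _]; rewrite k0 => sf; split=> //.
by case/and4P: sf => /eqP->; rewrite dW.
Qed.

Definition eps_val (k : 'I_n -> nat) (W : 'I_n -> VS) (s : 'I_n -> seq VS) : chain om n :=
  to_chain om n (ap (tolist s)).

Lemma eps_alternating : alternating idx eps_val.
Proof.
move=> k W s i t N sigma kW sf tf sN Et.
have [sf0 s2] := idx0_frame kW (sf i); have N2 : N = 2%N by rewrite -sN.
move: sigma Et; rewrite {}N2 => sigma Et.
pose f t := to_chain om n (ap (take i (tolist s) ++ line_pair t :: drop i.+1 (tolist s))).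
have fH a b : is_frame 0 (W i) [:: a; b] -> f [:: b; a] = - f [:: a; b].
  by rewrite /f ap_flip raddfN.
have := alternating2 0%VS (is_frame_perm 0 (W i)) fH sigma s2 sf0.
by rewrite /eps_val tolist_split Et => <-; rewrite /f -tolist_split upd_id.
Qed.

Definition eps_chain : shsum idx -> chain om n := shlift eps_val.

Lemma eps_chainB : zmod_morphism eps_chain.
Proof. exact: shliftB eps_alternating. Qed.
HB.instance Definition _ := GRing.isZmodMorphism.Build _ _ eps_chain eps_chainB.

Lemma eps_chainE k W s : idx k W -> (forall i, is_frame (k i) (W i) (s i)) ->
  eps_chain (shelt idx k W s) = to_chain om n (ap (tolist s)).
Proof. exact: (shlift_shelt eps_alternating). Qed.

Definition frame_elt (t : seq T) : shsum idx :=
  shelt idx (fun=> 0%N) (pair_span t) (pair_lines t).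

Lemma sframe_size (t : seq T) : sframe fullv t -> size t = n.
Proof. by move=> f; have := sframe_dim alt f; rewrite dm -!muln2 => /eqP; rewrite eqn_mul2r /= => /eqP. Qed.

Lemma frame_eltP (t : seq T) : sframe fullv t ->
  idx (fun=> 0%N) (pair_span (m := n) t) /\ (forall i, is_frame 0 (pair_span t i) (pair_lines (m := n) t i)).
Proof. by move=> f; have [] := pair_decomp alt (sframe_size f) f. Qed.

Lemma eps_frame_elt (t : seq T) : sframe fullv t -> eps_chain (frame_elt t) = to_chain om n (ap t).
Proof.
by move=> f; have [iW fW] := frame_eltP f; rewrite eps_chainE // tolistK // sframe_size.
Qed.

Lemma shelt_frame k W s : idx k W -> (forall i, is_frame (k i) (W i) (s i)) ->
  sframe fullv (tolist s) /\ shelt idx k W s = frame_elt (tolist s).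
Proof.
move=> [k0 Wd] sf.
have -> : k = fun=> 0%N by apply: functional_extensionality_dep.
have sf0 i : is_frame 0 (W i) (s i) by have := sf i; rewrite k0.
by split; [apply: (tolist_sframe alt Wd sf0)|rewrite /frame_elt (tolist_span Wd sf0) (tolist_lines Wd sf0)].
Qed.

Lemma shsum0_list (x : shsum idx) : exists2 e : seq (int * seq T),
  all_frames om fullv e & x = \sum_(z <- e) frame_elt z.2 *~ z.1.
Proof.
elim/shsum_ind: x => [|x y [e fe ->] [f ff ->]|k W s kW sf].
- by exists [::]; rewrite ?big_nil.
- exists (e ++ [seq (- z.1, z.2) | z <- f]).
    by move=> z; rewrite mem_cat => /orP[/fe//|/mapP[z' /ff zf ->]].
  rewrite big_cat big_map -sumrN; congr (_ + _); apply: eq_bigr => z _.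
  by rewrite /= mulrNz.
have [f ->] := shelt_frame kW sf.
by exists [:: (1, tolist s)]; [move=> z; rewrite inE => /eqP->|rewrite big_seq1 mulr1z].
Qed.

Lemma eps_chain_cycle x : eps_chain x \in @bdry_ker _ _ om n.
Proof.
have [e fe ->] := shsum0_list x; apply/eqP; rewrite raddf_sum /= raddf_sum big_seq_cond big1 //.
move=> z /andP[/fe f _]; rewrite !raddfMz /= eps_frame_elt //.
rewrite bdry_to_chain ?mul0rz ?bdD_ap //; last by have := ap_flag alt f; rewrite sframe_size.
Qed.

Definition eps_cycle x : cycle om n := Sub (eps_chain x) (eps_chain_cycle x).

Lemma eps_cycleB : zmod_morphism eps_cycle.
Proof.
move=> x y; apply: val_inj; rewrite [LHS]/= eps_chainB.
by rewrite [RHS](raddfB (val : cycle om n -> chain om n)).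
Qed.

Definition eps_class (x : shsum idx) : rhomology om n := zpi (@boundary _ _ om n) (eps_cycle x).

Lemma eps_classB : zmod_morphism eps_class.
Proof. by move=> x y; rewrite /eps_class eps_cycleB zpiB. Qed.

Definition eps_fun : modV0 iota n -> modSt iota n := eps_class.

Lemma eps_funB : zmod_morphism eps_fun.
Proof. exact: eps_classB. Qed.

Lemma eps_fun0 x : eps_fun x = 0 <-> eps_chain x = 0.
Proof.
split=> [/(boundary0 nd dm)/(congr1 val)|E] //.
by rewrite /eps_fun /eps_class -(zm0 (@zpiB _ (@boundary _ _ om n))); congr zpi; apply: val_inj.
Qed.

Lemma eps_fun_act g x : eps_fun (gact g x) = gact g (eps_fun x).
Proof.
change (zpi (@boundary _ _ om n) (eps_cycle (shact (@idx0G _ _ iota n) g x)) =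
  hact (sp_action iota n) g (zpi (@boundary _ _ om n) (eps_cycle x))).
rewrite hact_pi; congr zpi; apply: val_inj.
rewrite (val_cycle_map (iact_inj (sp_action iota n) g) (iact_om (sp_action iota n) g)) /=.
elim/shsum_ind: x => [|x y Ex Ey|k W s kW sf].
- by rewrite (zm0 (@shactB _ _ _ _ _ _ _ _ g)) raddf0 (zm0 (@chain_mapB _ _ _ _ n)).
- by rewrite shactB !raddfB /= Ex Ey.
rewrite shact_shelt // !eps_chainE //; last first.
- by move=> i; rewrite is_frame_limgs //; apply: iact_inj.
- exact: idx0G.
rewrite (chain_map_to_chain n _ (iact_inj (sp_action iota n) g) (iact_om (sp_action iota n) g)) mapD_ap.
congr (to_chain om n (ap _)); 
rewrite /tolist -[RHS]map_comp.
apply: eq_map => i /=.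
have [_ s2] := idx0_frame kW (sf i); by case: (s i) s2 => [|a [|b []]].
Qed.

Definition eps : ghom (modV0 iota n) (modSt iota n) :=
  GHom (zm_linear eps_funB) eps_fun_act.

Lemma eps_surj z : exists y, eps y = z.
Proof.
rewrite -[z]zreprK; move: (zrepr z) => [c ck].
have bc : bdD (of_chain c) = 0 by rewrite of_chain_bdry (eqP ck) raddf0.
have cc : iscycle om fullv n (of_chain c) by split=> //; apply: of_chain_supp nd dm c.
have [e fe E] := ap_surjective alt nd dm cc.
exists (\sum_(z <- e) frame_elt z.2 *~ z.1 : modV0 iota n).
congr zpi; apply: val_inj => /=; rewrite -[RHS]of_chainK E !raddf_sum.
apply: eq_big_seq => z' /fe f; rewrite !raddfMz /= eps_frame_elt //.
Qed.

(** This passes [ap_injective] from lists of frames to [V_0]. It is meant for the projection of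
    [V_0] onto the cokernel of [d_1]. *)
Lemma eps_kernel (B : zmodType) (h : shsum idx -> B) : zmod_morphism h ->
  symbol om fullv (fun t => h (frame_elt t)) -> forall x, eps x = 0 -> h x = 0.
Proof.
move=> hB hS x /eps_fun0; have [e fe ->] := shsum0_list x => E.
have E' : \sum_(z <- e) ap z.2 *~ z.1 = 0.
  have := apsum_flag alt dm fe; set c := \sum_(z <- e) _ => -[cU _].
  rewrite -(to_chainK nd dm cU) -[RHS](raddf0 (@of_chain _ _ om n)); congr of_chain.
  rewrite -E !raddf_sum; apply: eq_big_seq => z /fe f; by rewrite !raddfMz /= eps_frame_elt.
have := ap_injective alt nd dm hS fe E' => <-.
rewrite (big_morph h (zmD hB) (zm0 hB)); apply: eq_bigr => z _; exact: zmMz.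
Qed.

End Augmentation.

Lemma shelt_alternating (K : fieldType) (V : vectType K) m
    (P : ('I_m -> nat) -> ('I_m -> {vspace V}) -> Prop) : alternating P (shelt P).
Proof.
move=> k W s i t N sigma kW sf tf sN Et.
rewrite !(sheltE _ (asboolT kW)) -(zmMz (@dinB _ _ _)); congr din.
have E u : (fun j => shgen (k j) (W j) (upd s i u j)) =
    dfwith (fun j => shgen (k j) (W j) (s j)) (shgen (k i) (W i) u).
  apply: functional_extensionality_dep => j; rewrite /upd /=.
  by case: dfwithP => [|j' ij']; rewrite ?eqxx // eq_sym (negPf ij').
rewrite -[in LHS](upd_id s i) !E -(zmMz (tmulB _)); congr (tmul (dfwith _ _)).
exact: shgen_perm tf Et.
Qed.

(** The three permutations are the transpositions of 0 asked for by [alternating4]. Each term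
    changes sign when its first two or its last two indices are exchanged, which restores the
    increasing order within both pairs. *)
Lemma six_terms_swap (B : zmodType) (t : nat -> nat -> nat -> nat -> B) (tau : nat -> nat) :
  (forall a b c d, (a < 4)%N -> (b < 4)%N -> (c < 4)%N -> (d < 4)%N -> uniq [:: a; b; c; d] ->
     t b a c d = - t a b c d /\ t a b d c = - t a b c d) ->
  (map tau (iota 0 4) \in [:: [:: 1; 0; 2; 3]; [:: 2; 1; 0; 3]; [:: 3; 1; 2; 0]])%N ->
  six_terms (fun a b c d => t (tau a) (tau b) (tau c) (tau d)) = - six_terms t.
Proof.
move=> H.
have L a b c d : (a < 4)%N -> (b < 4)%N -> (c < 4)%N -> (d < 4)%N -> uniq [:: a; b; c; d] ->
  t b a c d = - t a b c d by move=> *; case: (H a b c d).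
have R a b c d : (a < 4)%N -> (b < 4)%N -> (c < 4)%N -> (d < 4)%N -> uniq [:: a; b; c; d] ->
  t a b d c = - t a b c d by move=> *; case: (H a b c d).
rewrite !inE /six_terms /= => /or3P[] /eqP[-> -> -> ->].
- by rewrite (L 0 1 2 3)%N // (R 2 3 0 1)%N //; abel.
- rewrite (L 1 2 0 3)%N // (L 0 2 1 3)%N // (R 2 3 0 1)%N // (L 0 1 2 3)%N // (R 0 3 1 2)%N //.
  by rewrite (R 1 3 0 2)%N //; abel.
rewrite (L 1 3 2 0)%N // (R 1 3 0 2)%N // (L 2 3 1 0)%N // (R 2 3 0 1)%N // (L 0 3 1 2)%N //.
rewrite (R 1 2 0 3)%N // (L 0 1 3 2)%N // (R 0 1 2 3)%N // (L 0 2 3 1)%N // (R 0 2 1 3)%N //.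
abel.
Qed.

(** * Existence of dual lines, and projections as dual lines *)

Section QuadMore.
Variables (K : fieldType) (V : vectType K) (om : {skew_symmetric V}).
Hypothesis om_alt : forall x, om x x = 0.
Local Notation VS := {vspace V}.
Local Notation perp := (perp om).
Local Notation nondeg := (nondeg om).
Local Notation good := (good om).
Local Notation quad := (quad om).
Implicit Types (W : VS) (v r : nat -> VS).

Lemma quad_perm W v r (tau : nat -> nat) : quad W v r ->
  perm_eq (map tau (iota 0 4)) (iota 0 4) -> quad W (v \o tau) (r \o tau).
Proof.
move=> Q tp; have t4 i : (i < 4)%N -> (tau i < 4)%N.
  move=> i4; have : tau i \in map tau (iota 0 4) by apply: map_f; rewrite mem_iota.
  by rewrite (perm_mem tp) mem_iota.
have tinj i j : (i < 4)%N -> (j < 4)%N -> i != j -> tau i != tau j.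
  move=> i4 j4; apply: contraNneq => E.
  have := perm_uniq tp; rewrite iota_uniq => /(uniqP 0%N)/(_ i j); rewrite !inE size_map size_iota.
  by move=> /(_ i4 j4); rewrite !(nth_map 0%N) ?size_iota // !nth_iota // E => ->.
split=> //=.
- exact: (quad_nondeg Q).
- exact: (quad_dim Q).
- have E (f : nat -> VS) : (f 0%N + f 1%N + f 2 + f 3)%VS = (\sum_(j <- iota 0 4) f j)%VS.
    by rewrite /= !big_cons big_nil addv0 !addvA.
  rewrite (E (v \o tau)) -(quad_sum Q) E -[RHS](perm_big _ tp) big_map; exact: eq_bigr.
- by move=> i i4; rewrite (quad_v Q) ?t4.
- by move=> i i4; rewrite (quad_r Q) ?t4.
- by move=> i i4; rewrite (quad_sub Q) ?t4.
- by move=> i l i4 l4 il; rewrite (quad_perp Q) ?t4 ?tinj.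
Qed.

Lemma quad_exists W (vs : seq VS) : nondeg W -> \dim W = 4%N -> is_frame 0 W vs ->
  exists r, quad W (nth 0%VS vs) r.
Proof.
move=> ndW dW /and4P[/eqP]; rewrite dW addn0 => sv uv lv /eqP EW.
have dv i : (i < 4)%N -> \dim (nth 0%VS vs i) = 1%N.
  by move=> i4; apply/eqP; apply: (allP lv); rewrite mem_nth ?sv.
pose X i := (\sum_(L <- del i vs) L)%VS.
have EX i : (i < 4)%N -> (X i + nth 0%VS vs i)%VS = W.
  move=> i4; rewrite -EW -{2}(cat_take_drop i vs) (drop_nth 0%VS) ?sv // /X !big_cat /= big_cons.
  by rewrite addvA addvAC.
have sd i : (i < 4)%N -> size (del i vs) = 3%N.
  move=> i4; rewrite size_cat size_takel ?size_drop sv ?(ltnW i4) //.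
  by case: i i4 => [|[|[|[|]]]].
have dX i : (i < 4)%N -> \dim (X i) = 3%N.
  move=> i4; apply/eqP; rewrite eqn_leq; apply/andP; split; last first.
    by have := (dimv_add_leqif (X i) (nth 0%VS vs i)).1; rewrite EX // dW dv // addn1.
  rewrite -(sd i i4) /X; have : all (fun L => \dim L == 1%N) (del i vs).
    apply/allP => L; rewrite mem_cat => /orP[/mem_take|/mem_drop]; exact: (allP lv).
  elim: (del i vs) => [|L t IHt] /=; first by rewrite big_nil dimv0.
  case/andP=> /eqP dL /IHt; rewrite big_cons => dt.
  by rewrite (leq_trans (dimv_add_leqif _ _)) // dL add1n.
(* The dual of line [i] is the orthogonal in [W] of the span [X i] of the other three, a line
   because [X i] has dimension 3. *)
exists (fun i => W :&: orthov om (X i))%VS.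
have XW i : (i < 4)%N -> (X i <= W)%VS by move=> i4; rewrite -(EX i i4) addvSl.
split=> //.
- rewrite -EW; case: vs sv {uv lv EW dv X EX sd dX XW} => [|a [|b [|c [|d []]]]] //= _.
  by rewrite !big_cons big_nil addv0 !addvA.
- move=> i i4; have := dim_orthov_nondeg ndW (XW i i4); rewrite dX // dW => /eqP.
  by rewrite -[4%N]/(1 + 3)%N eqn_add2r => /eqP.
- by move=> i _; apply: capvSl.
move=> i l i4 l4 il; rewrite perpC; apply: (perpS (subvv _) _ (perp_cap om W (X l))).
rewrite /X (nth_del 0%VS _ il) ?sv // (big_nth 0%VS) big_mkord.
have ui : (unbump l i < size (del l vs))%N.
  rewrite sd //; by case: l i i4 l4 il => [|[|[|[|]]]] [|[|[|[|]]]].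
exact: (sumv_sup (Ordinal ui)).
Qed.

(** The projected vector differs from a generator of [v c] by an element of [X], and both are
    orthogonal to [r d]. In the nondegenerate plane complementary to [X], the only line orthogonal
    to [r d] is [r d] itself. *)
Lemma quad_proj W v r a b c d : quad W v r -> (a < 4)%N -> (b < 4)%N -> (c < 4)%N -> (d < 4)%N ->
  uniq [:: a; b; c; d] -> ~~ perp (v a) (v b) ->
  let X := (v a + v b)%VS in (daddv_pi (orthov om X :&: W)%VS X @: v c)%VS = r d.
Proof.
move=> Q a4 b4 c4 d4; rewrite /= !inE !negb_or andbT -!andbA => /and5P[ab ac ad bc] /andP[bd cd] vab.
have gX : good (v a, v b) by rewrite goodE /= !(quad_v Q) // vab.
set X := (v a + v b)%VS; have ndX : nondeg X := nondeg_pl om_alt gX.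
have XW : (X <= W)%VS by rewrite subv_add !(quad_vsub Q).
rewrite capvC; set Y := (W :&: _)%VS.
have ndY : nondeg Y := nondeg_cap ndX (quad_nondeg Q) XW.
have dY : \dim Y = 2%N.
  have := dim_orthov_nondeg (quad_nondeg Q) XW.
  by rewrite (dim_pl om_alt gX) (quad_dim Q) => /eqP; rewrite -[4%N]/(2 + 2)%N eqn_add2r => /eqP.
have YX0 : (Y :&: X = 0)%VS.
  by rewrite capvC; apply: nondeg_disjoint ndX _; rewrite perpC perp_cap.
have rY : (r d <= Y)%VS.
  by rewrite subv_cap (quad_sub Q) //= -perpE perpC perpDl !(quad_perp Q).
have rX : perp X (r d) by rewrite perpDl !(quad_perp Q).
have [x x0 vx] : exists2 x, x != 0 & v c = <[x]>%VS by apply/dim1P; rewrite (quad_v Q).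
rewrite vx limg_line; set y := daddv_pi Y X x.
have yY : y \in Y by apply: memv_pi.
have xE : y + daddv_pi X Y x = x.
  apply: daddv_pi_add => //; rewrite addvC nondeg_split // memvE -vx; exact: (quad_vsub Q).
have zX : daddv_pi X Y x \in X by apply: memv_pi.
have y0 : y != 0.
  apply: contraNneq (quad_dual Q c4) => y0; rewrite y0 add0r in xE.
  have : (v c <= X)%VS by rewrite vx -memvE -xE.
  by move=> /perpS/(_ (subvv (r c))); apply; rewrite perpDl !(quad_perp Q) // eq_sym.
have dy : \dim <[y]> = 1%N by rewrite dim_vline y0.
have yr : perp <[y]> (r d).
  have -> : y = x - daddv_pi X Y x by rewrite -{1}xE addrK.
  apply/perpP => _ u /vlineP[k ->] ur; rewrite omZl omDl omNl.
  have /perpP/(_ x u) -> // : perp (v c) (r d) by rewrite (quad_perp Q).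
    by rewrite (perpP _ _ _ rX) // subr0 mulr0.
  by rewrite vx memv_line.
have := good_lines om_alt ndY dY dy (quad_r Q d4); rewrite -memvE yY rY => /(_ isT isT).
by rewrite goodE /= yr andbF andbF => /esym/eqP.
Qed.
End QuadMore.

(** * The differential *)

Lemma upd_eq (K : fieldType) (V : vectType K) m (s : 'I_m -> seq {vspace V}) i t : upd s i t i = t.
Proof. by rewrite /upd /= eqxx. Qed.

Lemma upd_neq (K : fieldType) (V : vectType K) m (s : 'I_m -> seq {vspace V}) i j t :
  j != i -> upd s i t j = s j.
Proof. by rewrite /upd /= => /negPf->. Qed.

Lemma permuted_swap (T : eqType) (x0 a b : T) :
  permuted x0 [:: a; b] (tperm ord0 (Ordinal (isT : (1 < 2)%N))) = [:: b; a].
Proof.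
by rewrite /permuted !enum_ordSl (enum_ord0 : enum 'I_0 = [::]) /= !permE /=.
Qed.

Section FramesInDecompositions.
Variables (K : fieldType) (V : vectType K) (om : {skew_symmetric V}).
Hypothesis om_alt : forall x, om x x = 0.
Local Notation VS := {vspace V}.
Local Notation T := (VS * VS)%type.
Local Notation perp := (perp om).
Local Notation nondeg := (nondeg om).
Local Notation good := (good om).

Lemma frame1P W s : \dim W = 2%N -> is_frame 1 W s ->
  exists a b c : VS, [/\ s = [:: a; b; c], is_frame 0 W [:: a; b], is_frame 0 W [:: a; c]
    & is_frame 0 W [:: b; c]].
Proof.
move=> dW /and4P[]; rewrite dW; case: s => [|a [|b [|c []]]] //= _.
rewrite !inE negb_or andbT -andbA => /and3P[ab ac bc] /and4P[/eqP da /eqP db /eqP dc _].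
rewrite !big_cons big_nil addv0 => /eqP E.
have [aW bW cW] : [/\ a <= W, b <= W & c <= W]%VS.
  rewrite -E addvSl; split=> //; first by rewrite addvC -addvA addvSl.
  by rewrite addvA addvSr.
have F (x y : VS) : \dim x = 1%N -> \dim y = 1%N -> x != y -> (x <= W)%VS -> (y <= W)%VS -> is_frame 0 W [:: x; y].
  move=> dx dy xy xW yW; have Exy := lineD_eq dx dy dW xy xW yW.
  by rewrite -Exy; apply: frame0I => //; rewrite Exy.
by exists a, b, c; rewrite !F.
Qed.

Lemma frame_pair W s : nondeg W -> \dim W = 2%N -> is_frame 0 W s ->
  good (line_pair s) /\ pl (line_pair s) = W.
Proof.
move=> ndW dW sW; have [a [b [-> da db ab E]]] := frame0P dW sW.
have [aW bW] : (a <= W)%VS /\ (b <= W)%VS by rewrite E addvSl addvSr.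
by rewrite /line_pair (good_lines om_alt ndW dW).
Qed.

Section Slot.
Variables (m : nat) (g : 'I_m -> nat) (W : 'I_m -> VS) (s : 'I_m -> seq VS) (i : 'I_m).
Hypotheses (Wd : perp_decomp om g W) (g1 : forall j, j != i -> g j = 1%N).
Hypothesis sW : forall j, j != i -> is_frame 0 (W j) (s j).

Lemma slot_pair j : j != i -> good (line_pair (s j)) /\ pl (line_pair (s j)) = W j.
Proof.
move=> ji; case: Wd => /(_ j) /andP[nd /eqP] + _ _ _; rewrite g1 // => dW.
exact: frame_pair nd dW (sW ji).
Qed.

Lemma slot_ctx : ctx om fullv (take i (tolist s)) (W i) (drop i.+1 (tolist s)).
Proof.
case: Wd => symW pW _ W1; rewrite /ctx.
have -> : take i (tolist s) ++ drop i.+1 (tolist s) = [seq line_pair (s j) | j <- del i (enum 'I_m)].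
  by rewrite /tolist -map_take -map_drop -map_cat.
have im : (i < size (enum 'I_m))%N by rewrite size_enum_ord.
have Er : perm_eq (enum 'I_m) (i :: del i (enum 'I_m)).
  rewrite -{1}(cat_take_drop i (enum 'I_m)) (drop_nth i) // nth_ord_enum.
  by rewrite perm_sym -cat1s perm_catCA.
have /andP[ir ur] : (i \notin del i (enum 'I_m)) && uniq (del i (enum 'I_m)).
  by have := perm_uniq Er; rewrite enum_uniq.
have ri j : j \in del i (enum 'I_m) -> j != i by apply: contraTneq => ->.
have Es : plsum [seq line_pair (s j) | j <- del i (enum 'I_m)] = (\sum_(j <- del i (enum 'I_m)) W j)%VS.
  by rewrite /plsum big_map; apply: eq_big_seq => j /ri ji; case: (slot_pair ji).
rewrite Es; apply/and3P; split.
- rewrite orthogonal_frameE; apply/andP; split.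
    by apply/allP => _ /mapP[j /ri ji ->]; case: (slot_pair ji).
  rewrite pairwise_map; have : all (fun j => j != i) (del i (enum 'I_m)) by apply/allP.
  move: ur; rewrite uniq_pairwise => pr ar.
  apply: (sub_in_pairwise (P := fun j => j != i) _ ar pr) => j k /= ji ki jk.
  by case: (slot_pair ji) => _ ->; case: (slot_pair ki) => _ ->; apply: pW.
- rewrite big_seq_cond; apply: perp_sum => j; rewrite andbT => /ri ji; apply: pW.
  by rewrite eq_sym.
apply/eqP; rewrite -W1 -[RHS]big_enum /= (perm_big _ Er) big_cons //.
Qed.
End Slot.

Lemma decomp_of_seq m (g : 'I_m -> nat) (ws : seq VS) : size ws = m ->
  (forall i : 'I_m, symplectic om (g i) (nth 0%VS ws i)) -> pairwise perp ws ->
  (\sum_(W <- ws) W)%VS = fullv -> perp_decomp om g (fun i => nth 0%VS ws i).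
Proof.
move=> sw symw /(pairwiseP 0%VS) pw w1; apply: perp_decomp_intro => //; last first.
  by rewrite -w1 (big_nth 0%VS) sw big_mkord.
move=> i j ij; have [ltij|ltji|E] := ltngtP i j; last by rewrite (val_inj E) eqxx in ij.
  by apply: pw; rewrite // inE sw.
by rewrite perpC; apply: pw; rewrite // inE sw.
Qed.

Lemma splice_map (A : Type) m n (s : 'I_m -> seq VS) (G : 'I_m -> A) (F : T -> A) (i : 'I_m) p q :
  m.+1 = n -> (forall j, j != i -> F (line_pair (s j)) = G j) ->
  (fun k : 'I_n => F (nth (0%VS, 0%VS) (take i (tolist s) ++ [:: p, q & drop i.+1 (tolist s)]) k)) =
  splice i (F p) (F q) G.
Proof.
move=> mn FG; apply: functional_extensionality_dep => k; rewrite /splice.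
have -> : take i (codom G) ++ [:: F p, F q & drop i.+1 (codom G)] =
    map F (take i (tolist s) ++ [:: p, q & drop i.+1 (tolist s)]).
  have /andP[i1 i2] : (i \notin take i (enum 'I_m)) && (i \notin drop i.+1 (enum 'I_m)).
    have im : (i < size (enum 'I_m))%N by rewrite size_enum_ord.
    have := enum_uniq 'I_m; rewrite -{1}(cat_take_drop i (enum 'I_m)) (drop_nth i) // nth_ord_enum.
    by rewrite cat_uniq /= negb_or => /and3P[_ /andP[-> _] /andP[-> _]].
  have H r : i \notin r -> map G r = map F (map (fun j => line_pair (s j)) r).
    move=> ir; rewrite -map_comp; apply/eq_in_map => j jr /=; rewrite FG //.
    by apply: contraNneq ir => <-.
  have t1 : take i (codom G) = map F (take i (tolist s)).
    by rewrite /codom /image_mem -map_take H // /tolist -map_take.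
  have t2 : drop i.+1 (codom G) = map F (drop i.+1 (tolist s)).
    by rewrite /codom /image_mem -map_drop H // /tolist -map_drop.
  by rewrite t1 t2 map_cat.
rewrite (nth_map (0%VS, 0%VS)) // size_cat /= size_takel ?size_drop size_tolist; last exact: ltnW.
suff -> : (i + (m - i.+1).+2)%N = n by [].
by rewrite -mn addnS subnSK // subnKC // (ltnW (ltn_ord i)).
Qed.
End FramesInDecompositions.

Section FrameElements.
Variables (K : fieldType) (n : nat).
Local Notation V := 'cV[K]_(n + n).
Local Notation VS := {vspace V}.
Local Notation om := (@st_form K n : {skew_symmetric V}).
Local Notation sframe := (sframe om).
Local Notation idx := (@idx0 K n).
Local Notation E W s := (shelt idx (fun=> 0%N) W s).


Lemma shelt_swap (W : 'I_n -> VS) s i (a b : VS) : perp_decomp om (fun=> 1%N) W ->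
  (forall j, j != i -> is_frame 0 (W j) (s j)) -> is_frame 0 (W i) [:: a; b] ->
  E W (upd s i [:: b; a]) = - E W (upd s i [:: a; b]).
Proof.
move=> Wd sW fab; have fba : is_frame 0 (W i) [:: b; a].
  by rewrite (is_frame_perm 0 (W i) (t := [:: a; b])) // -[[:: b; a]]/([:: b] ++ [:: a]) perm_catC.
have fr j : is_frame 0 (W j) (upd s i [:: b; a] j).
  by have [->|ji] := eqVneq j i; rewrite ?upd_eq // upd_neq // sW.
rewrite (shelt_alternating (k := fun=> 0%N) (P := idx) (i := i) (t := [:: a; b])
  (sigma := tperm ord0 (Ordinal (isT : (1 < 2)%N)))) ?upd_eq //.
  by rewrite updU odd_tperm expr1 mulrN1z.
by rewrite -/(permuted _ _ _) permuted_swap.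
Qed.

Lemma frame_elt_flip s1 s2 a b : sframe fullv (s1 ++ (a, b) :: s2) ->
  frame_elt (s1 ++ (b, a) :: s2) = - frame_elt (s1 ++ (a, b) :: s2).
Proof.
move=> f; have sz := sframe_size f; have i_n : (size s1 < n)%N.
  by apply: leq_trans (eq_leq sz); rewrite size_cat /= addnS ltnS leq_addr.
pose i := Ordinal i_n; set t := s1 ++ (a, b) :: s2 in f sz *.
have [[_ Wd] fW] := frame_eltP f.
have Es : pair_lines t i = [:: a; b] by rewrite /pair_lines /t nth_cat ltnn subnn.
have fab := fW i; rewrite Es in fab.
have {1}<- : tolist (upd (pair_lines (m := n) t) i [:: b; a]) = s1 ++ (b, a) :: s2.
  rewrite tolist_split tolistK // /t take_size_cat //; congr (_ ++ _ :: _).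
  by rewrite -cat_rcons drop_size_cat // size_rcons.
have fr u : is_frame 0 (pair_span (m := n) t i) u ->
    forall j, is_frame 0 (pair_span t j) (upd (pair_lines (m := n) t) i u j).
  by move=> fu j; have [->|ji] := eqVneq j i; rewrite ?upd_eq // upd_neq.
have fba : is_frame 0 (pair_span (m := n) t i) [:: b; a].
  by rewrite (is_frame_perm 0 _ (t := [:: a; b])) // -[[:: b; a]]/([:: b] ++ [:: a]) perm_catC.
have [_ <-] := shelt_frame (k := fun=> 0%N) (W := pair_span t) (conj (fun=> erefl) Wd) (fr _ fba).
rewrite shelt_swap // /frame_elt; congr (- shelt _ _ _ _).
by rewrite -Es upd_id.
Qed.

Definition d11_term W (s : 'I_n -> seq VS) i : shsum idx :=
  let v := nth 0%VS (s i) in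
  E W (upd s i [:: v 1; v 2])%N - E W (upd s i [:: v 0; v 2])%N + E W (upd s i [:: v 0; v 1])%N.

Definition d11_val (k : 'I_n -> nat) W s : shsum idx := oapp (d11_term W s) 0 [pick i | k i == 1%N].

Lemma idx11P k (W : 'I_n -> VS) : @idx11 K n k W -> exists i,
  [/\ k = (fun j => (j == i) : nat), [pick i | k i == 1%N] = Some i & perp_decomp om (fun=> 1%N) W].
Proof.
move=> [[i ki] Wd]; exists i; split=> //; first exact: functional_extensionality_dep.
case: pickP => [j|/(_ i)]; rewrite ki ?eqxx //.
by case: (j =P i) => [->|].
Qed.

Lemma decomp_dim (W : 'I_n -> VS) i : perp_decomp om (fun=> 1%N) W -> \dim (W i : VS) = 2%N.
Proof. by case=> /(_ i)/andP[_ /eqP]. Qed.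

Lemma d11_alternating : alternating (@idx11 K n) d11_val.
Proof.
move=> k W s j t N sigma kW sf tf sN Et.
have [i [kE pE Wd]] := idx11P kW; rewrite /d11_val pE /=.
have sf0 j' : j' != i -> is_frame 0 (W j') (s j').
  by move=> ji; have := sf j'; rewrite kE (negPf ji).
have [a [b [c [si fab fac fbc]]]] : exists a b c, [/\ s i = [:: a; b; c], is_frame 0 (W i) [:: a; b],
    is_frame 0 (W i) [:: a; c] & is_frame 0 (W i) [:: b; c]].
  by apply: frame1P; [apply: decomp_dim|have := sf i; rewrite kE eqxx].
have [ji|ji] := eqVneq j i; last first.
  have tf0 : is_frame 0 (W j) t by have := tf; rewrite kE (negPf ji).
  rewrite /d11_term upd_neq 1?eq_sym //.
  have H u : is_frame 0 (W i) u ->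
      E W (upd s i u) = E W (upd (upd s j t) i u) *~ (-1) ^+ sigma.
    move=> fu; rewrite updC //; apply: (shelt_alternating (P := idx)) => //.
    - by move=> j'; have [->|j'i] := eqVneq j' i; rewrite ?upd_eq // upd_neq // sf0.
    - by rewrite upd_neq.
    - by rewrite upd_neq.
  by rewrite si /= !H // mulrzDl mulrzBl.
subst j; have N3 : N = 3%N by rewrite -sN si.
move: sigma Et; rewrite {}N3 => sigma Et; pose f t := d11_term W (upd s i t) i.
have fE x y z : f [:: x; y; z] = E W (upd s i [:: y; z]) - E W (upd s i [:: x; z]) + E W (upd s i [:: x; y]).
  by rewrite /f /d11_term upd_eq !updU.
have fH x y z : is_frame 1 (W i) [:: x; y; z] ->
    f [:: y; x; z] = - f [:: x; y; z] /\ f [:: z; y; x] = - f [:: x; y; z].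
  move=> /(frame1P (decomp_dim _ Wd)) [x' [y' [z' [[<- <- <-] fxy fxz fyz]]]].
  rewrite !fE (shelt_swap Wd sf0 fxy) (shelt_swap Wd sf0 fxz) (shelt_swap Wd sf0 fyz).
  by split; abel.
have sf1 : is_frame 1 (W i) (s i) by have := sf i; rewrite kE eqxx.
have sz : size (s i) = 3%N by rewrite si.
have := alternating3 0%VS (is_frame_perm 1 (W i)) fH sigma sz sf1.
by rewrite /permuted -Et /f upd_id.
Qed.

Definition d11 : shsum (@idx11 K n) -> shsum idx := shlift d11_val.

Lemma d11B : zmod_morphism d11. Proof. exact: shliftB d11_alternating. Qed.

Lemma d11E k W s : idx11 k W -> (forall i, is_frame (k i) (W i) (s i)) ->
  d11 (shelt (@idx11 K n) k W s) = d11_val k W s.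
Proof. exact: (shlift_shelt d11_alternating). Qed.

Lemma d11_frames i W s a b c : perp_decomp om (fun=> 1%N) W ->
  (forall j, j != i -> is_frame 0 (W j) (s j)) -> s i = [:: a; b; c] ->
  is_frame 1 (W i) (s i) ->
  d11_term W s i =
  frame_elt (take i (tolist s) ++ (b, c) :: drop i.+1 (tolist s))
  - frame_elt (take i (tolist s) ++ (a, c) :: drop i.+1 (tolist s))
  + frame_elt (take i (tolist s) ++ (a, b) :: drop i.+1 (tolist s)).
Proof.
move=> Wd sf si fi; have [a' [b' [c' [+ fab fac fbc]]]] := frame1P (decomp_dim _ Wd) fi.
rewrite si => -[? ? ?]; subst a' b' c'; rewrite /d11_term si /=.
have H x y : is_frame 0 (W i) [:: x; y] ->
    E W (upd s i [:: x; y]) = frame_elt (take i (tolist s) ++ (x, y) :: drop i.+1 (tolist s)).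
  move=> fxy; rewrite -[(x, y)]/(line_pair [:: x; y]) -tolist_split.
  apply: (shelt_frame (k := fun=> 0%N) (conj (fun=> erefl) Wd) _).2 => j.
  by have [->|ji] := eqVneq j i; rewrite ?upd_eq // upd_neq // sf.
by rewrite !H.
Qed.

End FrameElements.

Lemma sum_pairs4 (B : zmodType) (f : nat -> nat -> B) :
  \sum_(j1 < 4) \sum_(j2 < 4 | (j1 < j2)%N) f j1 j2 =
  f 0%N 1%N + f 0%N 2%N + f 0%N 3%N + f 1%N 2%N + f 1%N 3%N + f 2%N 3%N.
Proof.
under eq_bigr => j1 _ do rewrite big_mkcond.
by rewrite !big_ord_recr !big_ord0 /=; abel.
Qed.

(** In [six_terms] the pair (a, b) has the sign opposite to the parity sign of a + b, whence the
    minus in front. The filter hypothesis fixes [c] and [d] as the remaining indices in increasing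
    order. *)
Lemma sum_pairs_six_terms (B : zmodType) (f : nat -> nat -> B) (q : nat -> nat -> nat -> nat -> B) (e : int) :
  (forall a b c d, (a < 4)%N -> (b < 4)%N -> (c < 4)%N -> (d < 4)%N -> uniq [:: a; b; c; d] ->
     uniq [:: a; b; d; c] -> [seq j <- iota 0 4 | (j != a) && (j != b)] = [:: c; d] ->
     f a b = q a b c d *~ ((-1) ^+ (a + b) * e)) ->
  \sum_(j1 < 4) \sum_(j2 < 4 | (j1 < j2)%N) f j1 j2 = - six_terms q *~ e.
Proof.
move=> H; rewrite sum_pairs4 (H 0 1 2 3)%N // (H 0 2 1 3)%N // (H 0 3 1 2)%N // (H 1 2 0 3)%N //.
rewrite (H 1 3 0 2)%N // (H 2 3 0 1)%N // !mulrzA -!mulrzDl /six_terms; congr (_ *~ _).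
by rewrite add0n expr1 !mulrN1z; abel.
Qed.

Section SixTermMap.
Variables (K : fieldType) (n : nat).
Local Notation V := 'cV[K]_(n + n).
Local Notation VS := {vspace V}.
Local Notation om := (@st_form K n : {skew_symmetric V}).
Local Notation T := (VS * VS)%type.
Local Notation perp := (perp om).
Local Notation quad := (quad om).
Local Notation idx := (@idx0 K n).
Local Notation E W s := (shelt idx (fun=> 0%N) W s).

Let alt := @st_form_alt K n.

(** Slots are counted from 0, so [n - 1 - i.+1] is n - 1 - i for slots counted from 1; the
    subtraction is never truncated because [i] is below [n.-1]. *)
Definition d12_term (i : 'I_n.-1) W (s : 'I_n.-1 -> seq VS) (j1 j2 : nat) : shsum idx :=
  let v j := nth 0%VS (s i) j in
  let X := (v j1 + v j2)%VS in
  let Y := (orthov om X :&: W i)%VS in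
  let yz := [seq (daddv_pi Y X @: v j)%VS | j : nat <- iota 0 4 & (j != j1) && (j != j2)] in
  if symplectic om 1 X then
    E (splice i X Y W) (splice i [:: v j1; v j2] yz s) *~ (-1) ^+ (j1 + j2 + (n - 1 - i.+1))
  else 0.

Definition d12_sum i W s : shsum idx :=
  \sum_(j1 < 4) \sum_(j2 < 4 | (j1 < j2)%N) d12_term i W s j1 j2.

Definition d12_val (k : 'I_n.-1 -> nat) W s : shsum idx :=
  oapp (fun i => d12_sum i W s) 0 [pick i | \dim (W i : VS) == 4%N].

Definition six_elt (s1 s2 : seq T) (v r : nat -> VS) a b c d : shsum idx :=
  if perp (v a) (v b) then 0 else frame_elt (s1 ++ [:: (v a, v b), (r d, r c) & s2]).

Lemma six_elt_flip W s1 s2 v r a b c d : ctx om fullv s1 W s2 -> quad W v r ->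
  (a < 4)%N -> (b < 4)%N -> (c < 4)%N -> (d < 4)%N -> uniq [:: a; b; c; d] ->
  six_elt s1 s2 v r b a c d = - six_elt s1 s2 v r a b c d /\
  six_elt s1 s2 v r a b d c = - six_elt s1 s2 v r a b c d.
Proof.
move=> C Q a4 b4 c4 d4 u; rewrite /six_elt (perpC _ (v b)); case: ifP => [_|/negbT vab].
  by rewrite oppr0.
have f := ctx_sframe C (quad_frame alt Q a4 b4 c4 d4 u vab).
split; first exact: frame_elt_flip f.
by have := @frame_elt_flip K n (s1 ++ [:: (v a, v b)]) s2 (r d) (r c); rewrite -!catA; apply.
Qed.

Section Sharbly12.
Variables (i : 'I_n.-1) (W : 'I_n.-1 -> VS) (s : 'I_n.-1 -> seq VS).
Hypothesis Wd : perp_decomp om (fun j => (j == i).+1) W.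
Hypothesis sW : forall j, is_frame 0 (W j) (s j).

Lemma ctx12 : ctx om fullv (take i (tolist s)) (W i) (drop i.+1 (tolist s)).
Proof. by apply: (slot_ctx alt Wd) => // j /negPf->. Qed.

Lemma quad12 : exists r, quad (W i) (nth 0%VS (s i)) r.
Proof.
case: Wd => /(_ i); rewrite eqxx => /andP[ndW /eqP dW] _ _ _.
exact: quad_exists ndW dW (sW i).
Qed.

(** Written with dual lines, the differential no longer mentions projections: alternation,
    equivariance and the comparison with symbols all start from this form. *)
Lemma d12E r : quad (W i) (nth 0%VS (s i)) r ->
  d12_sum i W s = - six_terms (six_elt (take i (tolist s)) (drop i.+1 (tolist s)) (nth 0%VS (s i)) r)
    *~ (-1) ^+ (n - 1 - i.+1).
Proof.
move=> Q; set v := nth 0%VS (s i); set q := six_elt _ _ v r; rewrite /d12_sum.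
have nE : n.-1.+1 = n by case: n i => // -[].
apply: sum_pairs_six_terms => a b c d a4 b4 c4 d4 u u' flt.
have eE e : (-1) ^+ (a + b + e) = (-1) ^+ (a + b) * (-1) ^+ e :> int by apply: exprD.
rewrite /d12_term -/v flt /q /six_elt.
  have gE : symplectic om 1 (v a + v b)%VS = ~~ perp (v a) (v b).
    have ab : a != b by move: u; rewrite /= !inE !negb_or => /and4P[/and3P[]].
    have dX := quad_dim2 Q a4 b4 ab; rewrite /symplectic dX eqxx andbT.
    apply/idP/idP => [ndX|vab]; last first.
      by apply: (nondeg_pl alt (p := (v a, v b))); rewrite /good /= !(quad_v Q) // vab.
    have vv m : (m < 4)%N -> perp (v m) (v m).
      by move=> m4; apply: (isotropic_line alt); rewrite (quad_v Q).
    apply/negP => vab; have : (v a + v b <= (v a + v b) :&: orthov om (v a + v b))%VS.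
      rewrite subv_cap subvv -perpE !(perpDl, perpDr) vab (perpC _ (v b)) vab.
      by rewrite !vv.
    by rewrite (eqP ndX) subv0 -dimv_eq0 dX.
  rewrite gE; case: ifP => [vab|/negbFE ->]; last by rewrite mul0rz.
  rewrite (negPf vab) eE; apply: (congr1 (fun z => z *~ _)).
  rewrite [map _ _]/= (quad_proj alt Q a4 b4 c4 d4 u vab) (quad_proj alt Q a4 b4 d4 c4 u' vab).
  have YE : (orthov om (v a + v b) :&: W i)%VS = pl (r d, r c).
    have := quad_frame alt Q a4 b4 c4 d4 u vab; rewrite sframe_cons // => /and3P[_ _ /andP[_ /eqP]].
    by rewrite plsum1 capvC => ->.
  have slot j : j != i -> pl (line_pair (s j)) = W j.
    by move=> ji; have [] := slot_pair alt Wd (s := s) _ _ ji => // j' /negPf->.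
  have slot2 j : j != i -> [:: (line_pair (s j)).1; (line_pair (s j)).2] = s j.
    move=> ji; case: Wd => /(_ j); rewrite (negPf ji) => /andP[_ /eqP dW] _ _ _.
    by have [x [y [-> _ _ _ _]]] := frame0P dW (sW j).
  rewrite YE /frame_elt; congr (shelt _ _ _ _).
    exact/esym/(splice_map (F := @pl _ _) (v a, v b) (r d, r c) nE slot).
  exact/esym/(splice_map (F := fun p : T => [:: p.1; p.2]) (v a, v b) (r d, r c) nE slot2).
Qed.
End Sharbly12.

Lemma idx12P k W : @idx12 K n k W -> exists i,
  [/\ k = (fun=> 0%N), [pick i | \dim (W i : VS) == 4%N] = Some i
    & perp_decomp om (fun j => (j == i).+1) W].
Proof.
move=> [k0 [i Wd]]; exists i; split=> //; first exact: functional_extensionality_dep.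
have dW j : \dim (W j : VS) = (j == i).+1.*2 by case: Wd => /(_ j) /andP[_ /eqP].
case: pickP => [j|/(_ i)]; rewrite dW ?eqxx //.
by case: (j =P i) => [->|].
Qed.

End SixTermMap.

Lemma six_terms_opp (B : zmodType) (t u : nat -> nat -> nat -> nat -> B) :
  (forall a b c d, (a < 4)%N -> (b < 4)%N -> (c < 4)%N -> (d < 4)%N -> uniq [:: a; b; c; d] ->
     t a b c d = - u a b c d) ->
  six_terms t = - six_terms u.
Proof. by move=> H; rewrite /six_terms !H //; abel. Qed.

Lemma six_terms_morph (A B : zmodType) (h : A -> B) t (u : nat -> nat -> nat -> nat -> B) :
  zmod_morphism h ->
  (forall a b c d, (a < 4)%N -> (b < 4)%N -> (c < 4)%N -> (d < 4)%N -> uniq [:: a; b; c; d] ->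
     h (t a b c d) = u a b c d) ->
  h (six_terms t) = six_terms u.
Proof. by move=> hB H; rewrite /six_terms !(zmD hB, zmN hB) !H. Qed.

Section QuadImage.
Variables (K : fieldType) (V : vectType K) (om : {skew_symmetric V}) (f : 'End(V)).
Hypothesis f0 : lker f == 0%VS.
Hypothesis fom : forall u v, om (f u) (f v) = om u v.

Lemma perp_limg X Y : perp om (f @: X)%VS (f @: Y)%VS = perp om X Y.
Proof. exact: limg_sub_orthov. Qed.

(** Dual lines are carried to dual lines, so [d12] is equivariant without any computation with
    projections. *)
Lemma quad_limg W v r : quad om W v r ->
  quad om (f @: W)%VS (fun i => f @: v i)%VS (fun i => f @: r i)%VS.
Proof.
move=> Q; split.
- have := symplectic_limg f0 fom (g := 2) (U := W).
  by rewrite /symplectic (quad_dim Q) eqxx andbT => /(_ (quad_nondeg Q))/andP[].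
- by rewrite limg_dim // (quad_dim Q).
- by rewrite -!limgD (quad_sum Q).
- by move=> i i4; rewrite limg_dim // (quad_v Q).
- by move=> i i4; rewrite limg_dim // (quad_r Q).
- by move=> i i4; rewrite limgS // (quad_sub Q).
by move=> i l i4 l4 il; rewrite perp_limg (quad_perp Q).
Qed.

Lemma nth_limgs (s : seq {vspace V}) i : nth 0%VS (limgs f s) i = (f @: nth 0%VS s i)%VS.
Proof.
have [si|si] := ltnP i (size s); first by rewrite (nth_map 0%VS).
by rewrite !nth_default ?size_map // limg0.
Qed.

Lemma tolist_limgs m (s : 'I_m -> seq {vspace V}) :
  tolist (fun i => limgs f (s i)) = [seq (f @: p.1, f @: p.2)%VS | p <- tolist s].
Proof. by rewrite /tolist -[RHS]map_comp; apply: eq_map => i /=; rewrite !nth_limgs. Qed.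
End QuadImage.

Section Differential.
Variables (K : fieldType) (n : nat).
Local Notation V := 'cV[K]_(n + n).
Local Notation VS := {vspace V}.
Local Notation om := (@st_form K n : {skew_symmetric V}).
Local Notation T := (VS * VS)%type.
Local Notation quad := (quad om).
Local Notation idx := (@idx0 K n).

Let alt := @st_form_alt K n.

Section Alternation.
Variables (i : 'I_n.-1) (W : 'I_n.-1 -> VS) (s : 'I_n.-1 -> seq VS).
Hypothesis Wd : perp_decomp om (fun j => (j == i).+1) W.
Hypothesis sW : forall j, is_frame 0 (W j) (s j).

Let upd_frame j t : is_frame 0 (W j) t -> forall j', is_frame 0 (W j') (upd s j t j').
Proof. by move=> ft j'; have [->|ji] := eqVneq j' j; rewrite ?upd_eq // upd_neq. Qed.

Lemma take_upd t : take i (tolist (upd s i t)) = take i (tolist s).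
Proof. by rewrite tolist_split take_size_cat // size_takel // size_tolist ltnW. Qed.

Lemma drop_upd t : drop i.+1 (tolist (upd s i t)) = drop i.+1 (tolist s).
Proof.
rewrite tolist_split -cat_rcons drop_size_cat // size_rcons size_takel // size_tolist.
exact: ltnW.
Qed.

Lemma d12_swap_lines vs vs' (tau : nat -> nat) :
  map tau (iota 0 4) \in [:: [:: 1; 0; 2; 3]; [:: 2; 1; 0; 3]; [:: 3; 1; 2; 0]]%N ->
  is_frame 0 (W i) vs -> is_frame 0 (W i) vs' -> nth 0%VS vs' =1 nth 0%VS vs \o tau ->
  d12_sum i W (upd s i vs') = - d12_sum i W (upd s i vs).
Proof.
move=> tauP fvs fvs' /funext E'; have [r Q] := quad12 Wd (upd_frame fvs).
have Q' : quad (W i) (nth 0%VS (upd s i vs' i)) (r \o tau).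
  rewrite upd_eq E'; rewrite upd_eq in Q.
  apply: (quad_perm Q); move: tauP; rewrite !inE => /or3P[] /eqP->; exact: isT.
rewrite (d12E Wd (upd_frame fvs) Q) (d12E Wd (upd_frame fvs') Q').
have C := ctx12 Wd (upd_frame fvs).
rewrite !take_upd !drop_upd !upd_eq in Q Q' C *; rewrite E'.
have S : six_terms (six_elt (take i (tolist s)) (drop i.+1 (tolist s)) (nth 0%VS vs \o tau) (r \o tau)) =
    - six_terms (six_elt (take i (tolist s)) (drop i.+1 (tolist s)) (nth 0%VS vs) r).
  by apply: six_terms_swap tauP => a b c d; apply: six_elt_flip C Q.
by rewrite S; apply: mulNrz.
Qed.

(** Slot [j] belongs to the context of the genus 2 slot, so the exchange flips one pair in each of
    the six frames, and the same dual lines serve on both sides. *)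
Lemma d12_swap_pair j a b : j != i -> is_frame 0 (W j) [:: a; b] ->
  d12_sum i W (upd s j [:: b; a]) = - d12_sum i W (upd s j [:: a; b]).
Proof.
move=> ji fab; have fba : is_frame 0 (W j) [:: b; a].
  by rewrite (is_frame_perm 0 (W j) (t := [:: a; b])) // -[[:: b; a]]/([:: b] ++ [:: a]) perm_catC.
have [r Q] := quad12 Wd (upd_frame fab).
have Q' : quad (W i) (nth 0%VS (upd s j [:: b; a] i)) r by move: Q; rewrite !upd_neq 1?eq_sym.
rewrite (d12E Wd (upd_frame fab) Q) (d12E Wd (upd_frame fba) Q') -[RHS](mulNrz _ _).
have C := ctx12 Wd (upd_frame fab).
have E' t : nth 0%VS (upd s j t i) = nth 0%VS (s i) by rewrite upd_neq 1?eq_sym.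
rewrite !E' in Q Q' C *; set v := nth 0%VS (s i) in Q Q' C *.
apply: (congr1 (fun z => - z *~ _)); apply: six_terms_opp => x y z w x4 y4 z4 w4 u.
rewrite /six_elt; case: ifP => [_|/negbT vxy]; first by rewrite oppr0.
have f := ctx_sframe C (quad_frame alt Q x4 y4 z4 w4 u vxy); move: f.
rewrite !tolist_split; set l1 := take j _; set l2 := drop j.+1 _.
have sl1 : size l1 = j by rewrite size_takel // size_tolist ltnW.
(* The flipped pair lies in the part of the context before or after slot [i]. *)
rewrite /line_pair /=; have [ltji|ltij|/val_inj E''] := ltngtP j i; last by rewrite E'' eqxx in ji.
  have Et p : take i (l1 ++ p :: l2) = l1 ++ p :: take (i - j.+1) l2.
    by rewrite take_cat sl1 ltnNge (ltnW ltji) /= -(subnSK ltji).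
  have Ed p : drop i.+1 (l1 ++ p :: l2) = drop (i - j) l2.
    by rewrite drop_cat sl1 ltnNge (leqW (ltnW ltji)) /= subSn // ltnW.
  by rewrite !Et !Ed -!catA; apply: frame_elt_flip.
have Et p : take i (l1 ++ p :: l2) = take i l1 by rewrite take_cat sl1 ltij.
have Ed p : drop i.+1 (l1 ++ p :: l2) = drop i.+1 l1 ++ p :: l2.
  rewrite drop_cat sl1; case: ltnP => // ji'.
  have -> : j = i.+1 :> nat by apply/eqP; rewrite eqn_leq ji' ltij.
  by rewrite subnn drop0 drop_oversize // sl1.
have Ec (A B B1 : seq T) p q : A ++ [:: p, q & B ++ B1] = (A ++ [:: p, q & B]) ++ B1 by rewrite -catA.
by rewrite !Et !Ed !Ec; apply: frame_elt_flip.
Qed.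
End Alternation.

Lemma d12_alternating : alternating (@idx12 K n) (@d12_val K n).
Proof.
move=> k W s j t N sigma kW sf tf sN Et.
have [i [kE pE Wd]] := idx12P kW; rewrite /d12_val pE /=.
have sf0 j' : is_frame 0 (W j') (s j') by have := sf j'; rewrite kE.
have tf0 : is_frame 0 (W j) t by have := tf; rewrite kE.
have dW : \dim (W j) = (j == i).+1.*2 by case: Wd => /(_ j) /andP[_ /eqP].
have sz : size (s j) = (j == i).+1.*2 by case/and4P: (sf0 j) => /eqP->; rewrite dW addn0.
pose f t := d12_sum i W (upd s j t).
have [ji|ji] := eqVneq j i; last first.
  rewrite (negPf ji) in sz; have N2 : N = 2%N by rewrite -sN sz.
  move: sigma Et; rewrite {}N2 => sigma Et.
  have fH a b : is_frame 0 (W j) [:: a; b] -> f [:: b; a] = - f [:: a; b].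
    exact: d12_swap_pair.
  have := alternating2 0%VS (is_frame_perm 0 (W j)) fH sigma sz (sf0 j).
  by rewrite /permuted -Et /f upd_id.
subst j; rewrite eqxx in sz; have N4 : N = 4%N by rewrite -sN sz.
move: sigma Et; rewrite {}N4 => sigma Et.
have fH a b c d : is_frame 0 (W i) [:: a; b; c; d] ->
    [/\ f [:: b; a; c; d] = - f [:: a; b; c; d], f [:: c; b; a; d] = - f [:: a; b; c; d]
      & f [:: d; b; c; a] = - f [:: a; b; c; d]].
  move=> fvs.
  have aux vs' (tau : nat -> nat) : map tau (iota 0 4) \in [:: [:: 1; 0; 2; 3]; [:: 2; 1; 0; 3]; [:: 3; 1; 2; 0]]%N ->
      perm_eq vs' [:: a; b; c; d] -> nth 0%VS vs' =1 nth 0%VS [:: a; b; c; d] \o tau ->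
      f vs' = - f [:: a; b; c; d].
    move=> tp pvs E'; apply: (d12_swap_lines Wd sf0 tp fvs _ E').
    by rewrite (is_frame_perm 0 (W i) pvs).
  have pq (x y z w : VS) : perm_eq [:: y; x; z; w] [:: x; y; z; w].
    by rewrite -[[:: y; x; z; w]]/([:: y] ++ [:: x] ++ [:: z; w]) perm_catCA.
  split.
  - apply: (aux _ (fun j => nth j [:: 1; 0; 2; 3]%N j)) => //; by case=> [|[|[|[|j]]]] //=; rewrite !nth_nil /= nth_nil.
  - apply: (aux _ (fun j => nth j [:: 2; 1; 0; 3]%N j)) => //; last by case=> [|[|[|[|j]]]] //=; rewrite !nth_nil /= nth_nil.
    rewrite (perm_trans (pq _ _ _ _)) // (perm_trans _ (pq _ _ _ _)) // perm_cons.
    by rewrite -[[:: c; a; d]]/([:: c] ++ [:: a] ++ [:: d]) perm_catCA.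
  apply: (aux _ (fun j => nth j [:: 3; 1; 2; 0]%N j)) => //; last by case=> [|[|[|[|j]]]] //=; rewrite !nth_nil /= nth_nil.
  rewrite -[X in perm_eq X _]/([:: d] ++ [:: b; c] ++ [:: a]) -[X in perm_eq _ X]/([:: a] ++ [:: b; c] ++ [:: d]).
  by rewrite perm_catC [X in perm_eq _ X]catA perm_cat2r perm_catC.
have := alternating4 0%VS (is_frame_perm 0 (W i)) fH sigma sz (sf0 i).
by rewrite /permuted -Et /f upd_id.
Qed.

Definition d12 : shsum (@idx12 K n) -> shsum idx := shlift (@d12_val K n).

Lemma d12B : zmod_morphism d12. Proof. exact: shliftB d12_alternating. Qed.

Lemma d12_shelt k W s : idx12 k W -> (forall i, is_frame (k i) (W i) (s i)) ->
  d12 (shelt (@idx12 K n) k W s) = d12_val k W s.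
Proof. exact: (shlift_shelt d12_alternating). Qed.

End Differential.

Lemma signed_six_terms_morph (A B : zmodType) (h : A -> B) t (u : nat -> nat -> nat -> nat -> B) e :
  zmod_morphism h ->
  (forall a b c d, (a < 4)%N -> (b < 4)%N -> (c < 4)%N -> (d < 4)%N -> uniq [:: a; b; c; d] ->
     h (t a b c d) = u a b c d) ->
  h (- six_terms t *~ e) = - six_terms u *~ e.
Proof. by move=> hB H; rewrite (zmMz hB) (zmN hB) (six_terms_morph hB H). Qed.

Lemma sum_morph (A B C : zmodType) (g : A -> C) (h : B -> C) :
  zmod_morphism g -> zmod_morphism h -> zmod_morphism (fun x : A * B => g x.1 + h x.2).
Proof. by move=> gB hB x y; rewrite /= gB hB opprD addrACA. Qed.

Section Equivariance.
Variables (R : comNzRingType) (K : fieldType) (iota : {rmorphism R -> K}) (n : nat).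
Local Notation V := 'cV[K]_(n + n).
Local Notation VS := {vspace V}.
Local Notation om := (@st_form K n : {skew_symmetric V}).
Local Notation T := (VS * VS)%type.
Local Notation sframe := (sframe om).
Local Notation quad := (quad om).
Local Notation idx := (@idx0 K n).
Local Notation E W s := (shelt idx (fun=> 0%N) W s).

Let alt := @st_form_alt K n.

Variable A : Sp R n.
Let f : 'End(V) := sp_action iota n A.
Let f_inj : lker f == 0%VS := iact_inj (sp_action iota n) A.
Let f_om : forall u v, om (f u) (f v) = om u v := iact_om (sp_action iota n) A.
Let fpair (p : T) : T := (f @: p.1, f @: p.2)%VS.

Lemma shact_frame_elt (t : seq T) : sframe fullv t ->
  shact (@idx0G R K iota n) A (frame_elt t) = frame_elt (map fpair t).
Proof.
move=> ft; have [tW ts] := frame_eltP ft.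
rewrite shact_shelt //.
have tW' := idx0G iota A tW.
rewrite (shelt_frame tW' _).2; last by move=> i; rewrite is_frame_limgs.
by rewrite (tolist_limgs f) tolistK // (sframe_size ft).
Qed.

Lemma shact_six_elt W s1 s2 v r a b c d : ctx om fullv s1 W s2 -> quad W v r ->
  (a < 4)%N -> (b < 4)%N -> (c < 4)%N -> (d < 4)%N -> uniq [:: a; b; c; d] ->
  shact (@idx0G R K iota n) A (six_elt s1 s2 v r a b c d) =
  six_elt (map fpair s1) (map fpair s2) (fun i => f @: v i)%VS (fun i => f @: r i)%VS a b c d.
Proof.
move=> C Q a4 b4 c4 d4 u; rewrite /six_elt (perp_limg f_om).
case: ifP => [_|/negbT vab]; first exact: zm0 (shactB _ _).
have ft := ctx_sframe C (quad_frame alt Q a4 b4 c4 d4 u vab).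
by rewrite shact_frame_elt // map_cat.
Qed.

Lemma shact_six_terms W s1 s2 v r e : ctx om fullv s1 W s2 -> quad W v r ->
  shact (@idx0G R K iota n) A (- six_terms (six_elt s1 s2 v r) *~ e) =
  - six_terms (six_elt (map fpair s1) (map fpair s2) (fun i => f @: v i)%VS (fun i => f @: r i)%VS) *~ e.
Proof.
move=> C Q; apply: (signed_six_terms_morph e (shactB _ A)) => a b c d a4 b4 c4 d4 u.
exact: (shact_six_elt C Q a4 b4 c4 d4 u).
Qed.

Lemma d12_shact x :
  d12 (shact (@idx12G R K iota n) A x) = shact (@idx0G R K iota n) A (d12 x).
Proof.
elim/shsum_ind: x => [|x y Ex Ey|k W s kW sf].
- by rewrite (zm0 (@d12B K n)) !(zm0 (shactB _ _)) (zm0 (@d12B K n)).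
- by rewrite (@d12B K n) !(shactB _ _) (@d12B K n) Ex Ey.
have kW' := idx12G iota A kW; have [i [kE pE Wd]] := idx12P kW.
have sf' j : is_frame (k j) (f @: W j)%VS (limgs f (s j)) by rewrite is_frame_limgs.
rewrite shact_shelt // !d12_shelt // /d12_val pE.
have -> : [pick i | \dim (f @: W i)%VS == 4%N] = Some i.
  by rewrite -pE; apply: eq_pick => j; rewrite limg_dim.
have sf0 j : is_frame 0 (W j) (s j) by have := sf j; rewrite kE.
have sf0' j : is_frame 0 (f @: W j)%VS (limgs f (s j)) by have := sf' j; rewrite kE.
have [r Q] := quad12 Wd sf0.
have Q' : quad (f @: W i)%VS (nth 0%VS (limgs f (s i))) (fun i => f @: r i)%VS.
  by rewrite (funext (nth_limgs f (s i))); apply: quad_limg.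
rewrite /= (d12E Wd sf0 Q) (d12E (sp_decomp iota A Wd) sf0' Q').
rewrite (shact_six_terms _ (ctx12 Wd sf0) Q) (tolist_limgs f) map_take map_drop.
by rewrite (funext (nth_limgs f (s i))).
Qed.

Lemma limgs_upd m (s : 'I_m -> seq VS) i t :
  (fun j => limgs f (upd s i t j)) = upd (fun j => limgs f (s j)) i (limgs f t).
Proof.
by apply: functional_extensionality_dep => j; have [->|ji] := eqVneq j i; rewrite ?upd_eq // !upd_neq.
Qed.

Lemma d11_shact x :
  d11 (shact (@idx11G R K iota n) A x) = shact (@idx0G R K iota n) A (d11 x).
Proof.
elim/shsum_ind: x => [|x y Ex Ey|k W s kW sf].
- by rewrite (zm0 (@d11B K n)) !(zm0 (shactB _ _)) (zm0 (@d11B K n)).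
- by rewrite (@d11B K n) !(shactB _ _) (@d11B K n) Ex Ey.
have kW' := idx11G iota A kW; have [i [kE pE Wd]] := idx11P kW.
have sf' j : is_frame (k j) (f @: W j)%VS (limgs f (s j)) by rewrite is_frame_limgs.
rewrite shact_shelt // !d11E // /d11_val pE /= /d11_term.
have fi : is_frame 1 (W i) (s i) by have := sf i; rewrite kE eqxx.
have sf0 j : j != i -> is_frame 0 (W j) (s j) by move=> ji; have := sf j; rewrite kE (negPf ji).
have [a [b [c [si fab fac fbc]]]] := frame1P (decomp_dim _ Wd) fi.
have H x y : is_frame 0 (W i) [:: x; y] -> shact (@idx0G R K iota n) A (E W (upd s i [:: x; y])) =
    E (fun j => f @: W j)%VS (upd (fun j => limgs f (s j)) i [:: (f @: x)%VS; (f @: y)%VS]).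
  move=> fxy; rewrite shact_shelt ?limgs_upd //.
  by move=> j; have [->|ji] := eqVneq j i; rewrite ?upd_eq // upd_neq // sf0.
by rewrite (zmD (shactB _ _)) shactB si /= !H.
Qed.
End Equivariance.

Section Differential.
Variables (R : comNzRingType) (K : fieldType) (iota : {rmorphism R -> K}) (n : nat).
Local Notation V := 'cV[K]_(n + n).
Local Notation VS := {vspace V}.
Local Notation om := (@st_form K n : {skew_symmetric V}).

Definition d1_fun (x : gprod (modV12 iota n) (modV11 iota n)) : modV0 iota n :=
  d12 (x.1 : shsum (@idx12 K n)) + d11 (x.2 : shsum (@idx11 K n)).

Lemma d1_funB : zmod_morphism d1_fun.
Proof. exact: (sum_morph (@d12B K n) (@d11B K n)). Qed.

Lemma d1_fun_act A x : d1_fun (gact A x) = gact A (d1_fun x).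
Proof.
rewrite /d1_fun [RHS](zmD (gactB _)); apply: (f_equal2 +%R); [exact: d12_shact|exact: d11_shact].
Qed.

Definition d1 : ghom (gprod (modV12 iota n) (modV11 iota n)) (modV0 iota n) :=
  GHom (zm_linear d1_funB) d1_fun_act.

Lemma d1E x y : d1 (x, y) = d12 (x : shsum (@idx12 K n)) + d11 (y : shsum (@idx11 K n)).
Proof. by []. Qed.

Lemma d1_elt11 (W : 'I_n -> VS) i s u v w :
  perp_decomp om (fun=> 1%N) W -> (forall j, j != i -> is_frame 0 (W j) (s j)) ->
  is_frame 1 (W i) [:: u; v; w] ->
  d1 (0, elt11 iota i W (upd s i [:: u; v; w])) =
    elt0 iota W (upd s i [:: v; w]) - elt0 iota W (upd s i [:: u; w]) + elt0 iota W (upd s i [:: u; v]).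
Proof.
move=> Wd sf fi; rewrite d1E (zm0 (@d12B K n)) add0r.
have kW : @idx11 K n (fun j => (j == i) : nat) W by split=> //; exists i.
rewrite d11E //; last first.
  by move=> j; have [->|ji] := eqVneq j i; rewrite ?upd_eq // upd_neq // sf.
have [i' [kE pE _]] := idx11P kW; rewrite /d11_val pE /=.
have -> : i' = i by have := congr1 (fun k => k i) kE; rewrite eqxx; case: eqP.
by rewrite /d11_term upd_eq /= !updU.
Qed.

Lemma d12_elt (W : 'I_n.-1 -> VS) i s :
  perp_decomp om (fun j => (j == i).+1) W -> (forall j, is_frame 0 (W j) (s j)) ->
  d12 (shelt (@idx12 K n) (fun=> 0%N) W s) = d12_sum i W s.
Proof.
move=> Wd sf; have kW : @idx12 K n (fun=> 0%N) W by split=> //; exists i.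
have [i' [kE pE Wd']] := idx12P kW; rewrite (d12_shelt kW sf) /d12_val pE /=.
suff -> : i' = i by [].
have [/(_ i) /andP[_ d] _ _ _] := Wd; have [/(_ i) /andP[_ d'] _ _ _] := Wd'.
by move: d; rewrite (eqP d'); case: (eqVneq i i') => // _; rewrite eqxx.
Qed.

Lemma d1_elt12 (W : 'I_n.-1 -> VS) i s :
  perp_decomp om (fun j => (j == i).+1) W -> (forall j, is_frame 0 (W j) (s j)) ->
  d1 (elt12 iota W s, 0) = d12_sum i W s.
Proof. by move=> Wd sf; rewrite d1E (zm0 (@d11B K n)) addr0; apply: d12_elt. Qed.
End Differential.

(** * Exactness *)

Lemma drop_mid (T : Type) (s1 s2 : seq T) p : drop (size s1).+1 (s1 ++ p :: s2) = s2.
Proof. by rewrite -cat_rcons drop_size_cat ?size_rcons. Qed.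

Lemma signed_eq0 (B : zmodType) (x : B) k : - x *~ (-1) ^+ k = 0 -> x = 0.
Proof.
move/(congr1 (fun z => z *~ (-1) ^+ k)); rewrite -mulrzA -expr2 sqrr_sign mulr1z mul0rz.
by move/eqP; rewrite oppr_eq0 => /eqP.
Qed.

Section Exactness.
Variables (R : comNzRingType) (K : fieldType) (iota : {rmorphism R -> K}) (n : nat).
Local Notation V := 'cV[K]_(n + n).
Local Notation VS := {vspace V}.
Local Notation om := (@st_form K n : {skew_symmetric V}).
Local Notation sframe := (sframe om).
Local Notation perp := (perp om).
Local Notation quad := (quad om).
Local Notation idx := (@idx0 K n).

Let alt := @st_form_alt K n.
Let dm := @st_form_dim K n.

Lemma sframe1 W p : sframe W [:: p] = good om p && (pl p == W).
Proof. by rewrite sframeE /= plsum_nil perp0r !andbT plsum1. Qed.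

Lemma frame_sframe W s : nondeg om W -> \dim W = 2%N -> is_frame 0 W s -> sframe W [:: line_pair s].
Proof. by move=> nW dW fW; have [g E] := frame_pair alt nW dW fW; rewrite sframe1 g E eqxx. Qed.

Lemma eps_d11 (x : shsum (@idx11 K n)) : eps_chain (d11 x) = 0.
Proof.
elim/shsum_ind: x => [|x y Ex Ey|k W s kW sf].
- by rewrite (zm0 (@d11B K n)) raddf0.
- by rewrite (@d11B K n) raddfB /= Ex Ey subrr.
have [i [kE pE Wd]] := idx11P kW.
have fi : is_frame 1 (W i) (s i) by have := sf i; rewrite kE eqxx.
have sf0 j : j != i -> is_frame 0 (W j) (s j) by move=> ji; have := sf j; rewrite kE (negPf ji).
have [a [b [c [si fab fac fbc]]]] := frame1P (decomp_dim _ Wd) fi.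
rewrite d11E // /d11_val pE /= (d11_frames Wd sf0 si fi).
have C := slot_ctx alt Wd (fun _ _ => erefl) sf0.
have [/(_ i) /andP[nW dW] _ _ _] := Wd.
have H x y : is_frame 0 (W i) [:: x; y] ->
    sframe (W i) [:: (x, y)] by move/(frame_sframe nW (eqP dW)).
have F x y fxy := eps_frame_elt (ctx_sframe C (H x y fxy)).
rewrite raddfD raddfB /= (F _ _ fab) (F _ _ fac) (F _ _ fbc).
by rewrite -raddfB -raddfD (symbol_three (ap_symbol alt fullv) C (H _ _ fab) (H _ _ fac) (H _ _ fbc)) raddf0.
Qed.

Lemma eps_six_elt W s1 s2 v r a b c d : ctx om fullv s1 W s2 -> quad W v r ->
  (a < 4)%N -> (b < 4)%N -> (c < 4)%N -> (d < 4)%N -> uniq [:: a; b; c; d] ->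
  eps_chain (six_elt s1 s2 v r a b c d) =
  to_chain om n (if perp (v a) (v b) then 0 else ap (s1 ++ [:: (v a, v b), (r d, r c) & s2])).
Proof.
move=> C Q a4 b4 c4 d4 u; rewrite /six_elt; case: ifP => [_|/negbT vab]; first by rewrite !raddf0.
exact: (eps_frame_elt (ctx_sframe C (quad_frame alt Q a4 b4 c4 d4 u vab))).
Qed.

Lemma eps_six_terms W s1 s2 v r e : ctx om fullv s1 W s2 -> quad W v r ->
  eps_chain (- six_terms (six_elt s1 s2 v r) *~ e) = 0.
Proof.
move=> C Q; pose q a b c d := if perp (v a) (v b) then 0 else ap (s1 ++ [:: (v a, v b), (r d, r c) & s2]).
pose q' a b c d := to_chain om n (q a b c d).
have E1 : eps_chain (- six_terms (six_elt s1 s2 v r) *~ e) = - six_terms q' *~ e.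
  by apply: signed_six_terms_morph (@eps_chainB K n) _ => a b c d a4 b4 c4 d4 u; apply: eps_six_elt C Q _ _ _ _ u.
have E2 : to_chain om n (six_terms q) = six_terms q' by apply: six_terms_morph => //; exact: raddfB.
by rewrite E1 -E2 (symbol_six (ap_symbol alt fullv) C Q) raddf0 oppr0 mul0rz.
Qed.

Lemma eps_d12 (x : shsum (@idx12 K n)) : eps_chain (d12 x) = 0.
Proof.
elim/shsum_ind: x => [|x y Ex Ey|k W s kW sf].
- by rewrite (zm0 (@d12B K n)) raddf0.
- by rewrite (@d12B K n) raddfB /= Ex Ey subrr.
have [i [kE pE Wd]] := idx12P kW; rewrite d12_shelt // /d12_val pE /=.
have sf0 j : is_frame 0 (W j) (s j) by have := sf j; rewrite kE.
have [r Q] := quad12 Wd sf0; have C := ctx12 Wd sf0; rewrite (d12E Wd sf0 Q).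
exact: eps_six_terms C Q.
Qed.

Lemma eps_d1 x : eps iota n (d1 iota n x) = 0.
Proof.
apply/eps_fun0; rewrite -[RHS](addr0 0); case: x => x y.
by rewrite -{1}(eps_d12 x) -(eps_d11 y); apply: (zmD (@eps_chainB K n)).
Qed.

Lemma quad_ext W v v' r : (forall i, (i < 4)%N -> v' i = v i) -> quad W v r -> quad W v' r.
Proof.
move=> E Q; split; rewrite ?E //; try by case: Q.
- by move=> i i4; rewrite E // (quad_v Q).
by move=> i j i4 j4 ij; rewrite E // (quad_perp Q).
Qed.

Definition in_image (y : shsum idx) := exists x, d1 iota n x = y :> modV0 iota n.

Lemma in_image0 : in_image 0. Proof. by exists 0; exact: (zm0 (ghomB _)). Qed.
Lemma in_imageB x y : in_image x -> in_image y -> in_image (x - y).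
Proof. by case=> x' <- [y' <-]; exists (x' - y'); exact: (ghomB (d1 iota n)). Qed.

Lemma zspan_in_image y : y \in zspan in_image -> in_image y.
Proof. by move=> /asboolP; apply=> //; [exact: in_image0|exact: in_imageB]. Qed.

Lemma in_image_d11 y : in_image (d11 y).
Proof. by exists (0, y); rewrite d1E (zm0 (@d12B K n)) add0r. Qed.
Lemma in_image_d12 y : in_image (d12 y).
Proof. by exists (y, 0); rewrite d1E (zm0 (@d11B K n)) addr0. Qed.

(** The projection onto the cokernel of [d_1]. Its values on frames form a symbol, so it kills the
    kernel of the augmentation, which is exactness at [V_0]. *)
Let cl := zpi in_image.

Lemma zpi_in_image y : in_image y -> cl y = 0.
Proof. by move=> Sy; rewrite -(zm0 (@zpiB _ in_image)); apply/zpi_eq; rewrite subr0; apply: zspan_gen. Qed.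

Lemma ctx_size s1 W s2 : ctx om fullv s1 W s2 -> nondeg om W ->
  n.*2 = (\dim W + (size (s1 ++ s2)).*2)%N.
Proof.
case/and3P=> os WS /eqP E nW; rewrite -(orthogonal_frame_dim alt os) -dm -E.
by rewrite dimv_disjoint_sum // (nondeg_disjoint nW WS).
Qed.

Lemma class_flip W s1 s2 a b : ctx om fullv s1 W s2 -> sframe W [:: (a, b)] ->
  cl (frame_elt (s1 ++ (b, a) :: s2)) = - cl (frame_elt (s1 ++ (a, b) :: s2)).
Proof.
move=> C f; rewrite -(zmN (@zpiB _ _)); congr cl.
exact: frame_elt_flip (ctx_sframe C f).
Qed.

Lemma class_three W s1 s2 a b c : ctx om fullv s1 W s2 ->
  sframe W [:: (a, b)] -> sframe W [:: (a, c)] -> sframe W [:: (b, c)] ->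
  cl (frame_elt (s1 ++ (b, c) :: s2)) - cl (frame_elt (s1 ++ (a, c) :: s2))
  + cl (frame_elt (s1 ++ (a, b) :: s2)) = 0.
Proof.
move=> C fab fac fbc; have ft := ctx_sframe C fab; set t := s1 ++ _ ++ s2 in ft.
have st := sframe_size ft.
have i_n : (size s1 < n)%N by apply: leq_trans (eq_leq st); rewrite size_cat /= addnS ltnS leq_addr.
pose i := Ordinal i_n; have [[_ Wd] sf] := frame_eltP ft.
have Wi : pair_span (m := n) t i = W.
  rewrite /pair_span nth_cat ltnn subnn /=.
  by move: fab; rewrite sframe1 => /andP[_ /eqP].
pose s := upd (pair_lines (m := n) t) i [:: a; b; c].
have tl : tolist s = s1 ++ (a, b) :: s2.
  by rewrite tolist_split tolistK // take_size_cat // drop_mid.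
have sf0 j : j != i -> is_frame 0 (pair_span t j) (s j) by move=> ji; rewrite /s upd_neq.
have si : s i = [:: a; b; c] by rewrite /s upd_eq.
have fi : is_frame 1 (pair_span t i) (s i).
  rewrite si Wi; move: fab fac fbc; rewrite !sframe1.
  move=> /andP[gab /eqP Eab] /andP[gac /eqP Eac] /andP[gbc /eqP Ebc].
  have /and3P[/eqP da /eqP db ab] := gab; have /and3P[_ /eqP dc bc] := gbc.
  have /and3P[_ _ ac] := gac.
  have neq x y : \dim x = 1%N -> ~~ perp x y -> x != y.
    by move=> dx; apply: contraNneq => <-; apply: (isotropic_line alt).
  apply/and4P; split.
  - by rewrite -Eab (dim_pl alt gab).
  - by rewrite /= !inE negb_or !neq.
  - by rewrite /= da db dc.
  by rewrite !big_cons big_nil addv0 -[(b + c)%VS]/(pl (b, c)) Ebc; apply/eqP/addv_idPr; rewrite -Eab addvSl.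
have := d11_frames Wd sf0 si fi; rewrite tl take_size_cat // drop_mid => Ed.
rewrite -(zpiB in_image) -(zmD (@zpiB _ _)) -Ed; apply: zpi_in_image.
have kW : @idx11 K n (fun j => (j == i) : nat) (pair_span t) by split=> //; exists i.
have [i' [kE pE _]] := idx11P kW.
have E' : i' = i by have := congr1 (fun k => k i) kE; rewrite eqxx; case: eqP.
have := in_image_d11 (shelt (@idx11 K n) (fun j => (j == i) : nat) (pair_span t) s).
rewrite d11E //; first by rewrite /d11_val pE /= E'.
by move=> j; have [->//|ji] := eqVneq j i; apply: sf0.
Qed.

(** The context and the four lines are assembled into a generator of [V_{1,2}] with the genus 2
    space in slot [size s1]; the relation is the vanishing of the class of its image. *)
Lemma class_six W s1 s2 v r : ctx om fullv s1 W s2 -> quad W v r ->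
  six_terms (fun i j k l => if perp (v i) (v j) then 0 else
    cl (frame_elt (s1 ++ [:: (v i, v j), (r l, r k) & s2]))) = 0.
Proof.
move=> C Q; have nW := quad_nondeg Q; have dW := quad_dim Q.
(* [W] takes up genus 2, so the context consists of n - 2 pairs and the decomposition has n - 1
   slots. *)
have sz : n = (size (s1 ++ s2)).+2.
  by apply: double_inj; rewrite -[n.*2]/(n.*2) (ctx_size C nW) dW !doubleS.
have sz1 := congr1 predn sz; rewrite /= in sz1.
have szi : (size s1 < n.-1)%N by apply: leq_trans (eq_leq (esym sz1)); rewrite ltnS size_cat leq_addr.
pose i := Ordinal szi; pose ws := map (@pl _ _) s1 ++ W :: map (@pl _ _) s2.
pose ss := map (fun p => [:: p.1; p.2]) s1 ++ [:: v 0; v 1; v 2; v 3]%N :: map (fun p => [:: p.1; p.2]) s2.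
pose s (j : 'I_n.-1) := nth [::] ss j.
have sws : size ws = n.-1 by apply: etrans (esym sz1); rewrite !size_cat /= !size_map addnS.
have sss : size ss = n.-1 by rewrite -sws !size_cat /= !size_map.
have /and3P[os WS /eqP WE] := C.
have gd p : p \in s1 ++ s2 -> good om p.
  by move: os; rewrite orthogonal_frameE => /andP[/allP os _]; apply: os.
have slot (j : 'I_n.-1) : (j = i /\ nth 0%VS ws j = W /\ s j = [:: v 0; v 1; v 2; v 3]%N) \/
    (j != i /\ exists2 p, p \in s1 ++ s2 & nth 0%VS ws j = pl p /\ s j = [:: p.1; p.2]).
  have [->|ji] := eqVneq j i.
    by left; rewrite /s /ws /ss !nth_cat !size_map ltnn subnn.
  right; split=> //; have [jlt|jge] := ltnP j (size s1).
    exists (nth (0%VS, 0%VS) s1 j); first by rewrite mem_cat mem_nth.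
    by rewrite /s /ws /ss !nth_cat !size_map jlt !(nth_map (0%VS, 0%VS)).
  have jlt : (size s1 < j)%N by rewrite ltn_neqAle jge andbT eq_sym -(inj_eq val_inj) in ji *.
  have j2 : (j - (size s1).+1 < size s2)%N.
    rewrite ltn_subLR // addSn -size_cat.
    exact: leq_trans (ltn_ord j) (eq_leq sz1).
  exists (nth (0%VS, 0%VS) s2 (j - (size s1).+1)); first by rewrite mem_cat mem_nth ?orbT.
  rewrite /s /ws /ss !nth_cat !size_map ltnNge jge /= -(subnSK jlt) /=.
  by rewrite !(nth_map (0%VS, 0%VS)).
have Wd : perp_decomp om (fun j => (j == i).+1) (fun j : 'I_n.-1 => nth 0%VS ws j).
  apply: decomp_of_seq => //.
  - move=> j; case: (slot j) => [[-> [-> _]]|[ji [p /gd gp [-> _]]]].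
      by rewrite eqxx /symplectic dW andbT.
    by rewrite (negPf ji) /symplectic (dim_pl alt gp) andbT; apply: (nondeg_pl alt gp).
  - have PW p : p \in s1 ++ s2 -> perp W (pl p).
      by move=> ps; apply: perpS (subvv W) _ WS; rewrite /plsum (big_rem p) //= addvSl.
    move: os; rewrite orthogonal_frameE => /andP[_].
    rewrite !pairwise_cat /= !pairwise_map allrel_consr allrel_mapl allrel_mapr => /and3P[-> -> ->]; rewrite !andbT.
    apply/andP; split; last by apply/allP => _ /mapP[p ps ->]; rewrite PW // mem_cat ps orbT.
    by apply/allP => _ /mapP[p ps ->]; rewrite perpC PW // mem_cat ps.
  by rewrite big_cat big_cons !big_map /= addvA (addvC _ W) -addvA -big_cat.
have sf (j : 'I_n.-1) : is_frame 0 (nth 0%VS ws j) (s j).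
  case: (slot j) => [[-> [-> ->]]|[ji [p /gd gp [-> ->]]]].
    apply/and4P; split; first by rewrite dW.
    - by rewrite /= !inE !negb_or !(quad_neq Q).
    - by rewrite /= !(quad_v Q).
    by rewrite !big_cons big_nil addv0 !addvA (quad_sum Q).
  have /and3P[/eqP d1 /eqP d2 np] := gp; apply: frame0I => //; last exact: (dim_pl alt gp).
  by apply: contraNneq np => ->; apply: (isotropic_line alt).
have tl : tolist s = s1 ++ (v 0, v 1)%N :: s2.
  have -> : tolist s = map (@line_pair _ _) ss.
    apply: (eq_from_nth (x0 := (0%VS, 0%VS))); rewrite size_tolist ?size_map ?sss // => j jm.
    by rewrite (nth_tolist s (Ordinal jm)) (nth_map [::]) ?sss.
  by rewrite map_cat /= -!map_comp !map_id_in // => -[].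
have Q' : quad (nth 0%VS ws i) (nth 0%VS (s i)) r.
  case: (slot i) => [[_ [-> ->]]|[]]; last by rewrite eqxx.
  by apply: quad_ext Q; case=> [|[|[|[|]]]].
have kW : @idx12 K n (fun=> 0%N) (fun j : 'I_n.-1 => nth 0%VS ws j) by split=> //; exists i.
have := zpi_in_image (in_image_d12 (shelt (@idx12 K n) (fun=> 0%N) (fun j : 'I_n.-1 => nth 0%VS ws j) s)).
rewrite (d12_elt Wd sf) (d12E Wd sf Q') tl take_size_cat // drop_mid => Z0.
apply: (@signed_eq0 _ _ (n - 1 - i.+1)); rewrite -[RHS]Z0; apply/esym.
apply: signed_six_terms_morph (@zpiB _ _) _ => a b c d a4 b4 c4 d4 _; rewrite /six_elt.
have -> : s i = [:: v 0; v 1; v 2; v 3]%N by case: (slot i) => [[_ [_ ->]]|[]]; rewrite ?eqxx.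
have nv m : (m < 4)%N -> nth 0%VS [:: v 0; v 1; v 2; v 3]%N m = v m by case: m => [|[|[|[|]]]].
by rewrite !nv //; case: ifP => // _; apply: (zm0 (@zpiB _ _)).
Qed.

Lemma class_symbol : symbol om fullv (fun t => cl (frame_elt t)).
Proof. by split; [exact: class_flip|exact: class_three|exact: class_six]. Qed.

Lemma presentation_d1 : presentation (d1 iota n) (eps iota n).
Proof.
split=> [z|y]; first exact: eps_surj.
split=> [ey|[x <-]]; last exact: eps_d1.
apply: zspan_in_image; have := eps_kernel (@zpiB _ _) class_symbol ey.
by rewrite -(zm0 (@zpiB _ in_image)) => /zpi_eq; rewrite subr0.
Qed.
End Exactness.

(** * Rational coefficients *)

Lemma rgenBl (A : zmodType) q : zmod_morphism (fun a : A => rgen a q).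
Proof. by move=> a b; apply/eqP; rewrite eq_sym subr_eq -rgenDl subrK. Qed.

Section RightExactness.
Variables (G : groupType) (V1 V0 M : gmodule int G) (d : ghom V1 V0) (e : ghom V0 M).
Hypothesis pres : presentation d e.

Let dB := @ghomB _ _ _ _ d.
Let eB := @ghomB _ _ _ _ e.
Let surj z := pres.1 z.
Let lift z : V0 := sval (cid (surj z)).
Let liftP z : e (lift z) = z := svalP (cid (surj z)).

Let image (y : rext V0) := exists x, rmap d x = y.

Let image_zspan y : y \in zspan image -> image y.
Proof.
move=> /asboolP; apply=> // [|x z [x' <-] [z' <-]]; first by exists 0; exact: zm0 (rmapB dB).
by exists (x' - z'); rewrite (rmapB dB).
Qed.

Let cl_kernel a q : e a = 0 -> zpi image (rgen a q) = 0.
Proof.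
case/(pres.2 a).1 => x Ea; rewrite -(zm0 (@zpiB _ image)); apply/zpi_eq; rewrite subr0.
by apply: zspan_gen; exists (rgen x q); rewrite rmap_rgen // Ea.
Qed.

Let cl_eq a b q : e a = e b -> zpi image (rgen a q) = zpi image (rgen b q).
Proof.
move=> ab; have := @cl_kernel (a - b) q; rewrite eB ab subrr => /(_ erefl) /eqP.
by rewrite rgenBl (@zpiB _ image) subr_eq0 => /eqP.
Qed.

(** The inverse of the map from the cokernel to [rext M], built from arbitrary lifts. It is additive
    in [z] because two lifts of one element differ by an element in the image of [d]. *)
Let back (z : M) q := zpi image (rgen (lift z) q).

Let back_kills s : rext_rel s -> fgext (fun x => back x.1 x.2) s = 0.
Proof.
apply: (rext_kills (f := back)) => [a b q|a q r]; rewrite /back.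
  rewrite -(zmD (@zpiB _ image)) -rgenDl; apply: cl_eq.
  by rewrite (zmD eB) !liftP.
by rewrite rgenDr (zmD (@zpiB _ image)).
Qed.

Lemma presentation_grmap : presentation (grmap d) (grmap e).
Proof.
split=> [|y].
  elim/presented_ind => [|x y [x' <-] [y' <-]|[a q]].
  - by exists 0; exact: zm0 (rmapB eB).
  - by exists (x' - y'); exact: rmapB.
  by exists (rgen (lift a) q); rewrite -[RHS]/(rgen a q) -{2}(liftP a); exact: rmap_rgen.
split=> [ey|[x <-]]; last first.
  apply: (presented_ext (f := fun x => rmap e (rmap d x)) (g := fun=> 0)) x => [x z|x z|[a q]].
  - by rewrite (rmapB dB) (rmapB eB).
  - by rewrite subr0.
  rewrite -/(rgen a q) (rmap_rgen dB) (rmap_rgen eB) (pres.2 _).2; last by exists a.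
  by apply: (addIr (rgen 0 q)); rewrite -rgenDl !add0r.
apply: image_zspan; suff E : plift (fun x => back x.1 x.2) (rmap e y) = zpi image y.
  have : zpi image y = 0 by rewrite -E [rmap e y]ey; apply: zm0 (pliftB back_kills).
  by rewrite -(zm0 (@zpiB _ image)) => /zpi_eq; rewrite subr0.
move: y {ey}; apply: (presented_ext (f := fun y => plift (fun x => back x.1 x.2) (rmap e y))) => [x y|x y|[a q]].
- by rewrite (rmapB eB) (pliftB back_kills).
- exact: zpiB.
rewrite -/(rgen a q) (rmap_rgen eB) plift_gen //.
by apply: cl_eq; rewrite liftP.
Qed.
End RightExactness.

(** * Projectivity of rational extensions *)

Section RationalProjectivity.
Variable G : groupType.

Lemma ghomZ (M N : gmodule rat G) (f : ghom M N) q x : f (q *: x) = q *: f x.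
Proof. by rewrite -[q *: x]addr0 ghom_linear (zm0 (ghomB f)) addr0. Qed.

Lemma gactZ (M : gmodule rat G) g q (x : M) : gact g (q *: x) = q *: gact g x.
Proof. by rewrite -[q *: x]addr0 gact_linear (zm0 (gactB g)) addr0. Qed.

Section Extension.
Variables (M : gmodule int G) (N : gmodule rat G) (h : M -> N).
Hypothesis hB : zmod_morphism h.

Definition rlift : rext M -> N := plift (fun x => x.2 *: h x.1).

Let rlift_kills s : rext_rel s -> fgext (fun x => x.2 *: h x.1) s = 0.
Proof.
by apply: (rext_kills (f := fun a q => q *: h a)) => *; rewrite ?(zmD hB) ?scalerDr ?scalerDl.
Qed.

Lemma rliftB : zmod_morphism rlift. Proof. exact/pliftB/rlift_kills. Qed.

Lemma rlift_rgen a q : rlift (rgen a q) = q *: h a. Proof. exact/plift_gen/rlift_kills. Qed.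

Lemma rlift_linear : linear rlift.
Proof.
move=> q x y; rewrite (zmD rliftB); congr (_ + _).
move: x; apply: presented_ext => [x z|x z|[a r]].
- by rewrite scalerBr rliftB.
- by rewrite rliftB scalerBr.
by change (rlift (rscale q (rgen a r)) = q *: rlift (rgen a r)); rewrite rscale_rgen !rlift_rgen scalerA.
Qed.

Hypothesis h_act : forall g x, h (gact g x) = gact g (h x).

Lemma rlift_act g (x : grext M) : rlift (gact g x) = gact g (rlift x).
Proof.
have gB := rmapB (@gactB _ _ M g).
apply: (presented_ext (f := fun x : rext M => rlift (rmap (gact g) x))
  (g := fun x => gact g (rlift x))) x => [x y|x y|[a q]].
- by rewrite gB rliftB.
- by rewrite rliftB (gactB g).
rewrite -/(rgen a q) (rmap_rgen (@gactB _ _ M g)) !rlift_rgen h_act.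
by rewrite gactZ.
Qed.

Definition rlift_hom : ghom (grext M) N := @GHom rat G (grext M) N rlift rlift_linear rlift_act.
End Extension.

Lemma rgen_scale (M : gmodule int G) (a : M) q : rgen a q = q *: (rgen a 1 : grext M).
Proof. by change (rgen a q = rscale q (rgen a 1)); rewrite rscale_rgen mulr1. Qed.

(** A map out of [grext M] is determined by its values on the elements [rgen x 1], so a lifting
    problem can be solved on [M] itself, that is, on integral generators. *)
Lemma projective_grext (M : gmodule int G) :
  (forall (N N' : gmodule rat G) (p : ghom N N') (F : M -> N'),
     (forall y, exists x, p x = y) -> zmod_morphism F -> (forall g x, F (gact g x) = gact g (F x)) ->
     exists h : M -> N,
     [/\ zmod_morphism h, forall g x, h (gact g x) = gact g (h x) & forall x, p (h x) = F x]) ->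
  projective (grext M).
Proof.
move=> H N N' p f ps; have fB : zmod_morphism (fun x : M => f (rgen x 1)).
  by move=> x y; rewrite rgenBl (ghomB f).
have f_act g (x : M) : f (rgen (gact g x) 1) = gact g (f (rgen x 1)).
  by rewrite -ghom_act; congr (f _); apply/esym/rmap_rgen/gactB.
have [h [hB h_act ph]] := H N N' p _ ps fB f_act.
exists (rlift_hom hB h_act).
apply: (presented_ext (f := fun x => p (rlift h x))) => [x y|x y|[a q]].
- by rewrite rliftB // (ghomB p).
- exact: ghomB f _ _.
by rewrite -/(rgen a q) rlift_rgen // ghomZ ph -ghomZ -rgen_scale.
Qed.

Lemma projective_gprod (M1 M2 : gmodule int G) :
  projective (grext M1) -> projective (grext M2) -> projective (grext (gprod M1 M2)).
Proof.
move=> P1 P2; apply: projective_grext => N N' p F ps FB F_act.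
have F1B : zmod_morphism (fun x : M1 => F (x, 0)) by move=> x y; rewrite -FB; congr F; congr (_, _); rewrite subr0.
have F2B : zmod_morphism (fun x : M2 => F (0, x)) by move=> x y; rewrite -FB; congr F; congr (_, _); rewrite subr0.
have F1a g x : F (gact g x, 0) = gact g (F (x, 0)) by rewrite -F_act; congr F; congr (_, _); rewrite (zm0 (gactB g)).
have F2a g x : F (0, gact g x) = gact g (F (0, x)) by rewrite -F_act; congr F; congr (_, _); rewrite (zm0 (gactB g)).
have [h1 E1] := P1 _ _ p (rlift_hom F1B F1a) ps; have [h2 E2] := P2 _ _ p (rlift_hom F2B F2a) ps.
exists (fun x : gprod M1 M2 => h1 (rgen x.1 1) + h2 (rgen x.2 1)); split.
- by move=> x y; rewrite /= !rgenBl (ghomB h1) (ghomB h2) opprD addrACA.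
- move=> g x; rewrite (zmD (gactB g)) -!ghom_act; congr (h1 _ + h2 _); apply/esym;
    exact: (rmap_rgen (gactB g)).
move=> x; rewrite (zmD (ghomB p)) E1 E2 /= !rlift_rgen // !scale1r -(zmD FB); congr F.
by case: x => x y; congr (_, _); rewrite ?addr0 ?add0r.
Qed.
End RationalProjectivity.

(** * Averaging over transporters *)

Section Averaging.
(** [T] models generators up to sign: [E e x y] says that [x] is [e] times [y], and [E 1 x x] that
    [x] is a genuine generator, since [T] may contain other elements. [E_inj] excludes that a
    generator is identified with its negative. *)
Variables (G : groupType) (T : Type) (act : G -> T -> T) (E : int -> T -> T -> Prop).
Hypothesis actM : forall g h x, act (g * h)%g x = act g (act h x).
Hypothesis act1 : forall x, act 1%g x = x.
Hypothesis E_sym : forall e x y, E e x y -> E e y x.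
Hypothesis E_trans : forall e e' x y z, E e x y -> E e' y z -> E (e * e') x z.
Hypothesis E_act : forall g e x y, E e x y -> E e (act g x) (act g y).
Hypothesis E_inj : forall e e' x y, E e x y -> E e' x y -> e = e'.
Hypothesis E_sqr : forall e x y, E e x y -> e * e = 1.
Hypothesis E_fin : forall x y, exists l : seq G, forall g e, E e (act g x) y -> g \in l.

Let orb y x := exists g e, E e (act g x) y.
(** Apart from the default, the choice depends on the predicate alone, so all genuine generators in
    one signed orbit receive the same representative. [list_of] is built in the same way, so
    generators that agree up to sign have the same list of transporters. *)
Let rep_of (Q : T -> Prop) d : T :=
  if pselect (exists x, Q x) is left h then sval (cid h) else d.
Let rep y := rep_of (orb y) y.
Let transporter y g := exists e, E e (act g (rep y)) y.
Let list_of (Q : G -> Prop) : seq G :=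
  if pselect (exists2 l : seq G, uniq l & forall g, g \in l <-> Q g) is left h then s2val (cid2 h) else [::].
Let S y := list_of (transporter y).
Let sgn y g : int := if pselect (transporter y g) is left h then sval (cid h) else 0.

Let orb_self y : E 1 y y -> orb y y.
Proof. by move=> yy; exists 1%g, 1; rewrite act1. Qed.

Let orb_rep y : E 1 y y -> orb y (rep y).
Proof.
move=> /orb_self yy; rewrite /rep /rep_of; case: pselect => [h|[]]; last by exists y.
exact: svalP (cid h).
Qed.

Let sgnP y g e : E e (act g (rep y)) y -> sgn y g = e.
Proof.
move=> Ey; rewrite /sgn; case: pselect => [h|[]]; last by exists e.
exact: E_inj (svalP (cid h)) Ey.
Qed.

Let mem_S y g : g \in S y <-> transporter y g.
Proof.
rewrite /S /list_of; case: pselect => [h|[]]; first exact: s2valP' (cid2 h) g.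
have [l lP] := E_fin (rep y) y.
exists [seq g <- undup l | `[< transporter y g >]]; first by rewrite filter_uniq ?undup_uniq.
move=> h; rewrite mem_filter mem_undup; split=> [/andP[/asboolP]|hy] //.
by rewrite asboolT //; case: hy => e /lP.
Qed.

Let S_uniq y : uniq (S y).
Proof. by rewrite /S /list_of; case: pselect => // h; apply: s2valP (cid2 h). Qed.

Let S_size y : E 1 y y -> (size (S y))%:R != 0 :> rat.
Proof.
move=> /orb_rep [g [e Ey]]; rewrite pnatr_eq0 size_eq0.
have : g \in S y by apply/mem_S; exists e.
by case: (S y).
Qed.

Let EE e x y : E e x y -> E 1 x x /\ E 1 y y.
Proof.
move=> xy; rewrite -(E_sqr xy); split; first exact: E_trans xy (E_sym xy).
exact: E_trans (E_sym xy) xy.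
Qed.

Let rep_eq y y' : E 1 y y -> (forall x, orb y x <-> orb y' x) -> rep y = rep y'.
Proof.
move=> yy Eo; have -> : rep y = rep_of (orb y') y.
  by congr rep_of; apply/funext => x; apply/propext.
rewrite /rep /rep_of; case: pselect => // -[]; exists y; exact/Eo/orb_self.
Qed.

Let rep_sign e y y' : E e y y' -> rep y = rep y'.
Proof.
move=> yy'; apply: rep_eq => [|x]; first by case: (EE yy').
split=> -[g [e' Ex]]; first by exists g, (e' * e); apply: E_trans Ex yy'.
by exists g, (e' * e); apply: E_trans Ex (E_sym yy').
Qed.

Let rep_act h y : E 1 y y -> rep (act h y) = rep y.
Proof.
move=> yy; apply/esym/rep_eq => // x; split=> -[g [e Ex]].
  by exists (h * g)%g, e; rewrite actM; apply: E_act.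
exists (h^-1 * g)%g, e; rewrite actM -[y]act1 -(mulVg h) actM; exact: E_act.
Qed.

Let S_sign e y y' : E e y y' -> S y = S y'.
Proof.
move=> yy'; congr list_of; apply/funext => g; apply/propext; rewrite /transporter (rep_sign yy').
split=> -[e' Ey]; first by exists (e' * e); apply: E_trans Ey yy'.
by exists (e' * e); apply: E_trans Ey (E_sym yy').
Qed.

Variables (N N' : gmodule rat G) (p : ghom N N') (F : T -> N').
Hypothesis p_surj : forall y, exists x, p x = y.
Hypothesis F_act : forall g x, E 1 x x -> F (act g x) = gact g (F x).
Hypothesis F_sign : forall e x y, E e x y -> F x = F y *~ e.

Let lift x : N := sval (cid (p_surj (F x))).
Let liftP x : p (lift x) = F x := svalP (cid (p_surj (F x))).

Let avg y : N := (size (S y))%:R^-1 *: \sum_(g <- S y) gact g (lift (rep y)) *~ sgn y g.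

(* Averaging over the finite set of group elements carrying a fixed orbit
   representative to [y], up to sign. *)
Lemma equivariant_lift : exists phi : T -> N,
  [/\ forall g x, E 1 x x -> phi (act g x) = gact g (phi x),
      forall e x y, E e x y -> phi x = phi y *~ e
    & forall x, E 1 x x -> p (phi x) = F x].
Proof.
exists avg; split=> [h y yy|e y y' yy'|y yy].
- have pS : perm_eq (S (act h y)) [seq (h * g)%g | g <- S y].
    apply: uniq_perm => //; first by rewrite map_inj_uniq //; apply: mulgI.
    move=> g; apply/idP/idP => [/mem_S[e]|/mapP[g' /mem_S[e Ey] ->]]; last first.
      by apply/mem_S; exists e; rewrite rep_act // actM; apply: E_act.
    rewrite rep_act // => Ey; apply/mapP; exists (h^-1 * g)%g; last by rewrite mulVKg.
    apply/mem_S; exists e; rewrite actM -[y in E e _ y]act1 -(mulVg h) actM; exact: E_act.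
  rewrite /avg (perm_size pS) size_map (perm_big _ pS) big_map /= gactZ.
  rewrite (big_morph _ (zmD (gactB h)) (zm0 (gactB h))).
  congr (_ *: _); apply: eq_big_seq => g /mem_S[e Ey].
  rewrite rep_act // gactM (zmMz (gactB h)) (sgnP Ey); congr (_ *~ _).
  by apply: sgnP; rewrite rep_act // actM; apply: E_act.
- rewrite /avg (S_sign yy') (rep_sign yy') scalerMzr mulrz_suml; congr (_ *: _).
  apply: eq_big_seq => g /mem_S[e' Ey']; rewrite -mulrzA (sgnP Ey'); congr (_ *~ _).
  apply: sgnP; rewrite (rep_sign yy'); exact: E_trans Ey' (E_sym yy').
rewrite /avg ghomZ (big_morph _ (zmD (ghomB p)) (zm0 (ghomB p))).
rewrite (eq_big_seq (fun=> F y)) => [|g /mem_S[e Ey]].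
  rewrite big_const_seq count_predT iter_addr_0 -scaler_nat scalerA mulVf ?scale1r //.
  exact: S_size.
(* Each summand is sent to [F y]: moving [F (rep y)] by [g] gives [F y] up to sign, and the sign in
   the average cancels it. *)
rewrite (zmMz (ghomB p)) ghom_act liftP (sgnP Ey) -F_act ?(F_sign Ey) -?mulrzA ?(E_sqr Ey) //.
have [g' [e' /E_sym Er]] := orb_rep yy.
by have [_ /(E_act g'^-1)] := EE Er; rewrite -actM mulVg act1.
Qed.
End Averaging.

(** * Permutations of the lines in every slot *)

Section SlotwisePermutations.
Variables (K : fieldType) (V : vectType K) (m : nat).
Local Notation VS := {vspace V}.
Implicit Types (s t u : 'I_m -> seq VS) (e : int).

Definition permuted_by e s t := exists (N : 'I_m -> nat) (sigma : forall i, 'S_(N i)),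
  [/\ forall i, size (s i) = N i, t = (fun i => permuted 0%VS (s i) (sigma i))
    & e = \prod_i (-1) ^+ sigma i].

Lemma permuted_by_refl s : permuted_by 1 s s.
Proof.
exists (fun i => size (s i)), (fun=> 1%g); split=> //.
  by apply: functional_extensionality_dep => i; rewrite permuted1.
by rewrite big1 // => i _; rewrite odd_perm1.
Qed.

Lemma permuted_by_sym e s t : permuted_by e s t -> permuted_by e t s.
Proof.
move=> [N [sigma [sN -> ->]]]; exists N, (fun i => (sigma i)^-1%g); split=> [i||].
- exact: size_permuted.
- by apply: functional_extensionality_dep => i; rewrite -permutedM mulVg permuted1.
by apply: eq_bigr => i _; rewrite odd_permV.
Qed.

Lemma permuted_by_trans e e' s t u :
  permuted_by e s t -> permuted_by e' t u -> permuted_by (e * e') s u.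
Proof.
move=> [N [sigma [sN -> ->]]] [N' [tau [tN -> ->]]].
have EN : N' = N by apply: functional_extensionality_dep => i; rewrite -tN size_permuted.
subst N'; exists N, (fun i => tau i * sigma i)%g; split=> //.
  by apply: functional_extensionality_dep => i; rewrite -permutedM.
by rewrite -big_split; apply: eq_bigr => i _; rewrite odd_permM signr_addb mulrC.
Qed.

Lemma permuted_by_sqr e s t : permuted_by e s t -> e * e = 1.
Proof.
by move=> [N [sigma [_ _ ->]]]; rewrite -big_split big1 // => i _; rewrite /= -signr_addb addbb.
Qed.

(** The lines of a frame are distinct, so the permutation in each slot is determined and with it the
    sign. Hence no generator is identified with its negative. *)
Lemma permuted_by_inj e e' s t : (forall i, uniq (s i)) ->
  permuted_by e s t -> permuted_by e' s t -> e = e'.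
Proof.
move=> us [N [sigma [sN -> ->]]] [N' [tau [sN' Et ->]]].
have EN : N' = N by apply: functional_extensionality_dep => i; rewrite -sN' sN.
subst N'; apply: eq_bigr => i _; congr (_ ^+ nat_of_bool (odd_perm _)); apply/permP => j.
have := congr1 (fun t => nth 0%VS (t i) j) Et; rewrite !nth_permuted => /eqP.
by rewrite nth_uniq ?sN ?ltn_ord // => /eqP/val_inj.
Qed.

Lemma permuted_by_limgs f e s t : permuted_by e s t ->
  permuted_by e (fun i => limgs f (s i)) (fun i => limgs f (t i)).
Proof.
move=> [N [sigma [sN -> ->]]]; exists N, sigma; split=> // [i|]; first by rewrite size_map.
apply: functional_extensionality_dep => i; rewrite /limgs /permuted -map_comp.
by apply: eq_map => j /=; rewrite nth_limgs.
Qed.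

Lemma permuted_by_frame e s t k W : permuted_by e s t ->
  (forall i, is_frame (k i) (W i) (s i)) -> forall i, is_frame (k i) (W i) (t i).
Proof.
by move=> [N [sigma [sN -> _]]] sW i; rewrite (is_frame_perm _ _ (perm_permuted _ _ (sN i))).
Qed.

Lemma permuted_by_upd s i (t : seq VS) N (sigma : 'S_N) : size (s i) = N ->
  t = permuted 0%VS (s i) sigma -> permuted_by ((-1) ^+ sigma) s (upd s i t).
Proof.
move=> sN; subst N => ->.
exists (fun j => size (s j)), (dfwith (fun j => 1%g : 'S_(size (s j))) sigma); split=> //.
  apply: functional_extensionality_dep => j; case: dfwithP => [|j' ij']; first by rewrite upd_eq.
  by rewrite permuted1 // upd_neq // eq_sym.
rewrite (bigD1 i) //= dfwith_in big1 ?mulr1 // => j ji.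
by rewrite dfwith_out 1?eq_sym // odd_perm1.
Qed.

Section Values.
Variables (P : ('I_m -> nat) -> ('I_m -> VS) -> Prop) (B : zmodType).
Variable phi : ('I_m -> nat) -> ('I_m -> VS) -> ('I_m -> seq VS) -> B.

Lemma alternating_permuted_by k W e s t : alternating P phi -> P k W ->
  (forall i, is_frame (k i) (W i) (s i)) -> permuted_by e s t -> phi k W s = phi k W t *~ e.
Proof.
move=> A kW sW [N [sigma [sN -> ->]]]; pose t' i := permuted 0%VS (s i) (sigma i).
suff H (r : seq 'I_m) : uniq r -> phi k W s =
    phi k W (fun i => if i \in r then t' i else s i) *~ \prod_(i <- r) (-1) ^+ sigma i.
  rewrite (H (enum 'I_m)) ?enum_uniq // big_enum; congr (phi k W _ *~ _).
  by apply: functional_extensionality_dep => i; rewrite mem_enum.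
have tW i : is_frame (k i) (W i) (t' i) by rewrite (is_frame_perm _ _ (perm_permuted _ _ (sN i))).
elim: r => [|i r IHr] /= => [_|/andP[ir ur]]; first by rewrite big_nil mulr1z.
rewrite IHr // big_cons mulrzA; congr (_ *~ _).
rewrite (A k W _ i (t' i) _ (sigma i)) //; last 3 first.
- by move=> j; case: ifP.
- by rewrite (negPf ir).
- by rewrite (negPf ir).
congr (phi k W _ *~ _); apply: functional_extensionality_dep => j.
by have [->|ji] := eqVneq j i; rewrite ?upd_eq ?mem_head // upd_neq // in_cons (negPf ji).
Qed.

Lemma permuted_by_alternating : (forall k W e s t, P k W -> (forall i, is_frame (k i) (W i) (s i)) ->
    permuted_by e s t -> phi k W s = phi k W t *~ e) -> alternating P phi.
Proof. by move=> H k W s i t N sigma kW sW tW sN Et; apply: H => //; apply: permuted_by_upd. Qed.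
End Values.
End SlotwisePermutations.

Section ProjectiveSharblies.
Variables (K : fieldType) (V : vectType K) (om : {skew_symmetric V}) (G : groupType).
Variables (rho : isom_action om G) (m : nat).
Local Notation VS := {vspace V}.
Variable P : ('I_m -> nat) -> ('I_m -> VS) -> Prop.
Hypothesis PG : forall g k W, P k W -> P k (fun i => (rho g @: W i)%VS).

Definition finite_transporters := forall k W (s t : 'I_m -> seq VS), P k W ->
  (forall i, is_frame (k i) (W i) (s i)) -> exists l : seq G, forall g,
  (exists e, permuted_by e (fun i => limgs (rho g) (s i)) t) -> g \in l.

Let T : Type := (('I_m -> nat) * ('I_m -> VS) * ('I_m -> seq VS))%type.
Let act g (x : T) : T := (x.1.1, fun i => (rho g @: x.1.2 i)%VS, fun i => limgs (rho g) (x.2 i)).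
(** The first two clauses single out the triples that index an actual generator; the decomposition
    has to be the same for both, only the lines within its slots are permuted. *)
Let E e (x y : T) := [/\ P x.1.1 x.1.2, forall i, is_frame (x.1.1 i) (x.1.2 i) (x.2 i),
  x.1 = y.1 & permuted_by e x.2 y.2].
Let elt (x : T) : shsum P := shelt P x.1.1 x.1.2 x.2.

Let E_self x : P x.1.1 x.1.2 -> (forall i, is_frame (x.1.1 i) (x.1.2 i) (x.2 i)) -> E 1 x x.
Proof. by move=> Px fx; split=> //; apply: permuted_by_refl. Qed.

Lemma projective_sharbly_module : finite_transporters -> projective (grext (sharbly_module PG)).
Proof.
move=> fin; apply: projective_grext => N N' p F ps FB F_gact.
have elt_act g x : E 1 x x -> elt (act g x) = shact PG g (elt x).
  by case=> Px fx _ _; apply/esym/shact_shelt.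
have elt_sign e x y : E e x y -> elt x = elt y *~ e.
  case: x y => [[k W] s] [[k' W'] t] [/= Px fx [<- <-] st].
  exact: (alternating_permuted_by (@shelt_alternating _ _ _ P) Px fx st).
have actM g h x : act (g * h)%g x = act g (act h x).
  by congr (_, _, _); apply: functional_extensionality_dep => i; rewrite ?limg_iactM ?limgs_iactM.
have act1 x : act 1%g x = x.
  case: x => [[k W] s]; congr (_, _, _); apply: functional_extensionality_dep => i;
    by rewrite ?limg_iact1 ?limgs_iact1.
have E_sym e x y : E e x y -> E e y x.
  by case=> Px fx Exy st; split; rewrite -?Exy //; [exact: permuted_by_frame st fx|exact: permuted_by_sym].
have E_trans e e' x y z : E e x y -> E e' y z -> E (e * e') x z.
  by case=> Px fx xy1 xy [_ _ yz1 yz]; split=> //; [rewrite xy1|exact: permuted_by_trans xy yz].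
have E_act g e x y : E e x y -> E e (act g x) (act g y).
  case=> Px fx Exy xy; split; [exact: PG| |by rewrite /= Exy|exact: permuted_by_limgs].
  by move=> i; rewrite is_frame_limgs; [apply: fx|apply: iact_inj].
have E_inj e e' x y : E e x y -> E e' x y -> e = e'.
  case=> _ fx _ xy [_ _ _ xy']; apply: permuted_by_inj xy xy' => i.
  by case/and4P: (fx i).
have E_sqr e x y : E e x y -> e * e = 1 by case=> _ _ _ /permuted_by_sqr.
have E_fin x y : exists l : seq G, forall g e, E e (act g x) y -> g \in l.
  have [[Px fx]|nx] := pselect (P x.1.1 x.1.2 /\ forall i, is_frame (x.1.1 i) (x.1.2 i) (x.2 i)).
    have [l lP] := fin _ _ _ y.2 Px fx; exists l => g e [_ _ _ xy].
    by apply: lP; exists e.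
  exists [::] => g e /(E_act g^-1%g) [Px fx _ _]; case: nx; split.
    by move: Px; rewrite -actM mulVg act1.
  by move: fx; rewrite -actM mulVg act1.
have F_act g x : E 1 x x -> F (elt (act g x)) = gact g (F (elt x)).
  by move/(elt_act g)->; apply: F_gact.
have F_sign e x y : E e x y -> F (elt x) = F (elt y) *~ e.
  by move/elt_sign->; apply: (zmMz FB).
have [phi [phi_act phi_sign p_phi]] := equivariant_lift actM act1 E_sym E_trans E_act E_inj E_sqr
  E_fin (F := fun x => F (elt x)) ps F_act F_sign.
pose val k W s : N := phi (k, W, s).
have A : alternating P val.
  apply: permuted_by_alternating => k W e s t kW sW st.
  exact: (phi_sign e (k, W, s) (k, W, t)).
exists (shlift val); split; first exact: shliftB A.
- move=> g; elim/shsum_ind => [|x y Ex Ey|k W s kW sW].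
  + by rewrite !(zm0 (gactB g)) !(zm0 (shliftB A)) (zm0 (gactB g)).
  + by rewrite (gactB g) !(shliftB A) (gactB g) Ex Ey.
  rewrite [gact g _]shact_shelt // (shlift_shelt A) ?(shlift_shelt A) //; last first.
    by move=> i; rewrite is_frame_limgs //; apply: iact_inj.
    exact: PG.
  exact: (phi_act g (k, W, s) (E_self (x := (k, W, s)) kW sW)).
elim/shsum_ind => [|x y Ex Ey|k W s kW sW].
- by rewrite (zm0 (shliftB A)) (zm0 (ghomB p)) (zm0 FB).
- by rewrite (shliftB A) (ghomB p) Ex Ey FB.
rewrite (shlift_shelt A) //; exact: (p_phi (k, W, s) (E_self (x := (k, W, s)) kW sW)).
Qed.
End ProjectiveSharblies.

(** * Finiteness of stabilizers *)

Section IntegralVectors.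
Variable R : idomainType.
Hypothesis R_pid : is_pid R.
Local Notation K := {fraction R}.
Local Notation F := (to_frac R).

Lemma fraction_clear (x : K) : exists a b, b != 0 /\ x * F b = F a.
Proof.
elim/quotW: x => x; exists \n_x, \d_x; split; first exact: denom_ratioP.
change (FracField.mul (\pi_(FracField.type R)%qT x) (@FracField.tofrac R \d_x) = @FracField.tofrac R \n_x).
rewrite !piE; apply/eqmodP; rewrite /= FracField.equivfE /FracField.mulf.
by rewrite !numden_Ratio ?mulf_neq0 ?oner_neq0 ?denom_ratioP //= !mulr1 mulrC.
Qed.

Lemma map_frac_inj m p : injective (map_mx F : 'M[R]_(m, p) -> 'M[K]_(m, p)).
Proof.
move=> A B /matrixP AB; apply/matrixP => i j; apply/eqP.
by rewrite -(tofrac_eq (A i j)); have := AB i j; rewrite !mxE => /eqP.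
Qed.

(** Clear denominators and divide by a generator [g] of the ideal spanned by the coordinates. The
    row [w] is a Bezout certificate that [u] is primitive; it later extracts scalars from multiples
    of [u]. *)
Lemma unimodular_vector N (v : 'cV[K]_N) : v != 0 ->
  exists (u : 'cV[R]_N) (w : 'rV[R]_N) c, [/\ w *m u = 1%:M, c != 0 & v = c *: map_mx F u].
Proof.
move=> v0; have [a a_v] := choice (fun i => fraction_clear (v i 0)).
have [b b_v] := choice a_v; pose D := \prod_i b i.
have D0 : D != 0 by apply/prodf_neq0 => i _; case: (b_v i).
pose v' : 'cV[R]_N := \col_i (a i * \prod_(l | l != i) b l).
have Dv : F D *: v = map_mx F v'.
  apply/colP => i; rewrite !mxE rmorphM; have [_ <-] := b_v i.
  by rewrite /D (bigD1 i) //= rmorphM [LHS]mulrC mulrA.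
pose I x := exists w : 'rV[R]_N, x = (w *m v') 0 0.
have I0 : I 0 by exists 0; rewrite mul0mx mxE.
have ID x y z : I y -> I z -> I (x * y + z).
  by move=> [w ->] [w' ->]; exists (x *: w + w'); rewrite mulmxDl -scalemxAl !mxE.
have [g gP] := R_pid I0 ID.
have /choice[u uP] : forall i, exists c, v' i 0 = c * g.
  move=> i; apply/gP; exists (delta_mx 0 i).
  by rewrite -rowE !mxE.
have v'u : v' = g *: \col_i u i by apply/colP => i; rewrite uP !mxE mulrC.
have [w gw] : exists w : 'rV[R]_N, g = (w *m v') 0 0 by apply/gP; exists 1; rewrite mul1r.
have g0 : g != 0.
  apply: contraNneq v0 => g0; have := Dv; rewrite v'u g0 scale0r map_mx0 => /eqP.
  by rewrite scaler_eq0 tofrac_eq0 (negPf D0).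
exists (\col_i u i), w, (F g / F D); split.
- rewrite [LHS]mx11_scalar; congr (_%:M); apply: (mulfI g0).
  by rewrite mulr1 [RHS]gw v'u -scalemxAr [RHS]mxE.
- by rewrite mulf_neq0 ?invr_eq0 ?tofrac_eq0.
apply: (scalerI (a := F D)); first by rewrite tofrac_eq0.
rewrite Dv v'u scalerA mulrC divfK ?tofrac_eq0 //.
by apply/colP => i; rewrite !mxE rmorphM.
Qed.

Lemma unimodular_line N : exists u : {vspace 'cV[K]_N} -> 'cV[R]_N * 'rV[R]_N,
  forall L, \dim L = 1%N -> (u L).2 *m (u L).1 = 1%:M /\ L = <[map_mx F (u L).1]>%VS.
Proof.
suff /choice[u uP] : forall L : {vspace 'cV[K]_N}, exists u : 'cV[R]_N * 'rV[R]_N,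
    \dim L = 1%N -> u.2 *m u.1 = 1%:M /\ L = <[map_mx F u.1]>%VS by exists u.
move=> L; have [/eqP dL|dL] := boolP (\dim L == 1%N); last first.
  by exists (0, 0) => dL'; rewrite dL' eqxx in dL.
have [v v0 ->] := dim1P _ (introT eqP dL); have [u [w [c [wu c0 ->]]]] := unimodular_vector v0.
exists (u, w) => _; split=> //; apply/eqP; rewrite eqEsubv -!memvE memvZ ?memv_line //.
by apply/vlineP; exists c^-1; rewrite scalerA mulVf // scale1r.
Qed.
End IntegralVectors.

Lemma bounded_seqs (T : eqType) (B : seq T) N :
  exists l : seq (seq T), forall s, size s = N -> {subset s <= B} -> s \in l.
Proof.
elim: N => [|N [l lP]]; first by exists [:: [::]] => s /size0nil->.
exists [seq x :: s | x <- B, s <- l] => -[|x s] //= [sN] sB.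
apply/allpairsP; exists (x, s); split=> //; first by rewrite sB ?mem_head.
by apply: lP => // y ys; rewrite sB // in_cons ys orbT.
Qed.

Lemma finite_preimage (T T' : eqType) (f : T -> T') (b : seq T') : injective f ->
  exists l : seq T, forall x, f x \in b -> x \in l.
Proof.
move=> f_inj; elim: b => [|y b [l lP]]; first by exists [::].
have [[x0 fx0]|nx] := pselect (exists x, f x = y); last first.
  by exists l => x; rewrite in_cons => /orP[/eqP fx|/lP//]; case: nx; exists x.
exists (x0 :: l) => x; rewrite !in_cons => /orP[/eqP fx|/lP->]; last exact: orbT.
by rewrite (f_inj x x0) ?eqxx // fx fx0.
Qed.

Lemma lfun_eq_sum (K : fieldType) (U U' : vectType K) (f g : 'Hom(U, U')) (Ls : seq {vspace U}) :
  (forall L, L \in Ls -> forall y, y \in L -> f y = g y) ->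
  forall x, x \in (\sum_(L <- Ls) L)%VS -> f x = g x.
Proof.
elim: Ls => [|L s IHs] fg x; first by rewrite big_nil memv0 => /eqP->; rewrite !linear0.
rewrite big_cons => /memv_addP[y yL [z zs ->]]; rewrite !linearD /= (fg L (mem_head _ _) y yL).
by rewrite (IHs _ z) // => L' L's; apply: fg; rewrite in_cons L's orbT.
Qed.

Section FiniteTransporters.
Variables (R : idomainType) (n : nat).
Hypothesis R_pid : is_pid R.
Local Notation K := {fraction R}.
Local Notation F := (to_frac R).
Local Notation V := 'cV[K]_(n + n).
Local Notation VS := {vspace V}.

Variable u : VS -> 'cV[R]_(n + n) * 'rV[R]_(n + n).
Hypothesis uP : forall L, \dim L = 1%N -> (u L).2 *m (u L).1 = 1%:M /\ L = <[map_mx F (u L).1]>%VS.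

Lemma sp_lfun_inj (A B : Sp R n) : sp_lfun F A = sp_lfun F B -> A = B.
Proof.
move=> AB; apply: val_inj; apply: (@map_frac_inj R); apply/matrixP => i j.
have := congr1 (fun f : 'End(V) => f (delta_mx j 0) i 0) AB.
by rewrite /= !sp_lfunE -!colE !mxE.
Qed.

Lemma sp_line_scale (A : Sp R n) L L' : \dim L = 1%N -> \dim L' = 1%N ->
  (sp_lfun F A @: L)%VS = L' -> exists r, val A *m (u L).1 = r *: (u L').1.
Proof.
move=> dL dL' AL; have [wu LE] := uP dL; have [wu' LE'] := uP dL'.
have : sp_lfun F A (map_mx F (u L).1) \in L' by rewrite -AL memv_img // {2}LE memv_line.
rewrite {1}LE' => /vlineP[c]; rewrite sp_lfunE -map_mxM => E.
(* A priori the scalar lies in the fraction field; applying the Bezout row of [L'] exhibits it as an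
   element of [R]. *)
exists (((u L').2 *m (val A *m (u L).1)) 0 0); apply: (@map_frac_inj R); rewrite E map_mxZ.
congr (_ *: _); have := congr1 (fun x => (map_mx F (u L').2 *m x) 0 0) E.
rewrite -scalemxAr -!map_mxM wu' => /esym.
by rewrite [LHS]mxE map_mx1 !mxE eqxx mulr1.
Qed.

(** The scalars obtained for [A] and for its inverse multiply to 1, which is checked by applying the
    Bezout row of [L]. *)
Lemma sp_line_unit (A : Sp R n) L L' : \dim L = 1%N -> (sp_lfun F A @: L)%VS = L' ->
  exists2 r, r \is a GRing.unit & val A *m (u L).1 = r *: (u L').1.
Proof.
move=> dL AL.
have dL' : \dim L' = 1%N by rewrite -AL limg_dim // (iact_inj (sp_action F n) A).
have AL' : (sp_lfun F A^-1%g @: L')%VS = L.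
  by rewrite -AL -(limg_iactM (sp_action F n)) mulVg (limg_iact1 (sp_action F n)).
have [r rP] := sp_line_scale dL dL' AL; have [r' rP'] := sp_line_scale dL' dL AL'.
exists r => //; have [wu _] := uP dL.
have E : (u L).1 = (r * r') *: (u L).1.
  rewrite -scalerA -rP' scalemxAr -rP mulmxA.
  have -> : val (A^-1)%g *m val A = val (A^-1 * A)%g by [].
  by rewrite mulVg mul1mx.
have := congr1 (fun x => ((u L).2 *m x) 0 0) E; rewrite -scalemxAr wu !mxE eqxx mulr1 => rr.
by apply/unitrP; exists r'; rewrite mulrC -rr.
Qed.

(** A matrix is determined by its values on the primitive generators of lines spanning the space,
    and each value is one of the finitely many unit multiples of generators of lines in [Lt]. *)
Lemma sp_lines_finite (units : seq R) (Ls Lt : seq VS) :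
  (forall r, r \is a GRing.unit -> r \in units) -> {in Ls, forall L, \dim L = 1%N} ->
  (\sum_(L <- Ls) L)%VS = fullv ->
  exists l : seq (Sp R n), forall A,
    {in Ls, forall L, (sp_lfun F A @: L)%VS \in Lt} -> A \in l.
Proof.
move=> uR dLs sLs; pose ev (A : Sp R n) := [seq val A *m (u L).1 | L <- Ls].
have ev_inj : injective ev.
  move=> A B /eq_in_map AB; apply: sp_lfun_inj; apply/lfunP => x.
  apply: (lfun_eq_sum (Ls := Ls)); last by rewrite sLs memvf.
  move=> L LLs y; have [_ {1}->] := uP (dLs L LLs); case/vlineP => c ->.
  by rewrite !linearZ /= !sp_lfunE -!map_mxM AB.
have [b bP] := bounded_seqs [seq r *: (u L).1 | r <- units, L <- Lt] (size Ls).
have [l lP] := finite_preimage b ev_inj; exists l => A AL; apply/lP/bP; first exact: size_map.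
move=> _ /mapP[L LLs ->]; have [r ru E] := sp_line_unit (A := A) (dLs L LLs) erefl.
by apply/allpairsP; exists (r, (sp_lfun F A @: L)%VS); rewrite uR // AL.
Qed.
End FiniteTransporters.

Lemma sp_finite_transporters (R : idomainType) n m
    (P : ('I_m -> nat) -> ('I_m -> {vspace 'cV[{fraction R}]_(n + n)}) -> Prop) :
  is_pid R -> finitely_many_units R -> (forall k W, P k W -> (\sum_i W i)%VS = fullv) ->
  finite_transporters (sp_action (to_frac R) n) P.
Proof.
move=> pid [units uR] PW k W s t kW sW; have [u uP] := unimodular_line pid (n + n).
pose lines (s : 'I_m -> seq {vspace 'cV[{fraction R}]_(n + n)}) := flatten [seq s i | i <- enum 'I_m].
have [||l lP] := @sp_lines_finite R n u uP units (lines s) (lines t) uR.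
- by move=> L /flatten_mapP[i _ Ls]; case/and4P: (sW i) => _ _ /allP/(_ L Ls)/eqP.
- rewrite -(PW k W kW) big_flatten big_map big_enum; apply: eq_bigr => i _.
  by case/and4P: (sW i) => _ _ _ /eqP.
exists l => A [e [N [sigma [sN Et _]]]]; apply: lP => L /flatten_mapP[i _ Ls].
apply/flatten_mapP; exists i; first by rewrite mem_enum.
rewrite Et (perm_mem (perm_permuted _ _ (sN i))); exact: map_f.
Qed.

Theorem corollary1p4 (R : idomainType) (n : nat)
    (R_pid : is_pid R) (n_gt0 : (0 < n)%N) :
  let K := {fraction R} in
  let V := 'cV[K]_(n + n) in
  let om : {skew_symmetric V} := @st_form K n in
  let V0 := modV0 (to_frac R) n in
  let V11 := modV11 (to_frac R) n in
  let V12 := modV12 (to_frac R) n in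
  let St := modSt (to_frac R) n in
  exists (d1 : ghom (gprod V12 V11) V0) (eps : ghom V0 St),
  [/\ forall (W : 'I_n -> {vspace V}) (i : 'I_n) (s : 'I_n -> seq {vspace V})
          (u v w : {vspace V}),
        perp_decomp om (fun=> 1%N) W ->
        (forall j, j != i -> is_frame 0 (W j) (s j)) ->
        is_frame 1 (W i) [:: u; v; w] ->
        d1 (0, elt11 (to_frac R) i W [eta s with i |-> [:: u; v; w]]) =
          elt0 (to_frac R) W [eta s with i |-> [:: v; w]]
          - elt0 (to_frac R) W [eta s with i |-> [:: u; w]]
          + elt0 (to_frac R) W [eta s with i |-> [:: u; v]],
      forall (W : 'I_n.-1 -> {vspace V}) (i : 'I_n.-1)
          (s : 'I_n.-1 -> seq {vspace V}),
        perp_decomp om (fun j => (j == i).+1) W ->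
        (forall j, is_frame 0 (W j) (s j)) ->
        d1 (elt12 (to_frac R) W s, 0) =
          \sum_(j1 < 4) \sum_(j2 < 4 | (j1 < j2)%N)
            let v j := nth 0%VS (s i) j in
            let X := (v j1 + v j2)%VS in
            let Y := (orthov om X :&: W i)%VS in
            let yz := [seq (daddv_pi Y X @: v j)%VS
                      | j : nat <- iota 0 4 & (j != j1) && (j != j2)] in
            if symplectic om 1 X then
              (-1) ^+ (j1 + j2 + (n - 1 - i.+1)) *:
                elt0 (to_frac R) (splice i X Y W)
                  (splice i [:: v j1; v j2] yz s)
            else 0,
      presentation d1 eps
    & finitely_many_units R ->
      [/\ presentation (grmap d1) (grmap eps),
          projective (grext (gprod V12 V11))
        & projective (grext V0)]].
Proof.
move=> K V om V0 V11 V12 St; exists (d1 (to_frac R) n), (eps (to_frac R) n); split.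
- by move=> W i s u v w Wd sf fi; apply: d1_elt11.
- move=> W i s Wd sf; rewrite (d1_elt12 (to_frac R) Wd sf).
  apply: eq_bigr => j1 _; apply: eq_bigr => j2 _; rewrite /d12_term; cbv zeta.
  by case: ifP => // _; rewrite int_scaleE.
- exact: presentation_d1.
move=> units; have fin0 := sp_finite_transporters R_pid units.
split; first exact: presentation_grmap (presentation_d1 _ _).
- apply: projective_gprod; apply/projective_sharbly_module/fin0.
  + by move=> k W [_ [i [_ _ _ ->]]].
  by move=> k W [_ [_ _ _ ->]].
apply/projective_sharbly_module/fin0.
by move=> k W [_ [_ _ _ ->]].
Qed.
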